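(* Let $d\ge 2$ and let $\tau_i\colon\mathcal A_i^*\to\mathcal A_i^*$, $i=0,\ldots,d-1$, be a collection of positive and prolongable substitutions, all of constant length with the same length. Let $\boldsymbol\sigma=(\sigma_n\colon\Lambda_d^*\to\Lambda_d^* )_{n\in\mathbb N}$ be the directive sequence of glued substitutions $\sigma_n=\Gamma(\tau_0^{n+1},\ldots,\tau_{d-1}^{n+1})$. Then the $\mathcal S$-adic subshift $(X_{\boldsymbol\sigma},S)$ is minimal and has $d$ ergodic measures $\mu_0,\ldots,\mu_{d-1}$ such that for every $i\in\{0,\ldots,d-1\}$ $$\lim_{n\to\infty}\mu_i^{(n)}([w])=\nu_i([w])\qquad\text{for all } w\in\mathcal A_i^*,$$ where $\nu_i$ is the unique invariant measure of the substitution subshift $(X_{\tau_i},S)$.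
   Context: Alphabets: $\mathcal A_i=\{a_i,b_i\}$, $i\in\{0,\ldots,d-1\}$, are pairwise disjoint two-letter alphabets and $\Lambda_d=\bigcup_{i=0}^{d-1}\mathcal A_i$. A morphism $\tau\colon A^*\to A^*$ is a substitution if $|\tau^n(c)|\to\infty$ for every $c\in A$; it is positive if every letter of $A$ occurs in $\tau(c)$ for every $c\in A$; it is prolongable if for every $c\in A$ the word $\tau(c)$ both starts and ends with $c$; it has constant length $\ell$ if $|\tau(c)|=\ell$ for all $c\in A$. $X_\tau$ is the set of $x\in A^{\mathbb Z}$ all of whose finite subwords occur in $\tau^N(c)$ for some $c\in A$, $N\ge1$. Gluing: $\kappa\colon\Lambda_d^*\to\Lambda_d^*$ changes only the last letter of a (nonempty) word: $\kappa(ua_i)=ua_{i+1}$, $\kappa(ub_i)=ub_{i+1}$, with index modulo $d$. $\Gamma(\tau_0,\ldots,\tau_{d-1})\colon\Lambda_d^*\to\Lambda_d^*$ is the morphism $a_i\mapsto\kappa(\tau_i(a_i))$, $b_i\mapsto\kappa(\tau_i(b_i))$. $\mathcal S$-adic subshifts: for $\boldsymbol\sigma=(\sigma_n\colon A_{n+1}^*\to A_n^* )_{n\in\mathbb N}$, $\mathbb N=\{0,1,\ldots\}$, put $\sigma_{[n,N)}=\sigma_n\circ\cdots\circ\sigma_{N-1}$; $\mathcal L^{(n)}(\boldsymbol\sigma)$ is the set of words occurring in some $\sigma_{[n,N)}(c)$, $c\in A_N$, $N>n$; $X^{(n)}_{\boldsymbol\sigma}$ is the set of $x\in A_n^{\mathbb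 Z}$ all of whose finite subwords lie in $\mathcal L^{(n)}(\boldsymbol\sigma)$; $X_{\boldsymbol\sigma}=X^{(0)}_{\boldsymbol\sigma}$; $S$ is the shift. Induced measures: let $h^{(n)}=|\sigma_{[0,n)}|$ be the common length of the words $\sigma_{[0,n)}(c)$. By recognizability, for each invariant probability measure $\mu$ on $X_{\boldsymbol\sigma}$ and $n\in\mathbb N$ there is a unique invariant probability measure $\mu^{(n)}$ on $X_{\boldsymbol\sigma}^{(n)}$ with $\mu=\frac1{h^{(n)}}\sum_{0\le k<h^{(n)}}(S^k\circ\sigma_{[0,n)})_*\mu^{(n)}$ (the measure induced by $\mu$ on the base $\sigma_{[0,n)}(X^{(n)}_{\boldsymbol\sigma})$). Measures on $\mathcal A_i^{\mathbb Z}$ or on subshifts of $\Lambda_d^{\mathbb Z}$ are regarded as measures on $\Lambda_d^{\mathbb Z}$; $[w]$ is the cylinder of sequences $x$ with $x_{[0,|w|)}=w$. *)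

(* Defs.v *)
From HB Require Import structures.
From mathcomp Require Import all_boot all_order all_algebra.
From mathcomp Require Import all_classical all_reals all_analysis.

Set Implicit Arguments.
Unset Strict Implicit.
Unset Printing Implicit Defensive.

Import Order.TTheory GRing.Theory Num.Theory.
Local Open Scope classical_set_scope.
Local Open Scope ring_scope.

(* A morphism [A^* -> A^*] is given by the images of the letters;
   [mext] is its extension to words. *)
Definition morph (A : Type) := A -> seq A.

Definition mext (A : Type) (s : morph A) (w : seq A) : seq A :=
  flatten [seq s c | c <- w].

Definition mpow (A : Type) (s : morph A) (n : nat) : morph A :=
  fun c => iter n (mext s) [:: c].

Definition substitution (A : Type) (s : morph A) :=
  forall c, (fun n => size (mpow s n c)) @ \oo --> \oo.

Definition positive (A : eqType) (s : morph A) :=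
  forall b c : A, b \in s c.

Definition prolongable (A : Type) (s : morph A) :=
  forall c, exists u v, s c = c :: u /\ s c = rcons v c.

Definition constant_length (A : Type) (l : nat) (s : morph A) :=
  forall c, size (s c) = l.

Definition biseq (A : Type) := {ptws int -> discrete_topology A}.

Definition bishift (A : Type) (x : biseq A) : biseq A := fun j => x (j + 1).

Definition window (A : Type) (x : biseq A) (j : int) (n : nat) : seq A :=
  [seq x (j + k%:Z) | k <- iota 0 n].

Definition cylinder (A : Type) (w : seq A) : set (biseq A) :=
  [set x | window x 0 (size w) = w].

Definition subshift_of (A : Type) (L : set (seq A)) : set (biseq A) :=
  [set x | forall j n, L (window x j n)].

Definition substitution_subshift (A : eqType) (s : morph A) : set (biseq A) :=
  subshift_of
    [set w | exists c N, (1 <= N)%N /\ seq.infix w (mpow s N c)].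

(* The action on [A^Z] of a morphism of constant length; the length is read
   off at the arbitrary letter [point]. The operations [%/] and [%%] are those
   of [intdiv], with nonnegative remainder, so that the image of [x 0] occupies
   the positions [0, ..., h - 1]. *)
Definition mlength (A : pointedType) (s : morph A) : nat := size (s point).

Definition bimorph (A : pointedType) (s : morph A) (x : biseq A) : biseq A :=
  let h := (mlength s)%:Z in
  fun j => nth (x 0) (s (x (j %/ h)%Z)) `|(j %% h)%Z|%N.

Definition minimal_subshift (A : choiceType) (X : set (biseq A)) :=
  X !=set0 /\
  forall Y : set (biseq A), closed Y -> Y `<=` X ->
    Y `<=` @bishift A @^-1` Y -> Y = set0 \/ Y = X.

Definition borel_biseq (A : pointedType) :=
  g_sigma_algebraType (@open (biseq A)).

(* Measures are total functions on sets, with unspecified values outside the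
   sigma-algebra, so they are compared on measurable sets only. *)
Definition same_measure (A : pointedType) (R : realType)
    (m m' : probability (borel_biseq A) R) :=
  forall E : set (borel_biseq A), measurable E -> m E = m' E.

Definition the_only_measure (A : pointedType) (R : realType)
    (P : probability (borel_biseq A) R -> Prop)
    (m : probability (borel_biseq A) R) :=
  P m /\ forall m', P m' -> same_measure m' m.

(* Invariant probability measures on [X], seen as measures on [A^Z]. *)
Definition invariant_measure (A : pointedType) (R : realType)
    (X : set (biseq A)) (m : probability (borel_biseq A) R) :=
  m X = 1%E /\
  forall E : set (borel_biseq A), measurable E ->
    pushforward m (@bishift A : borel_biseq A -> borel_biseq A) E = m E.

Definition ergodic_measure (A : pointedType) (R : realType)
    (X : set (biseq A)) (m : probability (borel_biseq A) R) :=
  invariant_measure X m /\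
  forall E : set (borel_biseq A), measurable E ->
    @bishift A @^-1` E = E -> m E = 0%E \/ m E = 1%E.

(* [srange s n N] is [s_n o ... o s_(N-1)]. *)
Definition srange (A : Type) (s : nat -> morph A) (n N : nat) : morph A :=
  fun c => foldr (fun k w => mext (s k) w) [:: c] (index_iota n N).

Definition slanguage (A : eqType) (s : nat -> morph A) (n : nat) :
    set (seq A) :=
  [set w | exists c N, (n < N)%N /\ seq.infix w (srange s n N c)].

Definition ssubshift (A : eqType) (s : nat -> morph A) (n : nat) :
    set (biseq A) :=
  subshift_of (slanguage s n).

Definition induced_measure (A : pointedType) (R : realType)
    (s : nat -> morph A) (mu : probability (borel_biseq A) R) (n : nat)
    (m : probability (borel_biseq A) R) :=
  let h := mlength (srange s 0 n) in
  invariant_measure (ssubshift s n) m /\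
  forall E : set (borel_biseq A), measurable E ->
    mu E = ((h%:R^-1)%:E *
      \sum_(0 <= k < h)
        pushforward m
          (iter k (@bishift A) \o bimorph (srange s 0 n)
             : borel_biseq A -> borel_biseq A) E)%E.

HB.instance Definition _ (n : nat) := isPointed.Build 'I_n.+1 ord0.

(* For [1 < d], the disjoint union of the alphabets [{a_i, b_i}], [i < d]:
   [(i, false)] is [a_i] and [(i, true)] is [b_i], with the indices in Z/dZ.
   Each alphabet [{a_i, b_i}] is identified with [bool]. *)
Definition letter (d : nat) := ('Z_d * bool)%type.

Definition in_alphabet (d : nat) (i : 'Z_d) (w : seq bool) : seq (letter d) :=
  [seq (i, e) | e <- w].

Definition kappa (d : nat) (w : seq (letter d)) : seq (letter d) :=
  if w is c :: w' then
    let z := last c w' in rcons (belast c w') (z.1 + 1, z.2)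
  else [::].

Definition glue (d : nat) (t : 'Z_d -> morph bool) : morph (letter d) :=
  fun c => kappa (in_alphabet c.1 (t c.1 c.2)).

Definition glued_sequence (d : nat) (t : 'Z_d -> morph bool) (n : nat) :
    morph (letter d) :=
  glue (fun i => mpow (t i) n.+1).

(* Main.v *)
Require Import Defs.
From HB Require Import structures.
From mathcomp Require Import all_boot all_order all_algebra.
From mathcomp Require Import all_classical all_reals all_analysis.
From mathcomp Require Import zify lra ring.

Set Implicit Arguments.
Unset Strict Implicit.
Unset Printing Implicit Defensive.

Import Order.TTheory GRing.Theory Num.Theory.
Import numFieldNormedType.Exports.
Local Open Scope classical_set_scope.
Local Open Scope ring_scope.

(* Every image of a glued morphism is written in one alphabet except for its last
   letter, so the alphabet changes exactly at the same place of every block; as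
   blocks have length at least 3 this determines the phase, whence recognizability.
   For an invariant measure m on X and a level n, let T_(n,i) be the union of the
   towers over the letters of alphabet i. Passing from level n to n + 1 moves only
   a proportion l^-(n+1) of the mass between the T_(n,i), a summable amount, so by
   Borel-Cantelli almost every point lies in T_(n,i) for all large n for exactly
   one i; call E_i the set of these points. Within alphabet i, the power
   tau_i^(n+1) makes the letter frequencies of the two images geometrically close,
   so the frequencies of a local event along sigma_[0,n)(c), c in alphabet i,
   converge to a limit mu_i depending on i only. Counting along the towers gives
   m = sum_i m(E_i) mu_i for every m, while mu_i(E_i) = 1 because an image of a
   letter of alphabet i stays in alphabet i up to a proportion l^-n. Hence the
   mu_i are exactly the ergodic measures. The induced measure mu_i^(n) gives mass
   at least 1 - l^-n to alphabet i, and there a block of level n is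
   tau_i^(n+1)(e) up to one letter, so the frequencies of w in it tend to nu_i(w). *)

(** * Topology of two-sided sequences *)

(** No ergodic theorem and no extraction of subsequences enters. An invariant measure charges all
    levels of a tower equally, so its value on a local set is, up to the levels near both ends, the
    mean of the block frequencies [letter_freq] weighted by the masses of the letter towers; only
    these masses depend on the measure. Two rates drive the estimates. Positivity puts both letters
    in every image, so the second eigenvalue of the incidence matrix has modulus at most [l - 2],
    against [l] for the length; hence the ratio [(l - 2) / l]. The growing exponent [n + 1] makes
    the losses summable, which a bounded exponent would not: as [l >= 3], all losses from level [N]
    on add up to less than [l^-N], the error bound used for the construction of the measures, for
    the limit sets and for the induced measures. Since the frequencies converge, each limit measure
    is obtained directly: compactness turns the limits on local sets into a premeasure, to which
    Caratheodory extension applies. For the induced measures the single step from level [n] to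
    [n + 1] suffices, because [tau_i^(n+1)] is already a long iterate. *)

Definition bshift (A : Type) (k : int) (x : biseq A) : biseq A :=
  fun j => x (j + k).

Definition agree (A : Type) (r : nat) (x y : biseq A) :=
  forall j : int, (`|j| <= r)%N -> x j = y j.

(** Over a finite alphabet the local sets are the clopen ones. The explicit radius is kept because
    it measures how far an event can see beyond the end of a block. *)
Definition radius_local (A : Type) (r : nat) (E : set (biseq A)) :=
  forall x y, agree r x y -> E x -> E y.

Definition local_set (A : Type) (E : set (biseq A)) :=
  exists r, radius_local r E.

Section BiseqTopology.
Context {A : choiceType}.
Implicit Types (x y : biseq A) (E K U : set (biseq A)).

Lemma agree_refl r x : agree r x x.
Proof. by []. Qed.

Lemma agree_sym r x y : agree r x y -> agree r y x.
Proof. by move=> xy j jr; rewrite xy. Qed.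

Lemma agree_trans r y x z : agree r x y -> agree r y z -> agree r x z.
Proof. by move=> xy yz j jr; rewrite xy // yz. Qed.

Lemma agree_le r r' x y : (r <= r')%N -> agree r' x y -> agree r x y.
Proof. by move=> rr' xy j jr; apply: xy; exact: leq_trans rr'. Qed.

(** For the direct implication, the filter generated by the central windows converges to [x] in
    every coordinate, hence in the product. For the converse, finitely many coordinate conditions
    are intersected. *)
Lemma nbhs_biseqP x U : nbhs x U <-> exists r, agree r x `<=` U.
Proof.
split=> [|[r rU]].
  pose G := filter_from [set: nat] (fun r => agree r x).
  have FG : Filter G.
    apply: filter_from_filter; first by exists 0%N.
    move=> r s _ _; exists (maxn r s) => // y xy; split.
      by apply: agree_le xy; exact: leq_maxl.
    by apply: agree_le xy; exact: leq_maxr.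
  suff Gx : G --> x by move=> /Gx [r _ ?]; exists r.
  apply/cvg_sup => t; apply/cvg_image.
    by apply/seteqP; split=> // a _; exists (fun=> a).
  move=> V /principal_filterP Vx; exists (fun y => V (y t)).
    by exists `|t|%N => // y /(_ t (leqnn _)) <-.
  by apply/seteqP; split=> [a [y Vy <-//]|a Va]; exists (fun=> a).
have Fx : Filter (nbhs x) := @nbhs_filter (biseq A) x.
apply: (filterS rU) => {U rU}.
have coord (j : int) : nbhs x [set y | x j = y j].
  have := @proj_continuous _ (fun=> discrete_topology A : topologicalType) j x.
  by move=> /(_ [set a | x j = a]); apply; exact/principal_filterP.
elim: r => [|r IHr].
  by apply: filterS (coord 0) => y /= xy j; rewrite leqn0 absz_eq0 => /eqP ->.
have xp := coord r.+1%:Z; have xn := coord (- r.+1%:Z).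
apply: filterS (filterI IHr (filterI xp xn)) => y [xy [/= yp yn]] j jr.
have [jr'|jr'] := leqP `|j|%N r; first exact: xy.
by have [->|->] : j = r.+1%:Z \/ j = - r.+1%:Z by lia.
Qed.

Lemma closed_biseqP K :
  closed K <-> forall x, (forall r, exists2 y, K y & agree r x y) -> K x.
Proof.
split=> [cK x xK|xK x clx].
  by apply: cK => U /nbhs_biseqP [r rU]; have [y Ky /rU Uy] := xK r; exists y.
apply: xK => r; have [|y [Ky xy]] := clx (agree r x); last by exists y.
by apply/nbhs_biseqP; exists r.
Qed.

Lemma open_biseqP U : open U <-> forall x, U x -> exists r, agree r x `<=` U.
Proof.
rewrite openE; split=> oU x Ux; first by apply/nbhs_biseqP; exact: oU.
by apply/nbhs_biseqP; exact: oU.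
Qed.

Lemma radius_local_open r E : radius_local r E -> open E.
Proof. by move=> lE; apply/open_biseqP => x Ex; exists r => y /lE; exact. Qed.

Lemma local_set_open E : local_set E -> open E.
Proof. by case=> r /radius_local_open. Qed.

Lemma radius_localC r E : radius_local r E -> radius_local r (~` E).
Proof. by move=> lE x y xy Ex Ey; apply: Ex; exact: lE (agree_sym xy) Ey. Qed.

Lemma local_setC E : local_set E -> local_set (~` E).
Proof. by case=> r /radius_localC ?; exists r. Qed.

Lemma local_setI E E' : local_set E -> local_set E' -> local_set (E `&` E').
Proof.
move=> [r lE] [s lE']; exists (maxn r s) => x y xy [Ex E'x]; split.
  by apply: lE Ex; apply: agree_le xy; exact: leq_maxl.
by apply: lE' E'x; apply: agree_le xy; exact: leq_maxr.
Qed.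

Lemma local_setU E E' : local_set E -> local_set E' -> local_set (E `|` E').
Proof.
move=> lE lE'; rewrite -[_ `|` _]setCK setCU.
by apply: local_setC; apply: local_setI; exact: local_setC.
Qed.

Lemma local_set0 : local_set (set0 : set (biseq A)).
Proof. by exists 0%N. Qed.

Lemma local_setT : local_set [set: biseq A].
Proof. by exists 0%N. Qed.

Definition thickening r K : set (biseq A) := [set x | exists2 y, K y & agree r x y].

Lemma radius_local_thickening r K : radius_local r (thickening r K).
Proof.
by move=> x y /agree_sym xy [z Kz xz]; exists z => //; exact: agree_trans xy xz.
Qed.

(** Approximates closed sets from outside by local ones, the only sets on which weak limits are
    known to converge. *)
Lemma closed_bigcap_thickening K :
  closed K -> K = \bigcap_r thickening r K.
Proof.
move=> /closed_biseqP cK; apply/seteqP; split => x.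
  by move=> Kx r _; exists x.
by move=> xK; apply: cK => r; exact: xK.
Qed.

Lemma hausdorff_biseq : hausdorff_space (biseq A).
Proof.
move=> x y xy; apply/funext => j.
have [||z [xz yz]] := xy (agree `|j|%N x) (agree `|j|%N y);
  [by apply/nbhs_biseqP; exists `|j|%N..|].
by rewrite xz // yz.
Qed.

Lemma compact_biseq : finite_set [set: A] -> compact [set: biseq A].
Proof.
move=> finA.
have := @tychonoff int (fun=> discrete_topology A) (fun=> setT).
rewrite (_ : [set f | _] = setT); last by apply/seteqP; split.
by apply=> _; exact: finite_compact.
Qed.

Lemma closed_compact_biseq K : finite_set [set: A] -> closed K -> compact K.
Proof.
move=> finA cK; apply: (subclosed_compact cK (compact_biseq finA)).
exact: subsetT.
Qed.

End BiseqTopology.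

Lemma continuous_biseqP (A B : choiceType) (f : biseq A -> biseq B) :
  (forall x r, exists s, forall y, agree s x y -> agree r (f x) (f y)) ->
  continuous f.
Proof.
move=> cf x U /nbhs_biseqP [r rU]; apply/nbhs_biseqP.
by have [s xs] := cf x r; exists s => y /xs/rU.
Qed.

(** Compactness makes the levels of towers closed, hence Borel, although they are defined as
    images. *)
Lemma closed_image_biseq (A B : choiceType) (f : biseq A -> biseq B) K :
  finite_set [set: A] -> continuous f -> closed K -> closed (f @` K).
Proof.
move=> finA cf cK; apply: compact_closed; first exact: hausdorff_biseq.
apply: continuous_compact; last exact: closed_compact_biseq.
exact: continuous_subspaceT.
Qed.

Lemma bshift_continuous (A : choiceType) k : continuous (@bshift A k).
Proof.
apply: continuous_biseqP => x r; exists (r + `|k|)%N => y xy j jr.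
by apply: xy; lia.
Qed.

Lemma bshift0 (A : Type) (x : biseq A) : bshift 0 x = x.
Proof. by apply/funext => j; rewrite /bshift addr0. Qed.

Lemma bshiftD (A : Type) (x : biseq A) j k :
  bshift j (bshift k x) = bshift (j + k) x.
Proof. by apply/funext => i; rewrite /bshift addrA. Qed.

Lemma bshift_eq (A : Type) (x : biseq A) j k : j = k -> bshift j x = bshift k x.
Proof. by move=> ->. Qed.

Lemma bshift1 (A : Type) : @bishift A = bshift 1.
Proof. by []. Qed.

Lemma iter_bishift (A : Type) n (x : biseq A) :
  iter n (@bishift A) x = bshift n%:Z x.
Proof.
elim: n => [|n IHn] /=; first by rewrite bshift0.
by rewrite IHn bshift1 bshiftD; congr bshift; lia.
Qed.

(** * Borel measures and weak limits *)

Lemma nested_closed_biseq (A : choiceType) (K : nat -> set (biseq A)) :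
  finite_set [set: A] -> (forall n, closed (K n)) ->
  (forall n, K n.+1 `<=` K n) -> (forall n, K n !=set0) ->
  \bigcap_n K n !=set0.
Proof.
move=> finA cK dK neK; have [x Kx] := choice neK.
have [z [_ clz]] : [set: biseq A] `&` cluster (x @ \oo) !=set0.
  by apply: (compact_biseq finA); exact: filterT.
exists z => n _; have /closed_biseqP := cK n; apply => r.
have Kle m : (n <= m)%N -> K m `<=` K n.
  elim: m => [|m IHm]; first by rewrite leqn0 => /eqP ->.
  by rewrite leq_eqVlt => /orP[/eqP -> //|/IHm mn]; apply: subset_trans mn.
have [||y [[m nm <-] zy]] := clz (x @` [set m | (n <= m)%N]) (agree r z).
- by exists n => // m /= nm; exists m.
- by apply/nbhs_biseqP; exists r.
by exists (x m) => //; exact: Kle (Kx m).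
Qed.

Section BiseqMeasurable.
Context {A : pointedType}.

Lemma measurable_open_biseq (U : set (borel_biseq A)) :
  @open (biseq A) U -> measurable U.
Proof. exact: sub_sigma_algebra. Qed.

Lemma measurable_closed_biseq (K : set (borel_biseq A)) :
  @closed (biseq A) K -> measurable K.
Proof.
rewrite -openC => /measurable_open_biseq mK.
by rewrite -[K]setCK; exact: measurableC.
Qed.

Lemma measurable_local_biseq (U : set (borel_biseq A)) :
  @local_set A U -> measurable U.
Proof. by move=> /local_set_open/measurable_open_biseq. Qed.

(** An open set is the countable union over [r] of the local sets of those points whose whole radius
    [r] neighbourhood it contains. *)
Lemma borel_biseq_local :
  @measurable _ (borel_biseq A) = <<s @local_set A >>.
Proof.
apply/seteqP; split.
  apply: smallest_sub; first exact: smallest_sigma_algebra.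
  move=> U /open_biseqP oU.
  have -> : U = \bigcup_r [set x | agree r x `<=` U].
    apply/seteqP; split=> [x /oU [r rU]|x [r _]]; first by exists r.
    by apply; exact: agree_refl.
  apply: sigma_algebra_bigcup => r; apply: sub_sigma_algebra; exists r.
  by move=> x y xy xU z yz; apply: xU; exact: agree_trans xy yz.
apply: smallest_sub; first exact: sigma_algebra_measurable.
by move=> U /measurable_local_biseq.
Qed.

Lemma continuous_measurable_biseq (B : pointedType)
    (f : borel_biseq A -> borel_biseq B) :
  continuous (f : biseq A -> biseq B) -> measurable_fun setT f.
Proof.
move=> cf; apply: (@measurability _ _ (borel_biseq A) (borel_biseq B) setT f (@open (biseq B))) => //.
move=> _ [U oU <-]; rewrite setTI; apply: measurable_open_biseq.
by apply: open_comp => // x _; exact: cf.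
Qed.

Lemma measurable_preimage_biseq (B : pointedType)
    (f : borel_biseq A -> borel_biseq B) (E : set (borel_biseq B)) :
  continuous (f : biseq A -> biseq B) -> measurable E -> measurable (f @^-1` E).
Proof.
move=> /continuous_measurable_biseq mf mE.
by rewrite -[_ @^-1` _]setTI; exact: mf.
Qed.

Lemma same_measure_local (R : realType) (m m' : probability (borel_biseq A) R) :
  (forall U, local_set U -> m U = m' U) -> same_measure m m'.
Proof.
move=> mm' E mE.
apply: (@measure_unique _ _ (borel_biseq A) (@local_set A) (fun=> setT) _ _ _ _ m m') => //.
- exact: borel_biseq_local.
- exact: local_setI.
- by move=> _; exact: local_setT.
- by rewrite bigcup_const //; exists 0%N.
- by move=> _ /=; rewrite [m _](probability_setT m) ltry.
Qed.

End BiseqMeasurable.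

(* A copy of [biseq A] carrying the algebra of local sets, on which the
   Caratheodory extension below is performed. *)
Definition localseq (A : Type) := biseq A.
HB.instance Definition _ (A : pointedType) :=
  Pointed.copy (localseq A) (biseq A).
HB.instance Definition _ (A : pointedType) :=
  @isAlgebraOfSets.Build default_measure_display (localseq A) (@local_set A)
    local_set0 local_setU local_setC.

Lemma exists_probability d (T : measurableType d) (R : realType)
    (f : set T -> \bar R) :
  f set0 = 0%E -> (forall E, (0 <= f E)%E) -> semi_sigma_additive f ->
  f setT = 1%E -> exists m : probability T R, forall E, m E = f E.
Proof.
move=> f0 f_ge0 fU fT.
pose mf := isMeasure.Build _ _ R f f0 f_ge0 fU.
pose m1 : {measure set T -> \bar R} := HB.pack f mf.
pose pf := @Measure_isProbability.Build _ _ R m1 fT.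
pose m : probability T R := HB.pack f mf pf.
by exists m.
Qed.

(** * Weak limits by extension from the algebra of local sets *)

Section WeakLimit.
Context {A : pointedType} {R : realType}.
Hypothesis finA : finite_set [set: A].
Variable F : nat -> set (biseq A) -> R.
Hypothesis F_ge0 : forall n U, 0 <= F n U.
Hypothesis FU : forall n U V, U `&` V = set0 -> F n (U `|` V) = F n U + F n V.
Hypothesis FT : forall n, F n setT = 1.
Hypothesis cvgF : forall U, local_set U -> cvgn (F^~ U).

(** The absolute value only forces nonnegativity on sets outside the algebra, where the limit may be
    a default value; [pmE] removes it on local sets. *)
Let pm (U : set (localseq A)) : \bar R := `|limn (F^~ U)|%:E.

Let F0 n : F n set0 = 0.
Proof.
by apply: (@addrI _ (F n set0)); rewrite -FU ?setI0 // setU0 addr0.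
Qed.

Let pm_ge0 U : (0 <= pm U)%E.
Proof. by rewrite lee_fin. Qed.

Let pmE U : local_set U -> pm U = (limn (F^~ U))%:E.
Proof.
move=> lU; rewrite /pm ger0_norm //; apply: limr_ge; first exact: cvgF.
by near=> n; exact: F_ge0.
Unshelve. all: by end_near. Qed.

Let pm0 : pm set0 = 0%E.
Proof.
rewrite pmE; last exact: local_set0.
by under eq_fun do rewrite F0; rewrite lim_cst.
Qed.

Let pm_additive : measure_function.semi_additive pm.
Proof.
apply/(additive2P pm0) => U V lU lV UV0.
rewrite !pmE //; last exact: local_setU.
rewrite -EFinD -limD //; [|exact: cvgF..].
by congr (limn _)%:E; apply/funext => n; rewrite FU.
Qed.

HB.instance Definition _ := isContent.Build _ _ R pm pm_ge0 pm_additive.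

(** Local sets are compact and open, so a countable cover of one by others has a finite subcover,
    and finite subadditivity suffices. The sets [K N] of uncovered points would otherwise have a
    common point. *)
Let pm_sigma_subadditive : measurable_subset_sigma_subadditive pm.
Proof.
move=> U V lV lU UV.
have [N UN] : exists N, U `<=` \big[setU/set0]_(k < N) V k.
  apply: contrapT => /forallNP noN.
  pose K N := U `\` \big[setU/set0]_(k < N) V k.
  have lK N : @local_set A (K N).
    rewrite /K setDE; apply: local_setI => //; apply: local_setC.
    elim: N => [|N IHN]; first by rewrite big_ord0; exact: local_set0.
    by rewrite big_ord_recr /=; apply: local_setU => //; exact: lV.
  have [x xK] : \bigcap_N K N !=set0.
    apply: nested_closed_biseq => // N.
    - by rewrite -[K N]setCK closedC; apply: local_set_open; exact: local_setC.
    - by move=> x [Ux nVx]; split=> // Vx; apply: nVx; rewrite big_ord_recr /=; left.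
    - have /existsNP [x /not_implyP [Ux nVx]] := noN N.
      by exists x; split.
  have [Ux _] := xK 0%N I.
  have [k _ Vkx] := UV _ Ux.
  have [_] := xK k.+1 I; apply.
  by rewrite big_ord_recr /=; right.
have leN := @content_subadditive _ _ _ pm U V N (fun k _ => lV k) lU UN.
apply: (le_trans leN).
rewrite -(big_mkord xpredT (fun k => pm (V k))).
exact: nneseries_lim_ge.
Qed.

HB.instance Definition _ :=
  Content_SigmaSubAdditive_isMeasure.Build _ R _ pm pm_sigma_subadditive.

Lemma weak_limit_probability : exists m : probability (borel_biseq A) R,
  forall U, local_set U -> F n U @[n --> \oo] --> fine (m U).
Proof.
pose ext := measure_extension (pm : {measure set (localseq A) -> \bar R}).
pose m0 : set (borel_biseq A) -> \bar R := ext.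
have mE (U : set (borel_biseq A)) : @local_set A U -> m0 U = (limn (F^~ U))%:E.
  by move=> lU; rewrite /m0 /ext /measure_extension measurable_mu_extE //; exact: pmE.
(* The extension lives on the sigma-algebra generated by the local sets; this equality carries it
   over to the Borel structure. *)
have mG : @measurable _ (borel_biseq A) =
    @measurable _ (g_sigma_algebraType (@measurable _ (localseq A))).
  exact: borel_biseq_local.
have m00 : m0 set0 = 0%E by exact: measure0.
have m0_ge0 U : (0 <= m0 U)%E by exact: measure_ge0.
have m0_sigma : semi_sigma_additive m0.
  move=> V mV tV mUV.
  apply: (@measure_semi_sigma_additive _ _ _ ext).
  - by move=> i; rewrite -mG.
  - exact: tV.
  - by rewrite -mG.
have m0T : m0 setT = 1%E.
  rewrite mE; last exact: local_setT.
  by under eq_fun do rewrite FT; rewrite lim_cst.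
have [P PE] := exists_probability m00 m0_ge0 m0_sigma m0T.
by exists P => U lU; rewrite PE mE //; exact: cvgF.
Qed.

End WeakLimit.

(** * Probabilities as real numbers and orbit frequencies *)

Section RealProbability.
Context d (T : measurableType d) (R : realType).
Implicit Types (m : probability T R) (E F : set T).

Definition prob m E : R := fine (m E).

Lemma probE m E : measurable E -> m E = (prob m E)%:E.
Proof. by move=> mE; rewrite /prob fineK // fin_num_measure. Qed.

Lemma prob_ge0 m E : 0 <= prob m E.
Proof. by apply: fine_ge0; exact: measure_ge0. Qed.

Lemma probT m : prob m setT = 1.
Proof. by rewrite /prob probability_setT. Qed.

Lemma prob0 m : prob m set0 = 0.
Proof. by rewrite /prob measure0. Qed.

Lemma le_prob m E F :
  measurable E -> measurable F -> E `<=` F -> prob m E <= prob m F.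
Proof.
by move=> mE mF EF; rewrite -lee_fin -!probE //; apply: le_measure; rewrite ?inE.
Qed.

Lemma prob_le1 m E : measurable E -> prob m E <= 1.
Proof. by move=> mE; rewrite -(probT m); apply: le_prob. Qed.

Lemma probU m E F : measurable E -> measurable F -> E `&` F = set0 ->
  prob m (E `|` F) = prob m E + prob m F.
Proof.
move=> mE mF EF; apply: EFin_inj.
by rewrite EFinD -!probE ?measureU //; exact: measurableU.
Qed.

Lemma probC m E : measurable E -> prob m (~` E) = 1 - prob m E.
Proof.
move=> mE; apply: EFin_inj.
by rewrite EFinB -!probE ?probability_setC //; exact: measurableC.
Qed.

Lemma probDI m E F : measurable E -> measurable F ->
  prob m E = prob m (E `\` F) + prob m (E `&` F).
Proof.
move=> mE mF; rewrite -probU; first by rewrite -setDDr setDv setD0.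
- exact: measurableD.
- exact: measurableI.
- by rewrite setDE setIACA setICl setI0.
Qed.

Lemma probI_full m E B : measurable E -> measurable B -> prob m B = 1 ->
  prob m (E `&` B) = prob m E.
Proof.
move=> mE mB B1; rewrite [RHS](probDI m mE mB).
suff -> : prob m (E `\` B) = 0 by rewrite add0r.
apply/eqP; rewrite eq_le prob_ge0 andbT.
apply: (@le_trans _ _ (prob m (~` B))); last by rewrite probC // B1 subrr.
by apply: le_prob; [exact: measurableD|exact: measurableC|exact: subIsetr].
Qed.

Lemma prob_bigsetU m (I : finType) (E : I -> set T) :
  (forall i, measurable (E i)) -> (forall i j, i != j -> E i `&` E j = set0) ->
  prob m (\big[setU/set0]_i E i) = \sum_i prob m (E i).
Proof.
move=> mE dE; suff: forall s : seq I, uniq s ->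
    prob m (\big[setU/set0]_(i <- s) E i) = \sum_(i <- s) prob m (E i).
  by apply; exact: index_enum_uniq.
elim=> [|i s IHs] /=; first by rewrite !big_nil prob0.
case/andP=> i_s us; rewrite !big_cons probU ?IHs //.
  by apply: bigsetU_measurable.
rewrite big_distrr /= big_seq big1 // => j js; apply: dE.
by apply: contra i_s => /eqP ->.
Qed.

Lemma prob_bigsetU_nat m n (E : nat -> set T) :
  (forall i, measurable (E i)) ->
  (forall i j, (i < n)%N -> (j < n)%N -> i != j -> E i `&` E j = set0) ->
  prob m (\big[setU/set0]_(i < n) E i) = \sum_(i < n) prob m (E i).
Proof.
by move=> mE dE; rewrite prob_bigsetU // => i j ij; exact: dE.
Qed.

Lemma prob_nonincreasing_cvg m (E : nat -> set T) :
  (forall n, measurable (E n)) -> (forall n, E n.+1 `<=` E n) ->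
  prob m (E n) @[n --> \oo] --> prob m (\bigcap_n E n).
Proof.
move=> mE dE; apply: fine_cvg.
have mI : measurable (\bigcap_n E n) by exact: bigcapT_measurable.
rewrite fineK ?fin_num_measure //; apply: nonincreasing_cvg_mu => //.
  by rewrite ltey_eq fin_num_measure.
by apply/nonincreasing_seqP => n; apply/subsetPset.
Qed.

End RealProbability.

(** One construction for three uses: the push-forward by the shift ([B] everything), the measure
    induced on the base of a tower ([psi] reads the letters of the blocks), and conditioning on an
    event ([psi] the identity). *)
Lemma scaled_probability d (T : measurableType d) (R : realType)
    (m : probability T R) (B : set T) (psi : T -> T) (c : R) :
  measurable B -> measurable_fun setT psi -> 0 <= c -> c * prob m B = 1 ->
  exists m' : probability T R,
    forall E, measurable E -> prob m' E = c * prob m (B `&` psi @^-1` E).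
Proof.
move=> mB mpsi c0 cB.
have mBpsi E : measurable E -> measurable (B `&` psi @^-1` E).
  by move=> mE; apply: measurableI => //; rewrite -[_ @^-1` _]setTI; exact: mpsi.
have [|||| m' m'E] := @exists_probability _ T R
    (fun E => (c%:E * m (B `&` psi @^-1` E))%E).
- by rewrite preimage_set0 setI0 measure0 mule0.
- by move=> E; rewrite mule_ge0 ?lee_fin // measure_ge0.
- move=> F mF tF mUF.
  rewrite preimage_bigcup setI_bigcupr.
  under eq_fun do rewrite -ge0_sume_distrr //.
  apply: cvgeZl => //; apply: measure_semi_sigma_additive.
  + by move=> i; exact: mBpsi.
  + apply/trivIsetP => i j _ _ ij; apply/seteqP; split=> // x [[_ Fi] [_ Fj]].
    move/trivIsetP : tF => /(_ i j I I ij) Fij.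
    by have : (F i `&` F j) (psi x); [split|rewrite Fij].
  + by apply: bigcupT_measurable => i; exact: mBpsi.
- by rewrite preimage_setT setIT probE // -EFinM cB.
by exists m' => E mE; rewrite /prob m'E fineM ?fin_num_measure //; exact: mBpsi.
Qed.

(** The closed half of the portmanteau theorem: the bound passes to each thickening, which is local,
    and then to their decreasing intersection. *)
Lemma weak_limit_closed_ge (A : pointedType) (R : realType)
    (F : nat -> set (biseq A) -> R) (m : probability (borel_biseq A) R)
    (K : set (biseq A)) (b : R) :
  (forall U, local_set U -> F n U @[n --> \oo] --> prob m U) ->
  (forall n (U V : set (biseq A)), U `<=` V -> F n U <= F n V) ->
  closed K -> (\forall n \near \oo, b <= F n K) -> b <= prob m K.
Proof.
move=> Fm Fmono cK FK; rewrite (closed_bigcap_thickening cK).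
have tK : prob m (thickening r K) @[r --> \oo] -->
    prob m (\bigcap_r thickening r K).
  apply: prob_nonincreasing_cvg.
    move=> r; apply: measurable_local_biseq; exists r.
    exact: radius_local_thickening.
  move=> r x [y Ky xy]; exists y => //; exact: agree_le xy.
apply: (closed_cvg (fun a => b <= a)) tK; first exact: closed_ge.
apply: nearW => r.
have lr : local_set (thickening r K) by exists r; exact: radius_local_thickening.
apply: (closed_cvg (fun a => b <= a)) (Fm _ lr); first exact: closed_ge.
apply: filterS FK => n /le_trans; apply; apply: Fmono => x Kx.
by exists x.
Qed.

(** The common source of the boundary terms: the exceptional indices are those whose window leaves
    the block or meets its altered last letter. *)
Lemma sum_dist (R : realType) (a b h : nat) (f g : nat -> R) (l : R) :
  0 <= l -> (forall k, (k < h)%N -> `|f k - g k| <= l) ->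
  (forall k, (a <= k)%N -> (k + b < h)%N -> f k = g k) ->
  `|\sum_(0 <= k < h) f k - \sum_(0 <= k < h) g k| <= (a + b)%:R * l.
Proof.
move=> l0 fgl fg.
have minnE c : (\sum_(0 <= k < h) (k < c)%N = minn h c)%N.
  elim: (h) => [|m IHm]; first by rewrite big_geq ?min0n.
  by rewrite big_nat_recr //= IHm; lia.
have suma : (\sum_(0 <= k < h) (k < a)%N <= a)%N by rewrite minnE geq_minr.
have sumb : (\sum_(0 <= k < h) (h <= k + b)%N <= b)%N.
  suff -> : (\sum_(0 <= k < h) (h <= k + b)%N =
             \sum_(0 <= k < h) (k < b)%N)%N by rewrite minnE geq_minr.
  by rewrite big_nat_rev /=; apply: eq_big_nat => k hk; congr (nat_of_bool _); lia.
rewrite -sumrB; apply: (le_trans (ler_norm_sum _ _ _)).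
apply: (@le_trans _ _ (\sum_(0 <= k < h) ((k < a)%N + (h <= k + b)%N)%N%:R * l)).
  apply: ler_sum_nat => k /andP[_ kh].
  have [kb|kb] := boolP ((k < a)%N || (h <= k + b)%N).
    apply: (le_trans (fgl _ kh)); rewrite ler_peMl // ler1n.
    by case/orP: kb => ->; rewrite ?addn1.
  rewrite fg; [by rewrite subrr normr0 mulr_ge0|lia..].
by rewrite -mulr_suml -natr_sum ler_wpM2r // ler_nat big_split leq_add.
Qed.

(** * Visit counts along finite stretches of an orbit *)

Section Occurrences.
Context {A : Type} {R : realType}.
Implicit Types (x y : biseq A) (E : set (biseq A)).

Definition occ x (h : nat) E : R :=
  \sum_(0 <= k < h) `[< E (bshift k%:Z x) >]%:R.

Definition freq x h E : R := occ x h E / h%:R.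

Lemma occ_ge0 x h E : 0 <= occ x h E.
Proof. by apply: sumr_ge0 => k _; exact: ler0n. Qed.

Lemma occ_leh x h E : occ x h E <= h%:R.
Proof.
rewrite -[h in h%:R]subn0 -sumr_const_nat.
by apply: ler_sum => k _; case: asboolP.
Qed.

Lemma occT x h : occ x h setT = h%:R.
Proof.
rewrite -[h in h%:R]subn0 -sumr_const_nat.
by apply: eq_bigr => k _; rewrite asboolT.
Qed.

Lemma le_occ x h E E' : E `<=` E' -> occ x h E <= occ x h E'.
Proof.
move=> EE'; apply: ler_sum => k _.
by case: asboolP => [/EE' E'x|_]; [rewrite asboolT|exact: ler0n].
Qed.

Lemma occU x h E E' : E `&` E' = set0 -> occ x h (E `|` E') = occ x h E + occ x h E'.
Proof.
move=> EE'; rewrite /occ -big_split; apply: eq_bigr => k _ /=.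
rewrite asbool_or; case: asboolP => [Ex|_]; last by rewrite add0r.
rewrite asboolF ?addr0 // => E'x.
by have : (E `&` E') (bshift k%:Z x); [split|rewrite EE'].
Qed.

Lemma occD x a b E : occ x (a + b) E = occ x a E + occ (bshift a%:Z x) b E.
Proof.
rewrite /occ (big_cat_nat (leq0n a) (leq_addr b a)) /=; congr (_ + _).
rewrite -{1}[a]add0n big_addn addKn; apply: eq_bigr => k _.
by rewrite bshiftD PoszD.
Qed.

Lemma occ_block x h M E :
  occ x (M * h) E = \sum_(0 <= j < M) occ (bshift (j * h)%:Z x) h E.
Proof.
elim: M => [|M IHM]; first by rewrite mul0n /occ !big_geq.
by rewrite mulSn addnC occD IHM big_nat_recr.
Qed.

(** Both counts are parts of the count over [h + 1] times. Divided by a growing [h] the difference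
    vanishes, which makes empirical limits invariant. *)
Lemma occ_bishift_dist x h E :
  `|occ x h (@bishift A @^-1` E) - occ x h E| <= 2%:R.
Proof.
have -> : occ x h (@bishift A @^-1` E) = occ (bshift 1 x) h E.
  by apply: eq_bigr => k _; rewrite /= bshift1 !bshiftD addrC.
have e1 : occ x h.+1 E = occ x h E + occ (bshift h%:Z x) 1 E by rewrite -addn1 occD.
have e2 : occ x h.+1 E = occ x 1 E + occ (bshift 1 x) h E by rewrite -add1n occD.
have := occ_ge0 (bshift h%:Z x) 1 E; have := occ_leh (bshift h%:Z x) 1 E.
have := occ_ge0 x 1 E; have := occ_leh x 1 E.
rewrite ler_norml; lra.
Qed.

Lemma occ_dist x y h r E : radius_local r E ->
  (forall j : int, 0 <= j < h%:Z -> x j = y j) ->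
  `|occ x h E - occ y h E| <= (r + r)%:R.
Proof.
move=> lE xy; rewrite -[leRHS]mulr1; apply: sum_dist => // k => [_|rk kh].
  by case: asboolP; case: asboolP;
    rewrite ?subrr ?subr0 ?sub0r ?normrN ?normr0 ?normr1.
congr (nat_of_bool _)%:R; apply: asbool_equiv_eq; split; apply: lE => j jr; rewrite /bshift xy //; lia.
Qed.

End Occurrences.

(** * Constant-length directive sequences *)

Section ConstantLength.
Context {A : pointedType}.
Implicit Types (g : morph A) (x y : biseq A) (h : nat).

(** What gluing preserves of prolongability: [kappa] spoils the last letter only. The first letter
    of a block then recovers its preimage, so the action is injective with inverse [sample]. *)
Definition headed h g :=
  [/\ (0 < h)%N, constant_length h g & forall c, nth point (g c) 0 = c].

Lemma headed_mlength h g : headed h g -> mlength g = h.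
Proof. by case=> _ gh _; exact: gh. Qed.

Lemma bimorphE h g x (a : int) (i : nat) : headed h g ->
  bimorph g x (a * h%:Z + i%:Z) =
  nth point (g (x (a + (i %/ h)%N%:Z))) (i %% h).
Proof.
move=> hg; have [h0 gh _] := hg; rewrite /bimorph (headed_mlength hg).
have -> : ((a * h%:Z + i%:Z) %/ h%:Z)%Z = a + (i %/ h)%N%:Z.
  by rewrite divzMDl ?divz_nat //; lia.
have -> : `|((a * h%:Z + i%:Z) %% h%:Z)%Z|%N = (i %% h)%N.
  by rewrite modzMDl modz_nat.
by apply: set_nth_default; rewrite gh ltn_pmod.
Qed.

Lemma int_divEq h (j : int) : (0 < h)%N ->
  exists a (i : nat), (i < h)%N /\ j = a * h%:Z + i%:Z.
Proof.
move=> h0; exists (j %/ h%:Z)%Z, `|(j %% h%:Z)%Z|%N; split.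
  by rewrite -ltz_nat gez0_abs ?modz_ge0 ?ltz_pmod //; lia.
by rewrite gez0_abs ?modz_ge0 -?divz_eq //; lia.
Qed.

Lemma bimorphE_lt h g x (a : int) (i : nat) : headed h g -> (i < h)%N ->
  bimorph g x (a * h%:Z + i%:Z) = nth point (g (x a)) i.
Proof.
by move=> hg ih; rewrite (bimorphE _ _ _ hg) divn_small // modn_small // addr0.
Qed.

Lemma bimorph_head h g x (a : int) : headed h g -> bimorph g x (a * h%:Z) = x a.
Proof.
move=> hg; have [h0 _ gc] := hg.
by rewrite -[a * _]addr0 -[0]/(0%N%:Z) (bimorphE_lt _ _ hg) // gc.
Qed.

(* Left inverse of the action of a morphism of length [h] that fixes first letters. *)
Definition sample h x : biseq A := fun j => x (j * h%:Z).

Lemma bimorphK h g : headed h g -> cancel (bimorph g) (sample h).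
Proof. by move=> hg x; apply/funext => j; rewrite /sample (bimorph_head _ _ hg). Qed.

Lemma bimorph_bshift h g k x : headed h g ->
  bimorph g (bshift k x) = bshift (k * h%:Z) (bimorph g x).
Proof.
move=> hg; have [h0 _ _] := hg; apply/funext => j; rewrite /bshift.
have [a [i [ih ->]]] := int_divEq j h0.
rewrite (bimorphE_lt _ _ hg) // addrAC -mulrDl.
by rewrite (bimorphE_lt _ _ hg).
Qed.

Lemma bimorph_continuous h g : headed h g -> continuous (bimorph g).
Proof.
move=> hg; have [h0 _ _] := hg.
apply: continuous_biseqP => x r; exists r => y xy j jr.
have [a [i [ih je]]] := int_divEq j h0; rewrite je !(bimorphE_lt _ _ hg) // xy //.
nia.
Qed.

Lemma sample_continuous h : continuous (sample h).
Proof.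
apply: continuous_biseqP => x r; exists (r * h)%N => y xy j jr; apply: xy.
by rewrite abszM leq_mul.
Qed.

Lemma size_mext h g w : constant_length h g -> size (mext g w) = (size w * h)%N.
Proof.
by move=> gh; elim: w => //= c w IHw; rewrite /mext /= size_cat gh -/(mext g w) IHw mulSn.
Qed.

Lemma nth_mext h g w q : headed h g -> (q < size w * h)%N ->
  nth point (mext g w) q = nth point (g (nth point w (q %/ h))) (q %% h).
Proof.
case=> h0 gh _; elim: w q => //= c w IHw q qw.
rewrite /mext /= nth_cat gh -/(mext g w).
have [qh|hq] := ltnP q h; first by rewrite divn_small // modn_small.
rewrite IHw; last by lia.
have -> : (q %/ h = ((q - h) %/ h).+1)%N.
  by rewrite -[in LHS](subnK hq) divnDr // divnn h0 addn1.
by have -> : (q %% h = (q - h) %% h)%N by rewrite -[in LHS](subnK hq) modnDr.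
Qed.

Lemma headed_comp h1 h2 g1 g2 : headed h1 g1 -> headed h2 g2 ->
  headed (h2 * h1)%N (fun c => mext g1 (g2 c)).
Proof.
move=> hg1 hg2; have [h10 g1h g1c] := hg1; have [h20 g2h g2c] := hg2.
split; first by rewrite muln_gt0 h20.
  by move=> c; rewrite (size_mext _ g1h) g2h.
move=> c; rewrite (nth_mext hg1) ?g2h ?muln_gt0 ?h20 //.
by rewrite div0n mod0n g2c g1c.
Qed.

Lemma bimorph_comp h1 h2 g1 g2 x : headed h1 g1 -> headed h2 g2 ->
  bimorph (fun c => mext g1 (g2 c)) x = bimorph g1 (bimorph g2 x).
Proof.
move=> hg1 hg2; have hg := headed_comp hg1 hg2.
have [h10 g1h g1c] := hg1; have [h20 g2h g2c] := hg2; have [h0 _ _] := hg.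
apply/funext => j; have [a [i [ih ->]]] := int_divEq j h0.
rewrite (bimorphE_lt _ _ hg) // (nth_mext hg1) ?g2h //.
rewrite PoszM mulrA (bimorphE _ _ _ hg1) (bimorphE_lt _ _ hg2) //.
by rewrite ltn_divLR.
Qed.

Lemma mext_cat g u v : mext g (u ++ v) = mext g u ++ mext g v.
Proof. by rewrite /mext map_cat flatten_cat. Qed.

Lemma mext_mext g1 g2 w : mext g1 (mext g2 w) = mext (fun c => mext g1 (g2 c)) w.
Proof.
by elim: w => //= c w IHw; rewrite {2}/mext /= mext_cat -/(mext g2 w) IHw.
Qed.

Lemma mext_seq1 w : mext (fun c : A => [:: c]) w = w.
Proof. by elim: w => //= c w; rewrite /mext /= => ->. Qed.

End ConstantLength.

(** * Language, points and desubstitution of a directive sequence *)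

Section Directive.
Context {A : pointedType}.
Variables (s : nat -> morph A) (L : nat -> nat).
Hypothesis sL : forall n, headed (L n) (s n).

Definition hlen n N := (\prod_(n <= k < N) L k)%N.

Lemma srange_id n N : (N <= n)%N -> srange s n N = fun c => [:: c].
Proof. by move=> Nn; apply/funext => c; rewrite /srange /index_iota (eqP Nn). Qed.

Lemma srange_foldr n N w :
  foldr (fun k u => mext (s k) u) w (index_iota n N) = mext (srange s n N) w.
Proof.
rewrite /srange; elim: (index_iota n N) w => /= [|k r IHr] w.
  by rewrite mext_seq1.
by rewrite IHr mext_mext.
Qed.

Lemma srange_cat n M N : (n <= M)%N -> (M <= N)%N ->
  srange s n N = fun c => mext (srange s n M) (srange s M N c).
Proof.
move=> nM MN; apply/funext => c; rewrite -srange_foldr {1}/srange.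
have -> : index_iota n N = index_iota n M ++ index_iota M N.
  rewrite /index_iota -{2}(subnKC nM) -iotaD; congr iota; lia.
by rewrite foldr_cat.
Qed.

Lemma srange1 n : srange s n n.+1 = s n.
Proof.
apply/funext => c; rewrite /srange /index_iota subSnn /=.
by rewrite /mext /= cats0.
Qed.

Lemma srangeS n N : (n <= N)%N ->
  srange s n N.+1 = fun c => mext (srange s n N) (s N c).
Proof. by move=> nN; rewrite (srange_cat nN (leqnSn N)) srange1. Qed.

Lemma hlenn n : hlen n n = 1%N.
Proof. by rewrite /hlen big_geq. Qed.

Lemma hlen1 n : hlen n n.+1 = L n.
Proof. by rewrite /hlen big_nat1. Qed.

Lemma hlenS n N : (n <= N)%N -> hlen n N.+1 = (L N * hlen n N)%N.
Proof. by move=> nN; rewrite /hlen big_nat_recr //= mulnC. Qed.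

Lemma hlen_cat n M N : (n <= M)%N -> (M <= N)%N -> hlen n N = (hlen M N * hlen n M)%N.
Proof. by move=> nM MN; rewrite /hlen (big_cat_nat nM MN) mulnC. Qed.

Lemma headed_srange n N : headed (hlen n N) (srange s n N).
Proof.
have [Nn|nN] := leqP N n; first by rewrite srange_id // /hlen big_geq.
rewrite -(subnKC (ltnW nN)); elim: (N - n)%N => [|k IHk].
  by rewrite addn0 srange_id // hlenn.
rewrite addnS srangeS ?leq_addr // hlenS ?leq_addr //.
exact: headed_comp.
Qed.

Lemma hlen_gt0 n N : (0 < hlen n N)%N.
Proof. by have [] := headed_srange n N. Qed.

Lemma size_srange n N c : size (srange s n N c) = hlen n N.
Proof. by have [_ + _] := headed_srange n N; exact. Qed.

Lemma bimorph_srange_cat n M N x : (n <= M)%N -> (M <= N)%N ->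
  bimorph (srange s n N) x = bimorph (srange s n M) (bimorph (srange s M N) x).
Proof.
move=> nM MN; rewrite (srange_cat nM MN).
exact: bimorph_comp (headed_srange n M) (headed_srange M N).
Qed.

(** Replaces the factor relation by a position [p] in a long image, so that later arguments are
    arithmetic on indices. *)
Lemma slanguage_windowP n (x : biseq A) j m :
  slanguage s n (window x j m) <->
  exists c N p, [/\ (n < N)%N, (p + m <= hlen n N)%N &
    forall k, (k < m)%N -> x (j + k%:Z) = nth point (srange s n N c) (p + k)].
Proof.
have sw : size (window x j m) = m by rewrite size_map size_iota.
have nw k : (k < m)%N -> nth point (window x j m) k = x (j + k%:Z).
  by move=> km; rewrite (nth_map 0%N) ?size_iota // nth_iota.
split=> [[c [N [nN /infixP [u [v E]]]]]|[c [N [p [nN pm xE]]]]].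
  exists c, N, (size u); split => //.
    by rewrite -(size_srange n N c) E !size_cat sw leq_add2l leq_addr.
  by move=> k km; rewrite E nth_cat ltnNge leq_addr /= addKn nth_cat sw km nw.
exists c, N; split=> //; apply/infixP.
exists (take p (srange s n N c)), (drop (p + m) (srange s n N c)).
have -> : window x j m = take m (drop p (srange s n N c)).
  apply: (@eq_from_nth _ point); first by rewrite sw size_takel // size_drop size_srange; lia.
  by move=> k; rewrite sw => km; rewrite nw // xE // nth_take // nth_drop.
by rewrite addnC -drop_drop cat_take_drop cat_take_drop.
Qed.

Lemma slanguage_window_sub n (x : biseq A) j m j' m' :
  slanguage s n (window x j m) -> j <= j' -> j' + m'%:Z <= j + m%:Z ->
  slanguage s n (window x j' m').
Proof.
move=> /slanguage_windowP [c [N [p [nN pm xE]]]] jj' jm.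
apply/slanguage_windowP; exists c, N, (p + `|j' - j|)%N; split => //; first by lia.
move=> k km; have -> : j' + k%:Z = j + (`|j' - j|%N + k)%:Z by lia.
by rewrite xE ?addnA //; lia.
Qed.

Lemma ssubshift_bshift n k (x : biseq A) : ssubshift s n x -> ssubshift s n (bshift k x).
Proof.
move=> Xx j m; have := Xx (j + k) m; congr (slanguage s n _).
by apply: eq_map => i; rewrite /bshift addrAC.
Qed.

Lemma closed_ssubshift n : closed (ssubshift s n).
Proof.
apply/closed_biseqP => x xX j m.
have [y Xy xy] := xX (`|j| + m)%N.
have := Xy j m; congr (slanguage s n _); rewrite /window; apply/eq_in_map => i.
by rewrite mem_iota => im; rewrite xy //; lia.
Qed.

Lemma bimorph_ssubshift n N y : (n <= N)%N ->
  ssubshift s N y -> ssubshift s n (bimorph (srange s n N) y).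
Proof.
move=> nN Yy j m; have hg := headed_srange n N; have [h0 _ _] := hg.
set h := hlen n N in hg h0.
have [a [i [ih ->]]] := int_divEq j h0.
have /slanguage_windowP [c [M [p [NM pm yE]]]] := Yy a (m + 1)%N.
apply/slanguage_windowP; exists c, M, (p * h + i)%N; split.
- exact: leq_ltn_trans nN NM.
- by rewrite (hlen_cat nN (ltnW NM)) -/h; nia.
move=> k km; rewrite (srange_cat nN (ltnW NM)).
have ikm : ((i + k) %/ h < m + 1)%N by rewrite ltn_divLR //; nia.
rewrite -addrA -PoszD (bimorphE _ _ _ hg) (nth_mext hg) ?size_srange.
  by rewrite -addnA divnMDl // modnMDl yE.
nia.
Qed.

(** If each of the [h] phases failed at some radius, all would fail at the largest of these radii,
    by monotonicity. *)
Lemma pigeonhole_phase h (P : nat -> nat -> Prop) :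
  (forall r, exists2 k, (k < h)%N & P r k) -> (forall r k, P r.+1 k -> P r k) ->
  exists2 k, (k < h)%N & forall r, P r k.
Proof.
move=> exP dP; apply: contrapT => nP.
have {}dP r r' k : (r <= r')%N -> P r' k -> P r k.
  elim: r' => [|r' IHr']; first by rewrite leqn0 => /eqP ->.
  by rewrite leq_eqVlt => /orP[/eqP -> //|/IHr' H] /dP.
have : forall m, (m <= h)%N -> exists r, forall k, (k < m)%N -> ~ P r k.
  elim=> [|m IHm] mh; first by exists 0%N.
  have [r rm] := IHm (ltnW mh).
  have [r' r'm] : exists r', ~ P r' m.
    by apply/existsNP => Pm; apply: nP; exists m.
  exists (maxn r r') => k; rewrite ltnS leq_eqVlt => /orP[/eqP ->|km].
    by move=> /(dP r' _ _ (leq_maxr _ _)).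
  by move=> /(dP r _ _ (leq_maxl _ _)); exact: rm.
move=> /(_ h (leqnn h)) [r rh]; have [k kh] := exP r.
exact: rh.
Qed.

(** Every central window of [x] sits in a word cut into blocks of length [h]. The cut positions
    modulo [h] may vary with the window, but one phase serves for all radii; the first letters of
    the blocks so cut form [y]. *)
Lemma desubstitution n N x : (n <= N)%N -> ssubshift s n x ->
  exists y k, [/\ ssubshift s N y, (k < hlen n N)%N &
    x = bshift k%:Z (bimorph (srange s n N) y)].
Proof.
move=> nN Xx; have hg := headed_srange n N; have [h0 _ gc] := hg.
set h := hlen n N in hg h0 *; set g := srange s n N in hg gc *.
(* Phase [k] is possible at radius [r]: the origin of the window falls at offset [k] of block [Q] in
   a word of some level beyond [N]. *)
pose P r k := exists M c Q, (N < M)%N /\ forall j : int, (`|j| <= r)%N ->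
  let q := (Q * h + k)%:Z + j in
  0 <= q < (hlen N M * h)%:Z /\ x j = nth point (srange s n M c) `|q|.
have [k kh Pk] : exists2 k, (k < h)%N & forall r, P r k.
  apply: pigeonhole_phase => [r|r k [M [c [Q [NM xE]]]]]; last first.
    by exists M, c, Q; split=> // j jr; apply: xE; exact: leqW.
  (* The extra [h] letters make the window longer than any image up to level [N], which forces
     [N < M]. *)
  have /slanguage_windowP [c [M [p [nM pm xE]]]] := Xx (- r%:Z) (r + r + h + 1)%N.
  have NM : (N < M)%N.
    rewrite ltnNge; apply/negP => MN.
    have : (hlen n M <= h)%N.
      by rewrite /h (hlen_cat (ltnW nM) MN) leq_pmull // hlen_gt0.
    lia.
  exists ((p + r) %% h)%N; first by rewrite ltn_pmod.
  exists M, c, ((p + r) %/ h)%N; split=> // j jr; rewrite -divn_eq.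
  rewrite -/h -(hlen_cat nN (ltnW NM)); split; first by lia.
  have {1}-> : j = - r%:Z + `|j + r%:Z|%:Z by lia.
  rewrite xE; last by lia.
  by congr nth; lia.
have sample_word r M c Q : (N < M)%N -> (forall j : int, (`|j| <= r)%N ->
  let q := (Q * h + k)%:Z + j in
  0 <= q < (hlen N M * h)%:Z /\ x j = nth point (srange s n M c) `|q|) ->
  forall (a : int) (i : nat), (i < h)%N ->
  (`|(a * h%:Z + i%:Z - k%:Z)%R|%N <= r)%N ->
  [/\ 0 <= Q%:Z + a < (hlen N M)%:Z &
    x (a * h%:Z + i%:Z - k%:Z) = nth point (g (nth point (srange s N M c) `|Q%:Z + a|)) i].
  move=> NM xE a i ih ar; have /= [q0 ->] := xE _ ar.
  have Qa : 0 <= Q%:Z + a < (hlen N M)%:Z by nia.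
  split=> //; rewrite (srange_cat nN (ltnW NM)).
  have -> : `|((Q * h + k)%N%:Z + (a * h%:Z + i%:Z - k%:Z))%R|%N = (`|(Q%:Z + a)%R| * h + i)%N by nia.
  rewrite (nth_mext hg) ?size_srange; last by nia.
  by rewrite divnMDl // divn_small // addn0 modnMDl modn_small.
(* With the origin at offset [k] of its block, blocks begin at the positions [t h - k]. *)
exists (fun t => x (t * h%:Z - k%:Z)), k; split => //.
  move=> j m; have [M [c [Q [NM xE]]]] := Pk (`|j| * h + m * h + k)%N.
  have yE t : (t < m)%N -> let u := Q%:Z + (j + t%:Z) in
      0 <= u < (hlen N M)%:Z /\
      x ((j + t%:Z) * h%:Z - k%:Z) = nth point (srange s N M c) `|u|.
    move=> tm u; have [|u0] := sample_word _ _ _ _ NM xE (j + t%:Z) 0%N h0; first by nia.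
    by rewrite addr0 gc => ->.
  case: m yE {xE} => [|m] yE.
    by exists point, N.+1; split=> //; exact: infix0s.
  apply/slanguage_windowP; exists c, M, `|(Q%:Z + j)%R|%N.
  have /= [q0 _] := yE 0%N isT; have /= [qm _] := yE m (leqnn _).
  split=> //; first by lia.
  by move=> t tm; have [_ ->] := yE t tm; congr nth; lia.
apply/funext => j; rewrite /bshift.
have [a [i [ih jk]]] := int_divEq (j + k%:Z) h0.
rewrite jk (bimorphE_lt _ _ hg) //.
have [M [c [Q [NM xE]]]] := Pk (`|j| + `|(a * h%:Z - k%:Z)%R|)%N.
have [|_ xj] := sample_word _ _ _ _ NM xE a i ih; first by lia.
have [|_] := sample_word _ _ _ _ NM xE a 0%N h0; first by lia.
rewrite addr0 gc => ->; rewrite -xj; congr x; lia.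
Qed.

Hypothesis finA : finite_set [set: A].
Hypothesis interior : forall n c,
  exists c' p, (0 < p < L n)%N /\ nth point (s n c') p = c.

Lemma ltn_hlen n r : (r < hlen n (n + r))%N.
Proof.
elim: r => [|r IHr]; first by rewrite addn0 hlenn.
rewrite addnS hlenS ?leq_addr //.
have [_ [p [/andP[p0 pL] _]]] := interior (n + r) point.
by nia.
Qed.

(** The letter is put at position [p > 0] of an image of level [n + r]. Mapped down to level [n],
    block [p] starts with it, block [p - 1] provides more than [r] letters on its left, and block
    [p] itself provides those on its right. Compactness gives a point. *)
Lemma ssubshift_letter n c : exists2 x, ssubshift s n x & x 0 = c.
Proof.
pose K r := [set x : biseq A |
  x 0 = c /\ slanguage s n (window x (- r%:Z) (r + r + 1)%N)].
have [x xK] : \bigcap_r K r !=set0.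
  apply: nested_closed_biseq => // r.
  - rewrite -[K r]setCK closedC; apply/local_set_open/local_setC.
    exists r => x y xy [x0 xr]; split; first by rewrite -xy.
    move: xr; congr (slanguage s n _); rewrite /window; apply/eq_in_map => i.
    by rewrite mem_iota => ir; rewrite xy //; lia.
  - move=> x [x0 xr]; split=> //; apply: slanguage_window_sub xr _ _; lia.
  have [c' [p [/andP[p0 pL] cE]]] := interior (n + r) c.
  have hg := headed_srange n (n + r).
  have rh := ltn_hlen n r; set h := hlen n (n + r) in hg rh.
  have [h0 _ gc] := hg; have [_ sLh _] := sL (n + r).
  pose w := srange s n (n + r).+1 c'.
  have wE : w = mext (srange s n (n + r)) (s (n + r) c').
    by rewrite /w srangeS // leq_addr.
  exists (fun j => nth point w `|(p * h)%:Z + j|); split.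
    rewrite addr0 absz_nat wE (nth_mext hg) ?sLh; last by nia.
    by rewrite mulnK // modnMl gc.
  apply/slanguage_windowP; exists c', (n + r).+1, (p * h - r)%N; split.
  - by rewrite ltnS leq_addr.
  - by rewrite hlenS ?leq_addr // -/h; nia.
  by move=> k km; congr nth; nia.
exists x => [j m|]; last by have [] := xK 0%N I.
have [_ xr] := xK (`|j| + m)%N I.
by apply: slanguage_window_sub xr _ _; lia.
Qed.

End Directive.

(** * Recognizability, towers and induced measures *)

Section InvariantMeasures.
Context {A : pointedType} {R : realType}.
Implicit Types (X E : set (biseq A)) (m : probability (borel_biseq A) R).

Lemma measurable_bshift (k : int) (E : set (borel_biseq A)) :
  measurable E -> measurable (@bshift A k @^-1` E : set (borel_biseq A)).
Proof. by apply: measurable_preimage_biseq; exact: bshift_continuous. Qed.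

Lemma invariant_measureP X m : closed X ->
  invariant_measure X m <-> prob m X = 1 /\
    forall E : set (borel_biseq A), measurable E ->
      prob m (@bishift A @^-1` E) = prob m E.
Proof.
move=> cX; have mX := measurable_closed_biseq cX.
split=> -[mX1 mS]; split.
- by rewrite /prob mX1.
- by move=> E mE; rewrite /prob -[in RHS]mS.
- by rewrite probE // mX1.
- move=> E mE; rewrite /pushforward [RHS]probE // -mS // -probE //.
  exact: (measurable_bshift 1).
Qed.

Lemma prob_bshift m : (forall E : set (borel_biseq A), measurable E ->
    prob m (@bishift A @^-1` E) = prob m E) ->
  forall (k : int) (E : set (borel_biseq A)), measurable E ->
    prob m (@bshift A k @^-1` E) = prob m E.
Proof.
move=> mS; have mN (k : nat) (E : set (borel_biseq A)) : measurable E ->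
    prob m (@bshift A k%:Z @^-1` E) = prob m E.
  elim: k => [|k IHk] mE.
    by congr (prob m _); apply/funext => x; rewrite /= bshift0.
  rewrite -[RHS]IHk // -[RHS]mS; last exact: measurable_bshift.
  congr (prob m _); apply/funext => x; rewrite /= bshift1 bshiftD.
  by congr E; apply: bshift_eq; lia.
move=> [k|k] E mE; first exact: mN.
rewrite -(mN k.+1); last exact: measurable_bshift.
congr (prob m _); apply/funext => x; rewrite /= bshiftD.
by rewrite (_ : _ + _ = 0) ?bshift0 //; lia.
Qed.

Lemma invariant_bshift X m (k : int) (E : set (borel_biseq A)) :
  invariant_measure X m -> measurable E -> prob m (@bshift A k @^-1` E) = prob m E.
Proof.
move=> [_ mS]; apply: prob_bshift => F mF.
by rewrite /prob -[in RHS]mS.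
Qed.

End InvariantMeasures.

Section Towers.
Context {A : pointedType}.
Implicit Types (g : morph A) (h : nat) (C D : set (biseq A)).

(* Phases are compared only; equality of the preimages then follows from [bimorphK]. *)
Definition recognizable h g := forall (y y' : biseq A) k, (k < h)%N ->
  bshift k%:Z (bimorph g y) = bimorph g y' -> k = 0%N.

(** Write [k] as [h1] times a quotient plus a remainder. The outer morphism forces the remainder to
    vanish, its injectivity strips it, and the quotient is a phase of the inner one. *)
Lemma recognizable_comp h1 h2 g1 g2 : headed h1 g1 -> headed h2 g2 ->
  recognizable h1 g1 -> recognizable h2 g2 ->
  recognizable (h2 * h1) (fun c => mext g1 (g2 c)).
Proof.
move=> hg1 hg2 r1 r2 y y' k kh; rewrite !(bimorph_comp _ hg1 hg2).
have [h10 _ _] := hg1.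
have -> : bshift k%:Z (bimorph g1 (bimorph g2 y)) =
    bshift (k %% h1)%N%:Z (bimorph g1 (bshift (k %/ h1)%N%:Z (bimorph g2 y))).
  rewrite (bimorph_bshift _ _ hg1) bshiftD; apply: bshift_eq.
  by rewrite -PoszM -PoszD addnC -divn_eq.
move=> E; have k1 := r1 _ _ _ (ltn_pmod k h10) E.
move: E; rewrite k1 bshift0 => /(can_inj (bimorphK hg1)) E.
have kd : (k %/ h1 < h2)%N by rewrite ltn_divLR.
by rewrite (divn_eq k h1) k1 (r2 _ _ _ kd E).
Qed.

Lemma recognizable_srange (s : nat -> morph A) (L : nat -> nat) :
  (forall n, headed (L n) (s n)) -> (forall n, recognizable (L n) (s n)) ->
  forall n N, recognizable (hlen L n N) (srange s n N).
Proof.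
move=> sL rs n N.
have id1 : recognizable 1 (fun c : A => [:: c]).
  by move=> y y' k; rewrite ltnS leqn0 => /eqP.
have [Nn|nN] := leqP N n; first by rewrite srange_id // /hlen big_geq.
rewrite -(subnKC (ltnW nN)); elim: (N - n)%N => [|k IHk].
  by rewrite addn0 srange_id // hlenn.
rewrite addnS srangeS ?leq_addr // hlenS ?leq_addr //.
by apply: recognizable_comp => //; exact: headed_srange.
Qed.

Definition level g D (k : nat) : set (biseq A) :=
  (fun y => bshift k%:Z (bimorph g y)) @` D.

Definition tower h g D : set (biseq A) := \big[setU/set0]_(k < h) level g D k.

Lemma towerP h g D x : tower h g D x <->
  exists k y, [/\ (k < h)%N, D y & x = bshift k%:Z (bimorph g y)].
Proof.
rewrite /tower -bigcup_mkord; split=> [[k kh [y Dy <-]]|[k [y [kh Dy ->]]]].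
  by exists k, y.
by exists k => //; exists y.
Qed.

Section Fixed.
Variables (h : nat) (g : morph A).
Hypothesis hg : headed h g.
Hypothesis rg : recognizable h g.
Hypothesis finA : finite_set [set: A].

Let h0 : (0 < h)%N. Proof. by case: hg. Qed.

Lemma closed_level D k : closed D -> closed (level g D k).
Proof.
move=> cD; apply: closed_image_biseq => // x.
apply: continuous_comp; first exact: bimorph_continuous hg x.
exact: bshift_continuous.
Qed.

Lemma measurable_level D k : closed D -> measurable (level g D k : set (borel_biseq A)).
Proof. by move=> cD; apply: measurable_closed_biseq; exact: closed_level. Qed.

Lemma closed_tower D : closed D -> closed (tower h g D).
Proof.
move=> cD; rewrite /tower; elim/big_ind: _ => // [|U V cU cV|k _].
- exact: closed0.
- exact: closedU.
- exact: closed_level.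
Qed.

Lemma measurable_tower D : closed D -> measurable (tower h g D : set (borel_biseq A)).
Proof. by move=> cD; apply: measurable_closed_biseq; exact: closed_tower. Qed.

Lemma level_bshift D k : level g D 0 = @bshift A k%:Z @^-1` level g D k.
Proof.
apply/seteqP; split=> x [y Dy].
  by rewrite bshift0 => <-; exists y.
by move=> /(congr1 (bshift (- k%:Z))); rewrite !bshiftD addNr !bshift0 => <-;
  exists y; rewrite ?bshift0.
Qed.

Lemma bshift_bimorph_inj (k k' : nat) (y y' : biseq A) : (k < h)%N -> (k' < h)%N ->
  bshift k%:Z (bimorph g y) = bshift k'%:Z (bimorph g y') -> k = k' /\ y = y'.
Proof.
wlog kk' : k k' y y' / (k' <= k)%N.
  move=> W kh k'h E; have [/W|/ltnW /W] := leqP k' k; first exact.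
  by move=> /(_ y' y k'h kh (esym E)) [-> ->].
move=> kh k'h /(congr1 (bshift (- k'%:Z))); rewrite !bshiftD addNr bshift0.
have -> : - k'%:Z + k%:Z = (k - k')%N%:Z by lia.
move=> E; have kE : (k - k')%N = 0%N by apply: rg E; lia.
move: E; rewrite kE bshift0 => /(can_inj (bimorphK hg)) ->; split=> //; lia.
Qed.

Lemma level_disjoint D D' k k' : (k < h)%N -> (k' < h)%N -> k != k' ->
  level g D k `&` level g D' k' = set0.
Proof.
move=> kh k'h kk'; apply/seteqP; split=> // x [[y _ <-] [y' _ E]].
by have [/esym/eqP] := bshift_bimorph_inj k'h kh E; rewrite (negbTE kk').
Qed.

Lemma tower_disjoint D D' : D `&` D' = set0 -> tower h g D `&` tower h g D' = set0.
Proof.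
move=> DD'; apply/seteqP; split=> // x [/towerP [k [y [kh Dy ->]]]].
move=> /towerP [k' [y' [k'h D'y' E]]].
have [_ yy'] := bshift_bimorph_inj kh k'h E.
by have : (D `&` D') y; [split; rewrite // yy'|rewrite DD'].
Qed.

Context {R : realType}.
Variables (X : set (biseq A)) (m : probability (borel_biseq A) R).
Hypothesis mX : invariant_measure X m.

Lemma prob_level D k : closed D -> prob m (level g D k) = prob m (level g D 0).
Proof.
move=> cD; rewrite (level_bshift D k) (invariant_bshift _ mX) //.
exact: measurable_level.
Qed.

Lemma probI_tower D E : closed D -> measurable (E : set (borel_biseq A)) ->
  prob m (E `&` tower h g D) = \sum_(0 <= k < h) prob m (E `&` level g D k).
Proof.
move=> cD mE; rewrite /tower big_distrr /= big_mkord prob_bigsetU //.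
  by move=> k; apply: measurableI => //; exact: measurable_level.
move=> k k' kk'; rewrite setIACA level_disjoint ?setI0 ?ltn_ord //.
Qed.

Lemma prob_tower D : closed D -> prob m (tower h g D) = h%:R * prob m (level g D 0).
Proof.
move=> cD; rewrite -[tower _ _ _]setTI probI_tower //.
under eq_bigr => k _ do rewrite setTI prob_level //.
by rewrite sumr_const_nat subn0 mulr_natl.
Qed.

(** A point of level [k] shows the block of [c] on the coordinates from [-k] to [h - k - 1]. For
    [r <= k < h - r] this decides [E], so the level lies wholly inside or wholly outside [E]. All
    levels have the same mass, and at most [2r] of them are undecided. *)
Lemma prob_tower_approx D E (r : nat) (c : A) : closed D ->
  (forall y, D y -> y 0 = c) -> radius_local r E ->
  `|prob m (E `&` tower h g D) - freq (bimorph g (fun=> c)) h E * prob m (tower h g D)|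
    <= (r + r)%:R / h%:R * prob m (tower h g D).
Proof.
move=> cD Dc lE; have mE : measurable (E : set (borel_biseq A)).
  by apply: measurable_local_biseq; exists r.
have hR : h%:R != 0 :> R by rewrite pnatr_eq0 -lt0n.
set l := prob m (level g D 0).
rewrite probI_tower // prob_tower // -/l /freq !mulrA mulfVK //.
rewrite [_ / _ * _]mulrVK ?unitfE // /occ mulr_suml.
apply: sum_dist => [|k kh|k rk kh]; first exact: prob_ge0.
  have mEk : measurable (E `&` level g D k : set (borel_biseq A)).
    by apply: measurableI => //; exact: measurable_level.
  have El : prob m (E `&` level g D k) <= l.
    rewrite /l -(prob_level k) //; apply: le_prob => //; exact: measurable_level.
  have E0 := prob_ge0 m (E `&` level g D k).
  by case: asboolP => _ /=; rewrite ler_norml; lra.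
have Ec y : D y -> (E (bshift k%:Z (bimorph g y)) <->
    E (bshift k%:Z (bimorph g (fun=> c)))).
  move=> Dy; have xy : agree r (bshift k%:Z (bimorph g y))
      (bshift k%:Z (bimorph g (fun=> c))).
    move=> j jr; rewrite /bshift.
    have -> : j + k%:Z = 0 * h%:Z + `|j + k%:Z|%:Z by lia.
    by rewrite !(bimorphE_lt _ _ hg) ?(Dc y Dy) //; lia.
  by split; apply: lE => //; exact: agree_sym.
case: asboolP => Ek /=; rewrite ?mul1r ?mul0r.
  rewrite /l -(prob_level k) //; congr (prob m _); apply/setIidPr.
  by move=> x [y /Ec Ey <-]; apply/Ey.
rewrite (_ : _ `&` _ = set0) ?prob0 //; apply/seteqP; split=> // x [Ex [y Dy yx]].
by apply: Ek; apply/(Ec y Dy); rewrite yx.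
Qed.

Section Induced.
Variable Y : set (biseq A).
Hypothesis cX : closed X.
Hypothesis cY : closed Y.
Hypothesis Y_bshift : forall k y, Y y -> Y (bshift k y).
Hypothesis cover : X `<=` tower h g Y.

Let mtower : prob m (tower h g Y) = 1.
Proof.
apply/eqP; rewrite eq_le prob_le1 /=; last exact: measurable_tower.
have <- : prob m X = 1 by rewrite /prob mX.1.
by apply: le_prob => //; [exact: measurable_closed_biseq|exact: measurable_tower].
Qed.

Let mbase : h%:R * prob m (level g Y 0) = 1.
Proof. by rewrite -prob_tower. Qed.

Let mB : measurable (level g Y 0 : set (borel_biseq A)).
Proof. exact: measurable_level. Qed.

Let msample (E : set (borel_biseq A)) : measurable E ->
  measurable (@sample A h @^-1` E : set (borel_biseq A)).
Proof. by apply: measurable_preimage_biseq; exact: sample_continuous. Qed.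

Let base_bshift x k : level g Y 0 (bshift (k * h%:Z) x) <-> level g Y 0 x.
Proof.
suff W x' k' : level g Y 0 x' -> level g Y 0 (bshift (k' * h%:Z) x').
  split; last exact: W.
  by move=> /(W _ (- k)); rewrite bshiftD mulNr addNr bshift0.
move=> [y Yy <-]; exists (bshift k' y); first exact: Y_bshift.
by rewrite !bshift0 (bimorph_bshift _ _ hg).
Qed.

(** The base is invariant under the [h]-th power of the shift, which [sample] conjugates to the
    shift: hence invariance. The averaging formula follows by moving each level [k] back to the
    base. *)
Lemma induced_formula m' :
  (forall E : set (borel_biseq A), measurable E ->
    prob m' E = h%:R * prob m (level g Y 0 `&` @sample A h @^-1` E)) ->
  invariant_measure Y m' /\
  forall E : set (borel_biseq A), measurable E ->
    prob m E = h%:R^-1 * \sum_(0 <= k < h)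
      prob m' ((fun y => bshift k%:Z (bimorph g y)) @^-1` E).
Proof.
move=> m'E; have hR : h%:R != 0 :> R by rewrite pnatr_eq0 -lt0n.
split.
  apply/invariant_measureP => //; split.
    rewrite m'E; last exact: measurable_closed_biseq.
    rewrite (_ : _ `&` _ = level g Y 0) //; apply/setIidPl => _ [y Yy <-] /=.
    by rewrite bshift0 (bimorphK hg).
  move=> E mE; rewrite !m'E //; last exact: (measurable_bshift 1).
  congr (_ * _); rewrite -[RHS](invariant_bshift h%:Z mX); last first.
    by apply: measurableI => //; exact: msample.
  congr (prob m _); apply/seteqP.
  have sS x : sample h (bshift h%:Z x) = bishift (sample h x).
    by apply/funext => j; rewrite /sample /bshift /bishift mulrDl mul1r.
  split=> x [Bx Ex]; split.
  - by have /= := base_bshift x 1; rewrite mul1r => ->.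
  - by rewrite /= sS.
  - by have /= := base_bshift x 1; rewrite mul1r => <-.
  - by rewrite /= -sS.
move=> E mE; rewrite mulr_sumr.
have -> : prob m E = prob m (E `&` tower h g Y).
  by rewrite (probI_full mE (measurable_tower cY) mtower).
rewrite probI_tower //; apply: eq_big_nat => k /andP[_ kh].
have mk : measurable ((fun y => bshift k%:Z (bimorph g y)) @^-1` E : set (borel_biseq A)).
  apply: measurable_preimage_biseq => // x; apply: continuous_comp.
    exact: bimorph_continuous hg x.
  exact: bshift_continuous.
rewrite m'E // mulrA mulVf // mul1r.
rewrite -(invariant_bshift k%:Z mX (E := E `&` level g Y k)); last first.
  by apply: measurableI => //; exact: measurable_level.
rewrite preimage_setI -level_bshift setIC; congr (prob m _).
apply/seteqP; split=> x [[y Yy <-]] /=; rewrite bshift0 => Ey; split;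
  by [exists y; rewrite ?bshift0|rewrite ?(bimorphK hg) // in Ey *].
Qed.

Lemma induced_exists : exists m' : probability (borel_biseq A) R,
  forall E : set (borel_biseq A), measurable E ->
    prob m' E = h%:R * prob m (level g Y 0 `&` @sample A h @^-1` E).
Proof.
apply: scaled_probability => //.
by apply: continuous_measurable_biseq; exact: sample_continuous.
Qed.

(** The averaging formula is evaluated on the part of the base lying over [E]. Recognizability
    empties every term with [k > 0], and the term [k = 0] is [m' E]. *)
Lemma induced_unique m' : invariant_measure Y m' ->
  (forall E : set (borel_biseq A), measurable E ->
    prob m E = h%:R^-1 * \sum_(0 <= k < h)
      prob m' ((fun y => bshift k%:Z (bimorph g y)) @^-1` E)) ->
  forall E : set (borel_biseq A), measurable E ->
    prob m' E = h%:R * prob m (level g Y 0 `&` @sample A h @^-1` E).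
Proof.
move=> m'Y mE E mE'; have hR : h%:R != 0 :> R by rewrite pnatr_eq0 -lt0n.
have mYm' : measurable (Y : set (borel_biseq A)) by exact: measurable_closed_biseq.
have [Y1 _] := (invariant_measureP m' cY).1 m'Y.
rewrite mE; last by apply: measurableI => //; exact: msample.
rewrite mulrA mulfV // mul1r big_ltn // [X in _ + X]big_nat [X in _ + X]big1 => [|k /andP[k0 kh]].
  rewrite addr0; set F := (X in _ = prob m' X).
  have mF : measurable (F : set (borel_biseq A)).
    apply: measurable_preimage_biseq => [x|].
      apply: continuous_comp; first exact: bimorph_continuous hg x.
      exact: bshift_continuous.
    by apply: measurableI => //; exact: msample.
  rewrite -(probI_full mE' mYm' Y1) -(probI_full mF mYm' Y1).
  congr (prob m' _); apply/seteqP; split=> y [Ey Yy]; split=> //.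
    by rewrite /F /= bshift0; split; [exists y; rewrite ?bshift0|rewrite /= (bimorphK hg)].
  by move: Ey => [_]; rewrite /= bshift0 (bimorphK hg).
set F := (X in prob m' X).
have mF : measurable (F : set (borel_biseq A)).
  apply: measurable_preimage_biseq => [x|].
    apply: continuous_comp; first exact: bimorph_continuous hg x.
    exact: bshift_continuous.
  by apply: measurableI => //; exact: msample.
rewrite -(probI_full mF mYm' Y1) (_ : _ `&` _ = set0) ?prob0 //.
apply/seteqP; split=> // y [[[y' _]]]; rewrite bshift0 => /esym /(rg kh) kE.
by rewrite kE in k0.
Qed.

End Induced.
End Fixed.
End Towers.

(** * Limit measures from letter frequencies *)

Lemma cvg_of_tail_bound (R : realType) (u b : nat -> R) :
  (forall n N, (n <= N)%N -> `|u N - u n| <= b n) -> b @ \oo --> 0 -> cvgn u.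
Proof.
move=> ub b0; apply/cauchy_cvgP/cauchy_exP => e e0.
have /cvgr0Pnorm_lt /(_ e e0) [n _ bn] := b0.
exists (u n); exists n => // N /= nN; rewrite /ball /= distrC.
apply: (le_lt_trans (ub _ _ nN)); apply: (le_lt_trans (ler_norm _)).
exact: bn (leqnn n).
Qed.

Lemma cvgr0_le (R : realType) (u b : nat -> R) :
  (forall n, `|u n| <= b n) -> b @ \oo --> 0 -> u @ \oo --> 0.
Proof.
move=> ub b0; apply/cvgr0Pnorm_lt => e e0.
have /cvgr0Pnorm_lt /(_ e e0) := b0; apply: filterS => n.
by apply: le_lt_trans; apply: le_trans (ler_norm _).
Qed.

Lemma cvgr0D (R : realType) (u v : nat -> R) :
  u @ \oo --> 0 -> v @ \oo --> 0 -> u n + v n @[n --> \oo] --> 0.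
Proof. by move=> u0 v0; rewrite -[Z in _ --> Z]addr0; exact: cvgD. Qed.

Lemma cvgr0Ml (R : realType) (a : R) (u : nat -> R) :
  u @ \oo --> 0 -> a * u n @[n --> \oo] --> 0.
Proof.
move=> u0; rewrite -[Z in _ --> Z](mulr0 a).
by apply: cvgM => //; exact: cvg_cst.
Qed.

Lemma cvgr0_norm (R : realType) (u : nat -> R) (a : R) :
  u @ \oo --> a -> `|u n - a| @[n --> \oo] --> 0.
Proof.
move=> ua; rewrite -[Z in _ --> Z](@normr0 _ R).
by apply: cvg_norm; apply/subr_cvg0.
Qed.

Section Frequencies.
Context {A : pointedType} {R : realType}.
Implicit Types (g : morph A) (h r : nat) (E : set (biseq A)).

Lemma freq_ge0 (x : biseq A) h E : 0 <= freq x h E :> R.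
Proof. by rewrite divr_ge0 ?occ_ge0. Qed.

Lemma freq_le1 (x : biseq A) h E : freq x h E <= 1 :> R.
Proof.
case: h => [|h]; first by rewrite /freq invr0 mulr0.
by rewrite ler_pdivrMr ?ltr0n // mul1r occ_leh.
Qed.

Lemma occ_bimorph_dist h g (y y' : biseq A) r E :
  headed h g -> radius_local r E -> y 0 = y' 0 ->
  `|occ (bimorph g y) h E - occ (bimorph g y') h E| <= (r + r)%:R :> R.
Proof.
move=> hg lE yy'; apply: occ_dist => // j jh.
have -> : j = 0 * h%:Z + `|j|%:Z by lia.
by rewrite !(bimorphE_lt _ _ hg) ?yy' //; lia.
Qed.

Lemma freq_bimorph_dist h g (y y' : biseq A) r E :
  headed h g -> radius_local r E -> y 0 = y' 0 ->
  `|freq (bimorph g y) h E - freq (bimorph g y') h E| <= (r + r)%:R / h%:R :> R.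
Proof.
move=> hg lE yy'; rewrite /freq -mulrBl normrM [`|h%:R^-1|]ger0_norm ?invr_ge0 //.
by rewrite ler_wpM2r ?invr_ge0 //; exact: occ_bimorph_dist.
Qed.

Lemma bshift_mul_bimorph h g (z : biseq A) (j : nat) : headed h g ->
  bshift (j * h)%N%:Z (bimorph g z) = bimorph g (bshift j%:Z z).
Proof. by move=> hg; rewrite (bimorph_bshift _ _ hg) PoszM. Qed.

Lemma freq_bimorph_blocks h g (z : biseq A) (M r : nat) E :
  headed h g -> radius_local r E -> (0 < M)%N ->
  `|freq (bimorph g z) (M * h) E -
     (\sum_(0 <= j < M) freq (bimorph g (fun=> z j%:Z)) h E) / M%:R|
    <= (r + r)%:R / h%:R :> R.
Proof.
move=> hg lE M0; have [h0 _ _] := hg.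
have hR : h%:R != 0 :> R by rewrite pnatr_eq0 -lt0n.
have MR : M%:R != 0 :> R by rewrite pnatr_eq0 -lt0n.
rewrite {1}/freq occ_block; set S := \sum_(_ <= _ < _) _; set T := \sum_(_ <= _ < _) _.
have -> : S / (M * h)%:R - T / M%:R = (S / h%:R - T) / M%:R.
  by rewrite natrM; field; rewrite hR MR.
rewrite normrM {}/S {}/T [`|M%:R^-1|]ger0_norm ?invr_ge0 // ler_pdivrMr ?ltr0n //.
rewrite mulr_suml -sumrB; apply: (le_trans (ler_norm_sum _ _ _)).
apply: (@le_trans _ _ (\sum_(0 <= j < M) (r + r)%:R / h%:R)); last first.
  by rewrite sumr_const_nat subn0 mulr_natr.
apply: ler_sum => j _; rewrite (bshift_mul_bimorph _ _ hg).
by apply: freq_bimorph_dist => //; rewrite /bshift add0r.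
Qed.

Lemma occ_tower h g (w : biseq A) M (D : set (biseq A)) : headed h g ->
  h%:R * occ w M D <= occ (bimorph g w) (M * h) (tower h g D) :> R.
Proof.
move=> hg; rewrite occ_block mulr_sumr; apply: ler_sum => j _.
rewrite (bshift_mul_bimorph _ _ hg); case: asboolP => [Dw|_]; last first.
  by rewrite mulr0 occ_ge0.
rewrite mulr1 -[h in h%:R]subn0 -sumr_const_nat.
apply: ler_sum_nat => k /andP[_ kh]; rewrite asboolT //.
by apply/towerP; exists k, (bshift j%:Z w).
Qed.

Lemma freq_tower h g (w : biseq A) M (D : set (biseq A)) : headed h g ->
  freq w M D <= freq (bimorph g w) (M * h) (tower h g D) :> R.
Proof.
move=> hg; have [h0 _ _] := hg; rewrite /freq natrM.
case: M => [|M]; first by rewrite invr0 mul0r invr0 !mulr0.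
have -> : occ w M.+1 D / M.+1%:R = h%:R * occ w M.+1 D / (M.+1%:R * h%:R) :> R.
  by rewrite [h%:R * _]mulrC -mulf_div divff ?mulr1 // pnatr_eq0 -lt0n.
by rewrite ler_wpM2r ?invr_ge0 ?mulr_ge0 //; exact: occ_tower.
Qed.

End Frequencies.

(** The Krylov-Bogoliubov argument, with convergence on local sets given. The last conclusion is
    there for towers, which are only known to be closed. *)
Lemma empirical_limit (A : pointedType) (R : realType) (X : set (biseq A))
    (x : nat -> biseq A) (h : nat -> nat) :
  finite_set [set: A] -> closed X -> (forall k y, X y -> X (bshift k y)) ->
  (forall n, X (x n)) -> (forall n, (n < h n)%N) ->
  (forall E, local_set E -> cvgn (fun n => freq (x n) (h n) E : R)) ->
  exists m : probability (borel_biseq A) R,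
  [/\ invariant_measure X m,
    forall E, local_set E -> freq (x n) (h n) E @[n --> \oo] --> prob m E &
    forall (K : set (biseq A)) b, closed K ->
      (\forall n \near \oo, b <= freq (x n) (h n) K) -> b <= prob m K].
Proof.
move=> finA cX Xs Xx nh cvgE.
have hR n : (h n)%:R != 0 :> R by rewrite pnatr_eq0 -lt0n; exact: leq_ltn_trans (nh n).
have [m mE] : exists m : probability (borel_biseq A) R,
    forall U, local_set U -> freq (x n) (h n) U @[n --> \oo] --> fine (m U).
  apply: (weak_limit_probability finA) => //.
  - by move=> n U; exact: freq_ge0.
  - by move=> n U V UV; rewrite /freq occU // mulrDl.
  - by move=> n; rewrite /freq occT divff.
have mK (K : set (biseq A)) b : closed K ->
    (\forall n \near \oo, b <= freq (x n) (h n) K) -> b <= prob m K.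
  apply: weak_limit_closed_ge mE _ => n U V UV.
  by rewrite /freq ler_wpM2r ?invr_ge0 // le_occ.
have mX : prob m X = 1.
  apply/eqP; rewrite eq_le prob_le1; last exact: measurable_closed_biseq.
  apply: mK => //; apply: nearW => n; rewrite /freq ler_pdivlMr ?mul1r; last first.
    by rewrite lt0r hR ler0n.
  rewrite -[h n in leLHS]subn0 -sumr_const_nat; apply: ler_sum => k _.
  by rewrite asboolT //; exact: Xs.
exists m; split=> //; apply/invariant_measureP => //; split=> //.
have [|||| m' m'E] := @scaled_probability _ (borel_biseq A) R m setT (@bishift A) 1.
- exact: measurableT.
- by apply: continuous_measurable_biseq; exact: (@bshift_continuous A 1).
- exact: ler01.
- by rewrite mul1r probT.
have m'm : same_measure m' m.
  apply: same_measure_local => U [r lU].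
  have lSU : local_set (@bishift A @^-1` U).
    exists r.+1 => y z yz; apply: lU => j jr.
    by apply: yz; lia.
  have mU : measurable (U : set (borel_biseq A)).
    by apply: measurable_local_biseq; exists r.
  rewrite !probE //; congr EFin; rewrite m'E // mul1r setTI.
  apply: (@cvg_unique _ _ (freq (x n) (h n) (@bishift A @^-1` U) @[n --> \oo])) => //.
    exact: mE.
  have -> : (fun n => freq (x n) (h n) (@bishift A @^-1` U)) =
      (fun n => (freq (x n) (h n) (@bishift A @^-1` U) - freq (x n) (h n) U)
        + freq (x n) (h n) U) :> (nat -> R).
    by apply/funext => n; rewrite subrK.
  rewrite -[prob m U]add0r; apply: cvgD; last by apply: mE; exists r.
  apply: (@cvgr0_le _ _ (fun n => 2 * n.+1%:R^-1)).
    move=> n; rewrite /freq -mulrBl normrM ler_pM //; first exact: occ_bishift_dist.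
    by rewrite ger0_norm ?invr_ge0 // lef_pV2 ?posrE ?ltr0n ?ler_nat //; exact: leq_ltn_trans (nh n).
  apply: cvgr0Ml.
  exact: cvg_harmonic.
move=> E mE'; have := m'm E mE'; rewrite !probE // => -[].
by rewrite m'E // mul1r setTI.
Qed.

Section ClassMeasure.
Context {A : pointedType} {R : realType}.
Variables (s : nat -> morph A) (L : nat -> nat).
Hypothesis sL : forall n, headed (L n) (s n).
Hypothesis finA : finite_set [set: A].
Hypothesis interior : forall n c,
  exists c' p, (0 < p < L n)%N /\ nth point (s n c') p = c.

(** The constant sequence [c] is a dummy continuation of the block and need not belong to the
    subshift. Only windows that leave the block can see it, which costs at most [2r] over the
    length. *)
Definition letter_freq n N E (c : A) : R :=
  freq (bimorph (srange s n N) (fun=> c)) (hlen L n N) E.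

Let hR n N : (hlen L n N)%:R != 0 :> R.
Proof. by rewrite pnatr_eq0 -lt0n; exact: hlen_gt0. Qed.

Lemma letter_freq_blocks n N N' E r c : (n <= N)%N -> (N <= N')%N ->
  radius_local r E ->
  `|letter_freq n N' E c - (\sum_(0 <= j < hlen L N N')
      letter_freq n N E (bimorph (srange s N N') (fun=> c) j%:Z)) / (hlen L N N')%:R|
  <= (r + r)%:R / (hlen L n N)%:R.
Proof.
move=> nN NN' lE; rewrite /letter_freq (bimorph_srange_cat sL _ nN NN').
rewrite (hlen_cat _ nN NN'); apply: freq_bimorph_blocks => //.
  exact: headed_srange.
exact: hlen_gt0.
Qed.

(** The block of [c] at level [N'] is a concatenation of blocks at level [N]. Those over letters of
    [C] have frequencies within [d], a proportion at most [e] of others errs by at most 1, and the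
    last term pays for windows across the cuts. *)
Lemma letter_freq_cauchy N N' E r (C : set A) c (d e : R) : (N <= N')%N ->
  radius_local r E ->
  (forall a b, C a -> C b -> `|letter_freq 0 N E a - letter_freq 0 N E b| <= d) ->
  C c -> 1 - e <= letter_freq N N' [set y | C (y 0)] c ->
  `|letter_freq 0 N' E c - letter_freq 0 N E c| <= d + e + (r + r)%:R / (hlen L 0 N)%:R.
Proof.
move=> NN' lE dE Cc eC.
have := letter_freq_blocks c (leq0n N) NN' lE.
set z := bimorph _ _; set H := hlen L N N'; set avg := (_ / H%:R) => zavg.
suff : `|avg - letter_freq 0 N E c| <= d + e.
  have := ler_normD (letter_freq 0 N' E c - avg) (avg - letter_freq 0 N E c).
  rewrite addrA subrK; lra.
have H0 : 0 < H%:R :> R by rewrite ltr0n (hlen_gt0 sL).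
have d0 : 0 <= d by have := dE _ _ Cc Cc; rewrite subrr normr0.
have -> : avg - letter_freq 0 N E c =
    (\sum_(0 <= j < H) (letter_freq 0 N E (z j%:Z) - letter_freq 0 N E c)) / H%:R.
  rewrite sumrB sumr_const_nat subn0 -/H mulrBl; congr (_ - _).
  by rewrite -[letter_freq 0 N E c *+ H]mulr_natr mulfK // hR.
have Hi : 0 <= H%:R^-1 :> R by rewrite invr_ge0 ltW.
rewrite normrM [`|H%:R^-1|]ger0_norm // ler_pdivrMr //.
apply: (le_trans (ler_norm_sum _ _ _)).
apply: (@le_trans _ _ (\sum_(0 <= j < H) (d + (1 - `[< C (z j%:Z) >]%:R)))).
  apply: ler_sum => j _; case: asboolP => [Cz|_] /=.
    by rewrite subrr addr0 dE.
  have := freq_ge0 (R := R) (bimorph (srange s 0 N) (fun=> z j%:Z)) (hlen L 0 N) E.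
  have := freq_le1 (R := R) (bimorph (srange s 0 N) (fun=> z j%:Z)) (hlen L 0 N) E.
  have := freq_ge0 (R := R) (bimorph (srange s 0 N) (fun=> c)) (hlen L 0 N) E.
  have := freq_le1 (R := R) (bimorph (srange s 0 N) (fun=> c)) (hlen L 0 N) E.
  rewrite /letter_freq ler_norml; lra.
rewrite big_split /= sumrB !sumr_const_nat subn0 -/H.
move: eC; rewrite /letter_freq -/z -/H /freq ler_pdivlMr // => eC.
have : occ z H [set y : biseq A | C (y 0)] = \sum_(0 <= j < H) `[< C (z j%:Z) >]%:R :> R.
  by apply: eq_bigr => j _; rewrite /= /bshift add0r.
rewrite -[d *+ H]mulr_natr -[1 *+ H]mulr_natr mul1r; lra.
Qed.

Lemma cvg_inv_hlen (a : R) : a / (hlen L 0 N)%:R @[N --> \oo] --> 0.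
Proof.
apply: (@cvgr0_le _ _ (fun N => `|a| * N.+1%:R^-1)) => [N|].
  rewrite normrM [`|_^-1|]ger0_norm ?invr_ge0 // ler_wpM2l //.
  have hN := ltn_hlen interior 0 N; rewrite add0n in hN.
  by rewrite lef_pV2 ?posrE ?ltr0n ?ler_nat //; exact: leq_ltn_trans hN.
apply: cvgr0Ml.
exact: cvg_harmonic.
Qed.

(** Used with [C] one of the glued alphabets, where [e] bounds the escape from it, and with [C] the
    whole alphabet of a single substitution and [e] zero. *)
Lemma class_measure (C : set A) (e : nat -> R) : C !=set0 ->
  (forall E, local_set E -> exists2 d : nat -> R, d @ \oo --> 0 &
    forall N a b, C a -> C b -> `|letter_freq 0 N E a - letter_freq 0 N E b| <= d N) ->
  e @ \oo --> 0 ->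
  (forall N N' c, (N <= N')%N -> C c ->
    1 - e N <= letter_freq N N' [set y | C (y 0)] c) ->
  exists m : probability (borel_biseq A) R,
  [/\ invariant_measure (ssubshift s 0) m,
    forall E c, local_set E -> C c -> letter_freq 0 N E c @[N --> \oo] --> prob m E &
    forall N, 1 - e N <= prob m (tower (hlen L 0 N) (srange s 0 N)
      (ssubshift s N `&` [set y | C (y 0)]))].
Proof.
move=> [c0 Cc0] dE e0 eC.
have cvgc E : local_set E -> cvgn (fun N => letter_freq 0 N E c0).
  move=> lE; have [d d0 dd] := dE _ lE; have [r lr] := lE.
  apply: (@cvg_of_tail_bound _ _
    (fun N => d N + e N + (r + r)%:R / (hlen L 0 N)%:R)) => [N N' NN'|].
    apply: (letter_freq_cauchy NN' lr (dd N) Cc0); exact: eC.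
  apply: cvgr0D; last exact: cvg_inv_hlen.
  by apply: cvgr0D.
(* Genuine points of the subshifts starting with [c0] replace the constant sequences, so that the
   limit measure is carried by the subshift. *)
have /choice [y Yy] : forall N, exists z, ssubshift s N z /\ z 0 = c0.
  move=> N.
  by have [z ? ?] := ssubshift_letter sL finA interior N c0; exists z.
pose x N := bimorph (srange s 0 N) (y N).
have xfreq E : local_set E ->
    freq (x N) (hlen L 0 N) E - letter_freq 0 N E c0 @[N --> \oo] --> (0 : R).
  move=> [r lE]; apply: cvgr0_le (cvg_inv_hlen (r + r)%:R) => N.
  apply: freq_bimorph_dist => //; first exact: headed_srange.
  by have [] := Yy N.
have xcvg E (l : R) : local_set E -> letter_freq 0 N E c0 @[N --> \oo] --> l ->
    freq (x N) (hlen L 0 N) E @[N --> \oo] --> l.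
  move=> lE cl; rewrite -[l]add0r.
  have -> : (fun N => freq (x N) (hlen L 0 N) E) =
    (fun N => (freq (x N) (hlen L 0 N) E - letter_freq 0 N E c0) + letter_freq 0 N E c0).
    by apply/funext => N; rewrite subrK.
  by apply: cvgD => //; exact: xfreq.
have [||||m [mX mE mK]] :=
    @empirical_limit _ R (ssubshift s 0) x (hlen L 0) finA (@closed_ssubshift _ s 0).
- by move=> k z; exact: ssubshift_bshift.
- by move=> N; apply: (bimorph_ssubshift sL (leq0n N)); have [] := Yy N.
- by move=> N; exact: (ltn_hlen interior 0 N).
- by move=> E lE; apply/cvg_ex; exists (limn (fun N => letter_freq 0 N E c0)); exact/xcvg/cvgc.
exists m; split=> //.
  move=> E c lE Cc; have [d d0 dd] := dE _ lE.
  have -> : (fun N => letter_freq 0 N E c) = (fun N =>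
      (letter_freq 0 N E c - letter_freq 0 N E c0) + letter_freq 0 N E c0).
    by apply/funext => N; rewrite subrK.
  rewrite -[prob m E]add0r; apply: cvgD.
    by apply: cvgr0_le d0 => N; exact: dd.
  suff <- : limn (fun N => letter_freq 0 N E c0) = prob m E by exact: cvgc.
  apply: (@cvg_unique _ _ (freq (x N) (hlen L 0 N) E @[N --> \oo])) => //.
    by apply: xcvg => //; exact: cvgc.
  exact: mE.
move=> N; apply: mK.
  apply: (closed_tower (headed_srange sL 0 N) finA).
  apply: closedI; first exact: closed_ssubshift.
  rewrite -[X in closed X]setCK closedC; apply/local_set_open/local_setC.
  by exists 0%N => z z' zz' /=; rewrite zz'.
(* For [N' >= N], the first block of [x N'] visits the tower at least as often as letters of [C]
   occur in the image of [c0] from level [N'] to level [N]. *)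
exists N => // N' /= NN'; have [Yy1 Yy0] := Yy N'.
rewrite /x (bimorph_srange_cat sL _ (leq0n N) NN') (hlen_cat _ (leq0n N) NN').
apply: le_trans (freq_tower _ _ _ (headed_srange sL 0 N)).
apply: (le_trans (eC N N' c0 NN' Cc0)); rewrite /letter_freq.
have l0 : radius_local 0 [set z : biseq A | C (z 0)].
  by move=> z z' zz' /=; rewrite zz'.
have := freq_bimorph_dist (R := R) (y' := y N') (headed_srange sL N N') l0 (esym Yy0).
rewrite addn0 mul0r normr_le0 subr_eq0 => /eqP ->.
rewrite /freq ler_wpM2r ?invr_ge0 //; apply: ler_sum => k _.
case: asboolP => [Ck|_]; last exact: ler0n.
rewrite asboolT //; split=> //; apply: ssubshift_bshift.
exact: (bimorph_ssubshift sL NN').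
Qed.

End ClassMeasure.

(** * Glued substitutions *)

Section ProlongableBool.
Variables (tau : morph bool) (l : nat).
Hypothesis tau_pos : positive tau.
Hypothesis tau_prol : prolongable tau.
Hypothesis tau_len : constant_length l tau.

Lemma prolongable_ends c :
  nth point (tau c) 0 = c /\ nth point (tau c) l.-1 = c.
Proof.
have [u [v [Eu Ev]]] := tau_prol c; split; first by rewrite Eu.
by have := tau_len c; rewrite Ev size_rcons => <- /=; rewrite nth_rcons ltnn eqxx.
Qed.

(** The image of the other letter begins and ends with that letter, so the occurrence of [e] given
    by positivity is strictly inside. This also yields [l >= 3]. *)
Lemma positive_interior e :
  exists2 p, (0 < p < l.-1)%N & nth point (tau (~~ e)) p = e.
Proof.
have [h0 hl] := prolongable_ends (~~ e); have et := tau_pos e (~~ e).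
have pl : (index e (tau (~~ e)) < l)%N by rewrite -(tau_len (~~ e)) index_mem.
exists (index e (tau (~~ e))); last exact: nth_index.
have ei := nth_index point et.
have p0 : index e (tau (~~ e)) != 0%N.
  by apply/eqP => E; move: ei; rewrite E h0; case: (e).
have pl1 : index e (tau (~~ e)) != l.-1.
  by apply/eqP => E; move: ei; rewrite E hl; case: (e).
lia.
Qed.

Lemma positive_prolongable_length : (3 <= l)%N.
Proof. by have [p] := positive_interior true; lia. Qed.

Lemma prolongable_headed : headed l tau.
Proof.
split => //; first by have := positive_prolongable_length; lia.
by move=> c; have [] := prolongable_ends c.
Qed.

Lemma mpowS m : mpow tau m.+1 = fun c => mext tau (mpow tau m c).
Proof. by []. Qed.

Lemma headed_mpow m : headed (l ^ m) (mpow tau m).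
Proof.
elim: m => [|m IHm]; first by split.
by rewrite expnSr mpowS; exact: headed_comp prolongable_headed IHm.
Qed.

Lemma size_mpow m c : size (mpow tau m c) = (l ^ m)%N.
Proof. by have [_ + _] := headed_mpow m; exact. Qed.

Lemma mpow_last m c : nth point (mpow tau m c) (l ^ m).-1 = c.
Proof.
have l3 := positive_prolongable_length.
elim: m => [|m IHm] //; rewrite mpowS (nth_mext prolongable_headed) ?size_mpow.
  have E : ((l ^ m.+1).-1 = (l ^ m).-1 * l + l.-1)%N.
    have lm : (0 < l ^ m)%N by rewrite expn_gt0; lia.
    by rewrite expnSr -[in LHS](prednK lm) mulSn; lia.
  have l1 : (l.-1 < l)%N by lia.
  rewrite E divnMDl; last by lia.
  rewrite divn_small // addn0 modnMDl modn_small // IHm.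
  by have [] := prolongable_ends c.
by rewrite -expnSr prednK // expn_gt0; lia.
Qed.

Lemma mpow_interior m e :
  exists2 p, (0 < p < (l ^ m.+1).-1)%N & nth point (mpow tau m.+1 (~~ e)) p = e.
Proof.
have l3 := positive_prolongable_length; have [p /andP[p0 pl] pE] := positive_interior e.
have lm : (0 < l ^ m)%N by rewrite expn_gt0; lia.
exists p; first by rewrite p0 expnSr; nia.
rewrite mpowS (nth_mext prolongable_headed) ?size_mpow; last by nia.
rewrite divn_small ?modn_small; [|lia..].
by have [_ _ ->] := headed_mpow m.
Qed.

Lemma srange_const n m : srange (fun=> tau) n (n + m) = mpow tau m.
Proof.
apply/funext => c; rewrite /srange /mpow /index_iota addKn.
have E r : foldr (fun (_ : nat) w => mext tau w) [:: c] r = iter (size r) (mext tau) [:: c].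
  by elim: r => //= _ r ->.
by rewrite E size_iota.
Qed.

Lemma substitution_subshiftE :
  substitution_subshift tau = ssubshift (fun=> tau) 0.
Proof.
congr (subshift_of _); apply/seteqP; split=> w [c [N [N0 wN]]]; exists c, N;
  by [rewrite -(srange_const 0) in wN|rewrite -(srange_const 0)].
Qed.

(** The count of [true] in the image is affine in that of [w], with slope the difference of the
    counts in the two images; the negative term is moved across to stay in [nat]. *)
Lemma count_mext (w : seq bool) :
  (count_mem true (mext tau w) + count_mem true w * count_mem true (tau false) =
   size w * count_mem true (tau false) + count_mem true w * count_mem true (tau true))%N.
Proof.
elim: w => //= c w; rewrite /mext /= count_cat -/(mext tau w).
by case: c => /=; nia.
Qed.

Variable R : realType.

(* The incidence matrix acts on differences of Parikh vectors as multiplication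
   by [count_mem true (tau true) - count_mem true (tau false)]. *)
Lemma count_mpow_dist m :
  `|(count_mem true (mpow tau m true))%:R - (count_mem true (mpow tau m false))%:R|
    <= (l - 2)%:R ^+ m :> R.
Proof.
(* Both letters occur in each image, so the counts lie between [1] and [l - 1] and differ by at most
   [l - 2]. *)
have cb c : (0 < count_mem true (tau c) < l)%N.
  rewrite -has_count has_pred1 tau_pos /= -(tau_len c) ltn_neqAle count_size andbT.
  rewrite -all_count; apply/negP => /allP /(_ false (tau_pos _ _)).
  by [].
elim: m => [|m IHm]; first by rewrite /= subr0 normr1 expr0.
rewrite !mpowS; have := count_mext (mpow tau m true); have := count_mext (mpow tau m false).
rewrite !size_mpow; move: (cb true) (cb false) IHm.
set a := count_mem true (tau false); set b := count_mem true (tau true).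
set x := count_mem true (mpow tau m true); set y := count_mem true (mpow tau m false).
set w := count_mem true (mext tau (mpow tau m true)).
set z := count_mem true (mext tau (mpow tau m false)).
move=> bl al IHm.
move=> /(congr1 (fun n => n%:R : R)); rewrite !natrD !natrM => Ez.
move=> /(congr1 (fun n => n%:R : R)); rewrite !natrD !natrM => Ew.
have -> : w%:R - z%:R = (b%:R - a%:R) * (x%:R - y%:R) :> R by lra.
rewrite normrM exprS ler_pM // natrB; last by lia.
have ab : b%:R + 2 <= a%:R + l%:R :> R by rewrite -!natrD ler_nat; lia.
have ba : a%:R + 2 <= b%:R + l%:R :> R by rewrite -!natrD ler_nat; lia.
by rewrite ler_norml; lra.
Qed.

Lemma sum_bool_word (F : bool -> R) w :
  \sum_(0 <= j < size w) F (nth point w j) =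
  (size w)%:R * F false + (count_mem true w)%:R * (F true - F false).
Proof.
rewrite -(big_nth point xpredT F); elim: w => [|c w IHw].
  by rewrite big_nil !mul0r addr0.
rewrite big_cons IHw /= natrD -[(size w).+1]add1n natrD.
by case: c => /=; ring.
Qed.

(** On two letters, an average over a word is affine in its proportion of [true], with slope at most
    1 in modulus; the two proportions differ by at most [(l - 2)^m / l^m]. *)
Lemma mpow_average_dist m (F : bool -> R) : (forall c, 0 <= F c <= 1) ->
  `|(\sum_(0 <= j < l ^ m) F (nth point (mpow tau m true) j)) / (l ^ m)%:R -
    (\sum_(0 <= j < l ^ m) F (nth point (mpow tau m false) j)) / (l ^ m)%:R|
    <= ((l - 2)%:R / l%:R) ^+ m.
Proof.
move=> F01; have l3 := positive_prolongable_length.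
have lm : 0 < (l ^ m)%:R :> R by rewrite ltr0n expn_gt0; lia.
rewrite -!mulrBl -{1}(size_mpow m true) -{1}(size_mpow m false) !sum_bool_word.
rewrite !size_mpow opprD addrACA subrr add0r -mulrBl normrM.
rewrite [`|_^-1|]ger0_norm ?invr_ge0 ?(ltW lm) // expr_div_n -!natrX ler_wpM2r //.
rewrite normrM natrX -[leRHS]mulr1 ler_pM // ?count_mpow_dist //.
have /andP[? ?] := F01 true; have /andP[? ?] := F01 false.
by rewrite ler_norml; lra.
Qed.

End ProlongableBool.

Section Glued.
Variables (d : nat) (t : 'Z_d -> morph bool) (l : nat).
Hypothesis t_pos : forall i, positive (t i).
Hypothesis t_prol : forall i, prolongable (t i).
Hypothesis t_len : forall i, constant_length l (t i).

Local Notation s := (glued_sequence t).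
Local Notation L := (fun n => (l ^ n.+1)%N).

Let l3 : (3 <= l)%N.
Proof. exact: positive_prolongable_length (t_pos 0) (t_prol 0) (t_len 0). Qed.

Let L3 n : (3 <= l ^ n.+1)%N.
Proof. by rewrite expnS -[3%N]muln1 leq_mul // expn_gt0; lia. Qed.

Lemma finite_letter : finite_set [set: letter d].
Proof. exact: finite_finset. Qed.

Lemma kappa_size (w : seq (letter d)) : size (kappa w) = size w.
Proof. by case: w => //= c w; rewrite size_rcons size_belast. Qed.

Lemma kappa_nth (w : seq (letter d)) k : (k < size w)%N ->
  nth point (kappa w) k = if k == (size w).-1 then
    ((nth point w k).1 + 1, (nth point w k).2) else nth point w k.
Proof.
case: w => //= c w; rewrite lastI !nth_rcons size_belast ltnS.
by case: ltngtP.
Qed.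

Lemma glued_size n c : size (s n c) = (l ^ n.+1)%N.
Proof.
by rewrite /glued_sequence /glue kappa_size size_map (size_mpow (t_pos _) (t_prol _) (t_len _)).
Qed.

Lemma glued_nth n i e k : (k < (l ^ n.+1).-1)%N ->
  nth point (s n (i, e)) k = (i, nth point (mpow (t i) n.+1 e) k).
Proof.
move=> kL; have sm := size_mpow (t_pos i) (t_prol i) (@t_len i) n.+1 e.
rewrite /glued_sequence /glue /= kappa_nth size_map sm; last by lia.
by rewrite ltn_eqF // (nth_map point) // sm; lia.
Qed.

Lemma glued_last n i e : nth point (s n (i, e)) (l ^ n.+1).-1 = (i + 1, e).
Proof.
have sm := size_mpow (t_pos i) (t_prol i) (@t_len i) n.+1 e.
have L0 := L3 n; rewrite /glued_sequence /glue /= kappa_nth size_map sm; last by lia.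
rewrite eqxx (nth_map point) ?sm; last by lia.
by rewrite (mpow_last (t_pos i) (t_prol i) (@t_len i)).
Qed.

Lemma glued_headed n : headed (l ^ n.+1) (s n).
Proof.
split=> [|c|[i e]]; first by have := L3 n; lia.
  exact: glued_size.
rewrite glued_nth; last by have := L3 n; lia.
by have [_ _ ->] := headed_mpow (t_pos i) (t_prol i) (@t_len i) n.+1.
Qed.

Lemma glued_interior n c :
  exists c' p, (0 < p < l ^ n.+1)%N /\ nth point (s n c') p = c.
Proof.
case: c => i e; have [p pL pE] := mpow_interior (t_pos i) (t_prol i) (@t_len i) n e.
exists (i, ~~ e), p; split; first by lia.
by rewrite glued_nth ?pE //; lia.
Qed.

Lemma glued_index n (y : biseq (letter d)) (a : int) (k : nat) :
  (k < (l ^ n.+1).-1)%N -> (bimorph (s n) y (a * (l ^ n.+1)%N%:Z + k%:Z)).1 = (y a).1.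
Proof.
move=> kL; rewrite (bimorphE_lt _ _ (glued_headed n)); last by lia.
by rewrite [y a]surjective_pairing glued_nth.
Qed.

Lemma glued_index_last n (y : biseq (letter d)) (a : int) :
  (bimorph (s n) y (a * (l ^ n.+1)%N%:Z + (l ^ n.+1).-1%:Z)).1 = (y a).1 + 1.
Proof.
rewrite (bimorphE_lt _ _ (glued_headed n)); last by have := L3 n; lia.
by rewrite [y a]surjective_pairing glued_last.
Qed.

(* In an image the alphabet changes between positions L - 2 and L - 1 of every
   block and otherwise only across block boundaries, so two parsings with
   different phases are incompatible as L >= 3. *)
Lemma glued_recognizable n : recognizable (l ^ n.+1) (s n).
Proof.
move=> y y' k kL E; apply/eqP; rewrite -leqn0 leqNgt; apply/negP => k0.
have L3n := L3 n; set h := (l ^ n.+1)%N in kL L3n *.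
have change (z : biseq (letter d)) (a : int) :
    (bimorph (s n) z (a * h%:Z + (h - 2)%N%:Z)).1 <>
    (bimorph (s n) z (a * h%:Z + h.-1%:Z)).1.
  rewrite glued_index ?glued_index_last; last by rewrite -/h; lia.
  by move=> /eqP; rewrite eq_sym -subr_eq0 addrAC subrr add0r oner_eq0.
have [k2|k2] := leqP k (h - 2).
  have /= := change y 0; apply.
  have Ej j : bimorph (s n) y j = bimorph (s n) y' (j - k%:Z).
    by rewrite -E /bshift subrK.
  rewrite !Ej.
  have -> : 0 * h%:Z + (h - 2)%N%:Z - k%:Z = 0 * h%:Z + (h - 2 - k)%N%:Z by lia.
  have -> : 0 * h%:Z + h.-1%:Z - k%:Z = 0 * h%:Z + (h.-1 - k)%N%:Z by lia.
  by rewrite !glued_index // -/h; lia.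
(* Only [k = h - 1] remains. The change in block 0 of [y'] now falls at the offsets [k - 2] and
   [k - 1] of block 1 of [y], both before its last letter; [h >= 3] keeps [k - 2] nonnegative. *)
apply: (change y' 0).
rewrite -E /bshift.
have -> : 0 * h%:Z + (h - 2)%N%:Z + k%:Z = 1 * h%:Z + (k - 2)%N%:Z by lia.
have -> : 0 * h%:Z + h.-1%:Z + k%:Z = 1 * h%:Z + (k - 1)%N%:Z by lia.
by rewrite !glued_index // -/h; lia.
Qed.

Variable R : realType.

Definition index_class (i : 'Z_d) : set (letter d) := [set c | c.1 = i].

Definition index_cylinder (i : 'Z_d) : set (biseq (letter d)) :=
  [set y | index_class i (y 0)].

Lemma radius_local_index i : radius_local 0 (index_cylinder i).
Proof. by move=> y z yz; rewrite /index_cylinder /= yz. Qed.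

Let lR : 3 <= l%:R :> R. Proof. by rewrite (ler_nat R 3). Qed.

(** All letters but the last of an image keep the index, so step [N1] multiplies the lower bound by
    [1 - l^-(N1+1)]. The term [l^-N'] is the unspent part of the allowance [l^-N] and lets the
    induction close. *)
Lemma glued_class_freq N N' i c : (N <= N')%N -> index_class i c ->
  1 - l%:R ^- N + l%:R ^- N' <=
  letter_freq s L N N' (index_cylinder i) c :> R.
Proof.
move=> NN'; rewrite -(subnKC NN'); elim: (N' - N)%N c => [|k IHk] c ci.
  rewrite addn0 subrK /letter_freq /hlen big_geq // srange_id //.
  rewrite /freq /occ big_nat1 divr1 asboolT //.
set N1 := (N + k)%N in IHk *; rewrite addnS -/N1.
have NN1 : (N <= N1)%N := leq_addr _ _.
have := letter_freq_blocks glued_headed c NN1 (leqnSn N1) (@radius_local_index i) (R := R).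
rewrite addn0 mul0r normr_le0 subr_eq0 => /eqP ->; rewrite srange1 hlen1.
have LL : 0 < (l ^ N1.+1)%:R :> R by rewrite ltr0n; have := L3 N1; lia.
rewrite ler_pdivlMr // -[in X in index_iota _ X](@prednK (l ^ N1.+1)); last by have := L3 N1; lia.
rewrite big_nat_recr //=.
set b : R := 1 - l%:R ^- N + l%:R ^- N1 in IHk *.
apply: (@le_trans _ _ (\sum_(0 <= j < (l ^ N1.+1).-1) b)); last first.
  rewrite -[leLHS]addr0 lerD ?freq_ge0 //; apply: ler_sum_nat => j /andP[_ jL].
  apply: IHk; rewrite /index_class /= -[j%:Z]add0r -(mul0r (l ^ N1.+1)%:Z).
  by rewrite glued_index.
rewrite sumr_const_nat subn0 -[b *+ _]mulr_natr -subn1 natrB; last by have := L3 N1; lia.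
have l0 : 0 < l%:R :> R by apply: lt_le_trans lR; rewrite ltr0n.
have b1 : b <= 1.
  have l1 : 1 < l%:R :> R by apply: lt_le_trans lR; rewrite (ltr_nat R 1).
  have : l%:R ^- N1 <= l%:R ^- N :> R.
    by rewrite lef_pV2 ?posrE ?exprn_gt0 // ler_eXn2l.
  rewrite /b; lra.
pose p : R := l%:R ^+ N1; have p0 : 0 < p by rewrite exprn_gt0.
have -> : (l ^ N1.+1)%:R = l%:R * p :> R by rewrite natrX exprS.
have -> : 1 - l%:R ^- N + l%:R ^- N1.+1 = b - p^-1 + (l%:R * p)^-1.
  by rewrite /b exprS -/p; ring.
have E1 : p^-1 * (l%:R * p) = l%:R by field; rewrite gt_eqF.
have E2 : (l%:R * p)^-1 * (l%:R * p) = 1.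
  by rewrite mulVf // mulf_neq0 ?gt_eqF.
(* Cleared of denominators the inequality is [b <= l - 1], while [b <= 1] and [l >= 3]. *)
move: b b1 {IHk} => b b1; rewrite mulrDl mulrBl E1 E2 mulrBr mulr1.
have lR1 : 2 <= l%:R - 1 :> R by rewrite lerBrDr -[_ + 1](natrD _ 2 1).
by lra.
Qed.

(** The three terms: contraction by [tau_i^(N+1)], the last letter altered by [kappa] in each of the
    two images, and windows across the cuts in each of them. *)
Lemma glued_letter_freq_dist N E r i : radius_local r E ->
  `|letter_freq s L 0 N.+1 E (i, true) - letter_freq s L 0 N.+1 E (i, false)|
  <= ((l - 2)%:R / l%:R) ^+ N.+1 + 2 / (l ^ N.+1)%:R
     + 2 * ((r + r)%:R / (hlen L 0 N)%:R) :> R.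
Proof.
move=> lE; pose F e : R := letter_freq s L 0 N E (i, e).
have LR : 0 < (l ^ N.+1)%:R :> R by rewrite ltr0n; have := L3 N; lia.
have appr e : `|letter_freq s L 0 N.+1 E (i, e) -
   (\sum_(0 <= j < l ^ N.+1) F (nth point (mpow (t i) N.+1 e) j)) / (l ^ N.+1)%:R|
   <= (l ^ N.+1)%:R^-1 + (r + r)%:R / (hlen L 0 N)%:R.
  have SS' : `|\sum_(0 <= j < l ^ N.+1)
        letter_freq s L 0 N E (bimorph (s N) (fun=> (i, e)) j%:Z) -
      \sum_(0 <= j < l ^ N.+1) F (nth point (mpow (t i) N.+1 e) j)|
      <= (0 + 1)%N%:R * 1.
    apply: sum_dist => // k.
      move=> kL; rewrite /F.
      set a := letter_freq _ _ _ _ _ _; set b := letter_freq _ _ _ _ _ _.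
      have : 0 <= a <= 1 by rewrite freq_ge0 freq_le1.
      have : 0 <= b <= 1 by rewrite freq_ge0 freq_le1.
      by move=> /andP[? ?] /andP[? ?]; rewrite ler_norml; lra.
    move=> _ kL; rewrite /F -[k%:Z]add0r -(mul0r (l ^ N.+1)%:Z).
    rewrite (bimorphE_lt _ _ (glued_headed N)); last by lia.
    by rewrite glued_nth //; lia.
  rewrite add0n mulr1 in SS'.
  have := letter_freq_blocks glued_headed (i, e) (leq0n N) (leqnSn N) lE (R := R).
  rewrite srange1 hlen1; move: SS'.
  set S := \sum_(_ <= _ < _) _; set S' := \sum_(_ <= _ < _) _ => SS' H.
  have : `|S / (l ^ N.+1)%:R - S' / (l ^ N.+1)%:R| <= (l ^ N.+1)%:R^-1.
    rewrite -mulrBl normrM [`|_^-1|]ger0_norm ?invr_ge0 ?(ltW LR) //.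
    by rewrite ler_piMl // invr_ge0 ltW.
  have := ler_normD (letter_freq s L 0 N.+1 E (i, e) - S / (l ^ N.+1)%:R)
    (S / (l ^ N.+1)%:R - S' / (l ^ N.+1)%:R).
  rewrite addrA subrK; move: H; lra.
have F01 c : 0 <= F c <= 1 by rewrite freq_ge0 freq_le1.
have := mpow_average_dist (t_pos i) (t_prol i) (@t_len i) N.+1 F01.
have := appr true; have := appr false.
set a := letter_freq _ _ _ _ _ _; set b := letter_freq _ _ _ _ _ _.
set a' := _ / _; set b' := _ / _; set u := _ ^+ _.
by rewrite !ler_norml => /andP[? ?] /andP[? ?] /andP[? ?]; apply/andP; split; lra.
Qed.

End Glued.

(** * Index towers *)

Section FinitePartitions.
Context d (T : measurableType d) (R : realType).
Implicit Types (m : probability T R) (E : set T).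

Lemma prob_partition m (I : finType) (B : I -> set T) (X : set T) E :
  (forall i, measurable (B i)) -> (forall i j, i != j -> B i `&` B j = set0) ->
  measurable X -> prob m X = 1 -> (forall x, X x -> exists i, B i x) ->
  measurable E -> prob m E = \sum_i prob m (E `&` B i).
Proof.
move=> mB dB mX X1 XB mE; rewrite -prob_bigsetU.
- have mU : measurable (\big[setU/set0]_i B i) by apply: bigsetU_measurable.
  rewrite -big_distrr /= probI_full //; apply/eqP; rewrite eq_le prob_le1 //=.
  rewrite -X1; apply: le_prob => // x /XB [i Bix].
  by rewrite (bigD1 i) //=; left.
- by move=> i; exact: measurableI.
- by move=> i j ij; rewrite setIACA dB ?setI0.
Qed.

Lemma prob_sigma_additive m (F : nat -> set T) :
  (forall i, measurable (F i)) -> trivIset setT F ->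
  \sum_(0 <= i < n) prob m (F i) @[n --> \oo] --> prob m (\bigcup_i F i).
Proof.
move=> mF tF; have mU : measurable (\bigcup_i F i) by exact: bigcupT_measurable.
have c := @measure_semi_sigma_additive _ _ _ m F mF tF mU.
have -> : (fun n => \sum_(0 <= i < n) prob m (F i)) =
    fine \o (fun n => (\sum_(0 <= i < n) m (F i))%E).
  apply/funext => n /=; under [in RHS]eq_bigr do rewrite probE //.
  by rewrite sumEFin.
by apply: fine_cvg; rewrite -probE.
Qed.

Lemma convex_combination (I : finType) (q : I -> R) (mu : I -> probability T R) :
  (forall i, 0 <= q i) -> \sum_i q i = 1 ->
  exists m : probability T R,
    forall E, measurable E -> prob m E = \sum_i q i * prob (mu i) E.
Proof.
move=> q0 q1.
have [||||m mE] := @exists_probability _ T R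
    (fun E => (\sum_i q i * prob (mu i) E)%:E).
- by rewrite big1 // => i _; rewrite prob0 mulr0.
- by move=> E; rewrite lee_fin sumr_ge0 // => i _; rewrite mulr_ge0 ?prob_ge0.
- move=> F mF tF mUF.
  under eq_fun do rewrite sumEFin exchange_big /=.
  apply: cvg_EFin; first by near=> n.
  apply: cvg_big => [|i _]; first exact: add_continuous.
  under eq_fun do rewrite -mulr_sumr.
  apply: cvgMr; exact: prob_sigma_additive.
- by congr EFin; under eq_bigr do rewrite probT mulr1.
by exists m => E mE'; rewrite /prob mE.
Unshelve. all: by end_near. Qed.

End FinitePartitions.

Section GluedMeasures.
Variables (d : nat) (t : 'Z_d -> morph bool) (l : nat).
Hypothesis t_pos : forall i, positive (t i).
Hypothesis t_prol : forall i, prolongable (t i).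
Hypothesis t_len : forall i, constant_length l (t i).
Variable R : realType.

Local Notation s := (glued_sequence t).
Local Notation L := (fun n => (l ^ n.+1)%N).
Local Notation X n := (ssubshift s n).
Local Notation h n := (hlen L 0 n).
Local Notation borel := (borel_biseq (letter d)).

Let sL n : headed (L n) (s n). Proof. exact: glued_headed. Qed.
Let interior n c : exists c' p, (0 < p < L n)%N /\ nth point (s n c') p = c.
Proof. exact: glued_interior. Qed.
Let hX n N : headed (hlen L n N) (srange s n N). Proof. exact: headed_srange. Qed.
Let rX n N : recognizable (hlen L n N) (srange s n N).
Proof. by apply: recognizable_srange => // k; exact: glued_recognizable. Qed.
Let finA : finite_set [set: letter d]. Proof. exact: finite_letter. Qed.
Let cX n : closed (X n). Proof. exact: closed_ssubshift. Qed.
Let l3 : (3 <= l)%N.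
Proof. exact: positive_prolongable_length (t_pos 0) (t_prol 0) (t_len 0). Qed.
Let lgt0 : 0 < l%:R :> R. Proof. by rewrite ltr0n; lia. Qed.

Lemma cvg_exprVn : (l%:R : R) ^- n @[n --> \oo] --> 0.
Proof.
under eq_fun do rewrite -exprVn; apply: cvg_expr.
rewrite ger0_norm ?invr_ge0 ?ler0n // invf_lt1 //.
by rewrite (ltr_nat R 1); lia.
Qed.

Lemma glued_class_dist i E : local_set E -> exists2 b : nat -> R, b @ \oo --> 0 &
  forall N a c, index_class i a -> index_class i c ->
    `|letter_freq s L 0 N E a - letter_freq s L 0 N E c| <= b N.
Proof.
move=> [r lE].
exists (fun N => `|letter_freq s L 0 N E (i, true) - letter_freq s L 0 N E (i, false)|).
  rewrite -cvg_shiftS.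
  apply: (@cvgr0_le _ _ (fun N => ((l - 2)%:R / l%:R) ^+ N.+1 +
      2 * l%:R ^- N.+1 + 2 * ((r + r)%:R / (h N)%:R))).
    move=> N; rewrite normr_id -natrX.
    exact: glued_letter_freq_dist.
  apply: cvgr0D.
    apply: cvgr0D.
      rewrite (cvg_shiftS (fun N => ((l - 2)%:R / l%:R : R) ^+ N)).
      apply: cvg_expr; rewrite ger0_norm ?divr_ge0 // ltr_pdivrMr // mul1r.
      by rewrite ltr_nat; lia.
    apply: cvgr0Ml.
    by rewrite (cvg_shiftS (fun N => (l%:R : R) ^- N)); exact: cvg_exprVn.
  apply: cvgr0Ml.
  exact: (cvg_inv_hlen interior).
move=> N [a1 a] [c1 c]; rewrite /index_class /= => -> ->.
by case: a; case: c; rewrite ?subrr ?normr0 ?normr_ge0 // distrC.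
Qed.

Definition index_tower N i : set (biseq (letter d)) :=
  tower (h N) (srange s 0 N) (X N `&` index_cylinder i).

Lemma closed_index_cylinder i : closed (@index_cylinder d i).
Proof.
rewrite -[index_cylinder i]setCK closedC; apply/local_set_open/local_setC.
by exists 0%N; exact: radius_local_index.
Qed.

Lemma measurable_index_tower N i : measurable (index_tower N i : set borel).
Proof.
apply: (measurable_tower (hX 0 N) finA).
by apply: closedI => //; exact: closed_index_cylinder.
Qed.

Lemma glued_measure i : exists m : probability borel R,
  [/\ invariant_measure (X 0) m,
    forall E c, local_set E -> index_class i c ->
      letter_freq s L 0 N E c @[N --> \oo] --> prob m E &
    forall N, 1 - l%:R ^- N <= prob m (index_tower N i)].
Proof.
apply: (class_measure sL finA interior (C := index_class i)) cvg_exprVn _.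
- by exists (i, true).
- exact: glued_class_dist.
move=> N N' c NN' ci; apply: le_trans (glued_class_freq t_pos t_prol t_len R NN' ci).
by rewrite lerDl invr_ge0 exprn_ge0.
Qed.

Lemma X_tower n : X 0 `<=` tower (h n) (srange s 0 n) (X n).
Proof.
move=> x /(desubstitution sL (leq0n n)) [y [k [Xy kh ->]]].
by apply/towerP; exists k, y.
Qed.

(** The set E_i of the overview, as the lower limit of the index towers. *)
Definition tail_index i : set (biseq (letter d)) :=
  \bigcup_n [set x | forall k, (n <= k)%N -> index_tower k i x].

Let tailI i n := [set x | forall k, (n <= k)%N -> index_tower k i x].

Let tailIE i n : tailI i n = \bigcap_p [set x | forall k, (k <= p)%N -> index_tower (n + k) i x].
Proof.
apply/seteqP; split=> [x xI p _ k _|x xI k nk]; first by apply: xI; exact: leq_addr.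
by have := xI (k - n)%N I (k - n)%N (leqnn _); rewrite subnKC.
Qed.

Let partialS i n p : [set x | forall k, (k <= p.+1)%N -> index_tower (n + k) i x] =
  [set x | forall k, (k <= p)%N -> index_tower (n + k) i x] `&` index_tower (n + p.+1) i.
Proof.
apply/seteqP; split=> [x xI|x [xI xp] k].
  by split=> [k kp|]; apply: xI => //; exact: leqW.
by rewrite leq_eqVlt => /orP[/eqP -> //|]; exact: xI.
Qed.

Let mpartial i n p :
  measurable ([set x | forall k, (k <= p)%N -> index_tower (n + k) i x] : set borel).
Proof.
elim: p => [|p IHp]; last first.
  by rewrite partialS; apply: measurableI => //; exact: measurable_index_tower.
rewrite (_ : [set _ | _] = index_tower n i); first exact: measurable_index_tower.
apply/seteqP; split=> [x /(_ 0%N isT)|x xn k]; rewrite ?addn0 //.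
by rewrite leqn0 => /eqP ->; rewrite addn0.
Qed.

Let mtailI i n : measurable (tailI i n : set borel).
Proof. by rewrite tailIE; apply: bigcapT_measurable. Qed.

Lemma measurable_tail_index i : measurable (tail_index i : set borel).
Proof. by apply: bigcupT_measurable => n; exact: mtailI. Qed.

Lemma index_tower_disjoint N i j : i != j -> index_tower N i `&` index_tower N j = set0.
Proof.
move=> ij; rewrite /index_tower (tower_disjoint (hX 0 N) (@rX 0 N)) //.
apply/seteqP; split=> // y [[_ yi] [_ yj]]; case/eqP: ij.
by rewrite -yi -yj.
Qed.

Lemma tail_index_disjoint i j : i != j -> tail_index i `&` tail_index j = set0.
Proof.
move=> ij; apply/seteqP; split=> // x [[n _ xn] [k _ xk]].
rewrite -(index_tower_disjoint (maxn n k) ij); split.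
  by apply: xn; exact: leq_maxl.
by apply: xk; exact: leq_maxr.
Qed.

Section InvariantMeasure.
Variable m : probability borel R.
Hypothesis mX : invariant_measure (X 0) m.

Let X1 : prob m (X 0) = 1. Proof. by have [] := (invariant_measureP m (@cX 0)).1 mX. Qed.

(* A point leaves the towers of index [i] at step [N + 1] only if its block of
   level [N] is the last one of its block of level [N + 1]. *)
Lemma prob_index_towerD N i :
  prob m (index_tower N i `\` index_tower N.+1 i) <= l%:R ^- N.+1.
Proof.
set g := srange s 0 N.+1; have hN : h N.+1 = (l ^ N.+1 * h N)%N by rewrite hlenS.
have L0 : (0 < l ^ N.+1)%N by rewrite expn_gt0; lia.
have h0 : (0 < h N)%N by exact: (hlen_gt0 sL).
have XN1 : closed (X N.+1) by [].
(* The levels lying in the last of the [l^(N+1)] sub-blocks of the tower of level [N + 1]: there are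
   [h N] of them, each of mass at most the inverse of [h N.+1]. *)
set lev := fun k => level g (X N.+1) (k + (l ^ N.+1).-1 * h N).
have mlev k : measurable (lev k : set borel).
  exact: (measurable_level (hX 0 N.+1) finA).
have sub : X 0 `&` (index_tower N i `\` index_tower N.+1 i) `<=`
    \big[setU/set0]_(k < h N) lev k.
  move=> x [_ [/towerP [k [y [kh [Xy yi] ->]]] nT]].
  have [z [j [Xz jL yE]]] := desubstitution sL (leqnSn N) Xy.
  rewrite hlen1 srange1 in jL yE.
  have zE : bshift k%:Z (bimorph (srange s 0 N) y) =
      bshift (k + j * h N)%N%:Z (bimorph g z).
    rewrite yE (bimorph_bshift _ _ (hX 0 N)) bshiftD /g.
    by rewrite (bimorph_srange_cat sL _ (leq0n N) (leqnSn N)) srange1 PoszD PoszM.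
  have [jE|jL'] := eqVneq j (l ^ N.+1).-1.
    rewrite -bigcup_mkord; exists k => //; exists z => //.
    by rewrite zE jE.
  case: nT; apply/towerP; exists (k + j * h N)%N, z; split => //.
    rewrite hN; have : (j.+1 * h N <= (l ^ N.+1) * h N)%N by rewrite leq_mul2r jL orbT.
    by rewrite mulSn; lia.
  split=> //; move: yi; rewrite /index_cylinder /index_class /= yE /bshift add0r.
  rewrite -[j%:Z]add0r -(mul0r (l ^ N.+1)%:Z) (glued_index t_pos t_prol t_len) //.
  by rewrite ltn_neqAle jL' /=; lia.
have mT j k : measurable (index_tower j k : set borel) by exact: measurable_index_tower.
have mX0 : measurable (X 0 : set borel) by exact: measurable_closed_biseq.
have mTT : measurable (index_tower N i `\` index_tower N.+1 i : set borel).
  exact: measurableD.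
have <- := probI_full mTT mX0 X1.
rewrite setIC; apply: (@le_trans _ _ (prob m (\big[setU/set0]_(k < h N) lev k))).
  apply: le_prob => //; last by apply: bigsetU_measurable.
  exact: measurableI.
rewrite prob_bigsetU_nat //; last first.
  have hle k : (k < h N)%N -> (k + (l ^ N.+1).-1 * h N < h N.+1)%N.
    by rewrite hN -{2}(prednK L0) mulSn; lia.
  move=> k k' kh kh' kk'; apply: (level_disjoint (hX 0 N.+1) (@rX 0 N.+1));
    [exact: hle|exact: hle|by rewrite eqn_add2r].
under eq_bigr => k _ do rewrite (prob_level (hX 0 N.+1) finA mX) //.
rewrite sumr_const card_ord -[prob _ _ *+ _]mulr_natl.
have := prob_le1 m (measurable_tower (hX 0 N.+1) finA XN1).
rewrite (prob_tower (hX 0 N.+1) (@rX 0 N.+1) finA mX) // -/g hN natrM -mulrA.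
by rewrite -ler_pdivlMl ?ltr0n // mulr1 natrX.
Qed.

(** A quantitative Borel-Cantelli argument. In [H] the term [l^-(N+p)] is what remains of the
    allowance [l^-N]; the next loss [l^-(N+p+1)] fits because [l >= 2]. *)
Lemma prob_tail_index_ge N i :
  prob m (index_tower N i) - l%:R ^- N <= prob m (tail_index i).
Proof.
have mT j k : measurable (index_tower j k : set borel) by exact: measurable_index_tower.
apply: (@le_trans _ _ (prob m (tailI i N))); last first.
  apply: le_prob => //; first exact: measurable_tail_index.
  by move=> x xN; exists N.
have H p : prob m (index_tower N i) - l%:R ^- N + l%:R ^- (N + p) <=
    prob m [set x | forall k, (k <= p)%N -> index_tower (N + k) i x].
  elim: p => [|p IHp].
    rewrite addn0 subrK; apply: le_prob => // x xN k.
    by rewrite leqn0 => /eqP ->; rewrite addn0.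
  rewrite partialS; set P := [set _ | _] in IHp *.
  have mP : measurable (P : set borel) by exact: mpartial.
  have := probDI m mP (mT (N + p.+1)%N i).
  have : prob m (P `\` index_tower (N + p.+1) i) <= l%:R ^- (N + p).+1.
    apply: le_trans (prob_index_towerD (N + p) i).
    apply: le_prob; [exact: measurableD|exact: measurableD|].
    by rewrite -addnS => x [xP xn]; split=> //; exact: xP.
  have : 2 * l%:R ^- (N + p).+1 <= l%:R ^- (N + p) :> R.
    rewrite exprS invfM mulrA ler_piMl ?invr_ge0 ?exprn_ge0 // ler_pdivrMr // mul1r.
    by rewrite (ler_nat R 2); lia.
  move: IHp; rewrite addnS; lra.
rewrite tailIE.
have c := @prob_nonincreasing_cvg _ _ _ m _ (@mpartial i N)
  (fun p x xp k kp => xp k (leqW kp)).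
apply: (closed_cvg (fun a => prob m (index_tower N i) - l%:R ^- N <= a)) c.
  exact: closed_ge.
apply: nearW => p; apply: le_trans (H p).
by rewrite lerDl invr_ge0 exprn_ge0.
Qed.

Lemma sum_prob_index_tower N E : measurable (E : set borel) ->
  prob m E = \sum_i prob m (E `&` index_tower N i).
Proof.
move=> mE; apply: (@prob_partition _ borel R m _ (index_tower N) (X 0)) => //.
- by move=> i; exact: measurable_index_tower.
- exact: index_tower_disjoint.
- exact: measurable_closed_biseq.
move=> x /(X_tower N) /towerP [k [y [kh Xy ->]]].
by exists (y 0).1; apply/towerP; exists k, y.
Qed.

Lemma sum_prob_index_towerT N : \sum_i prob m (index_tower N i) = 1.
Proof.
rewrite -(probT m) (@sum_prob_index_tower N setT) //.
by apply: eq_bigr => i _; rewrite setTI.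
Qed.

(** At most 1 by disjointness. At least 1 because the index towers of each level carry full mass and
    each limit set loses at most [l^-N] of its tower. *)
Lemma sum_prob_tail_index : \sum_i prob m (tail_index i) = 1.
Proof.
apply/eqP; rewrite eq_le; apply/andP; split.
  rewrite -(@prob_bigsetU _ borel).
  - by apply: prob_le1; apply: bigsetU_measurable => i _; exact: measurable_tail_index.
  - by move=> i; exact: measurable_tail_index.
  - exact: tail_index_disjoint.
have H N : 1 - #|'Z_d|%:R * l%:R ^- N <= \sum_i prob m (tail_index i).
  rewrite -[Z in Z - _](sum_prob_index_towerT N) mulr_natl -sumr_const -sumrB; apply: ler_sum => i _.
  exact: prob_tail_index_ge.
have c : 1 - #|'Z_d|%:R * l%:R ^- N @[N --> \oo] --> (1 - #|'Z_d|%:R * 0 : R).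
  by apply: cvgB; [exact: cvg_cst|apply: cvgM; [exact: cvg_cst|exact: cvg_exprVn]].
rewrite mulr0 subr0 in c.
apply: (closed_cvg (fun a => a <= \sum_i prob m (tail_index i))) c.
  exact: closed_le.
exact: nearW.
Qed.

(** Only a lower bound on each limit set is known. As both families of masses sum to 1, the errors
    [a j], made nonnegative by adding [l^-N], have a sum tending to 0, hence each of them does. *)
Lemma cvg_prob_index_tower i :
  prob m (index_tower N i) @[N --> \oo] --> prob m (tail_index i).
Proof.
apply/subr_cvg0.
apply: (@cvgr0_le _ _ (fun N => (#|'Z_d|%:R + 1) * l%:R ^- N)); last first.
  by apply: cvgr0Ml; exact: cvg_exprVn.
move=> N; pose a j := prob m (tail_index j) - prob m (index_tower N j) + l%:R ^- N.
have a0 j : 0 <= a j by have := prob_tail_index_ge N j; rewrite /a; lra.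
have sa : \sum_j a j = #|'Z_d|%:R * l%:R ^- N.
  rewrite /a big_split /= sumrB sum_prob_tail_index sum_prob_index_towerT.
  by rewrite subrr add0r sumr_const mulr_natl.
have ai : a i <= #|'Z_d|%:R * l%:R ^- N.
  by rewrite -sa (bigD1 i) //= lerDl sumr_ge0.
have e0 : 0 <= l%:R ^- N :> R by rewrite invr_ge0 exprn_ge0.
by move: ai (a0 i); rewrite /a ler_norml mulrDl mul1r => ? ?; lra.
Qed.

End InvariantMeasure.
End GluedMeasures.

(** * Ergodic measures of the glued subshift *)

Section GluedErgodicity.
Variables (d : nat) (t : 'Z_d -> morph bool) (l : nat).
Hypothesis t_pos : forall i, positive (t i).
Hypothesis t_prol : forall i, prolongable (t i).
Hypothesis t_len : forall i, constant_length l (t i).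
Variable R : realType.

Local Notation s := (glued_sequence t).
Local Notation L := (fun n => (l ^ n.+1)%N).
Local Notation X n := (ssubshift s n).
Local Notation h n := (hlen L 0 n).
Local Notation borel := (borel_biseq (letter d)).
Local Notation Tail i := (tail_index t l i).
Local Notation IT N i := (index_tower t l N i).

Let sL n : headed (L n) (s n). Proof. exact: glued_headed. Qed.
Let hX n N : headed (hlen L n N) (srange s n N). Proof. exact: headed_srange. Qed.
Let rX : forall n N, recognizable (hlen L n N) (srange s n N).
Proof. by move=> n N; apply: recognizable_srange => // k; exact: glued_recognizable. Qed.
Let finA : finite_set [set: letter d]. Proof. exact: finite_letter. Qed.
Let cX : forall n, closed (X n). Proof. by move=> n; exact: closed_ssubshift. Qed.

Definition letter_tower n N (c : letter d) : set (biseq (letter d)) :=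
  tower (hlen L n N) (srange s n N) (X N `&` [set y | y 0 = c]).

Lemma closed_letter_base N (c : letter d) :
  closed (X N `&` [set y : biseq (letter d) | y 0 = c]).
Proof.
apply: closedI; first exact: cX.
rewrite -[Z in closed Z]setCK closedC; apply/local_set_open/local_setC.
by exists 0%N => y z yz /= <-; rewrite yz.
Qed.

Lemma measurable_letter_tower n N c : measurable (letter_tower n N c : set borel).
Proof. by apply: (measurable_tower (hX n N) finA); exact: closed_letter_base. Qed.

Lemma letter_tower_disjoint n N a b :
  a != b -> letter_tower n N a `&` letter_tower n N b = set0.
Proof.
move=> ab; rewrite /letter_tower (tower_disjoint (hX n N) (@rX n N)) //.
by apply/seteqP; split=> // y [[_ /= ->] [_ /= E]]; rewrite E eqxx in ab.
Qed.

Lemma mem_letter_tower N c x : letter_tower 0 N c x -> IT N c.1 x.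
Proof.
move=> /towerP [k [y [kh [Xy yc] ->]]]; apply/towerP; exists k, y; split => //.
by split=> //; rewrite /index_cylinder /index_class /= yc.
Qed.

Section LetterTowers.
Variables (n N : nat) (m : probability borel R).
Hypothesis nN : (n <= N)%N.
Hypothesis mX : invariant_measure (X n) m.

Lemma prob_letter_towers E : measurable (E : set borel) ->
  prob m E = \sum_c prob m (E `&` letter_tower n N c).
Proof.
move=> mE.
have m1 : prob m (X n) = 1 by have [] := (invariant_measureP m (@cX n)).1 mX.
apply: (@prob_partition _ borel R m _ (letter_tower n N) (X n)) => //.
- by move=> c; exact: measurable_letter_tower.
- exact: letter_tower_disjoint.
- by apply: measurable_closed_biseq; exact: cX.
move=> x /(desubstitution sL nN) [y [k [Xy kh ->]]].
by exists (y 0); apply/towerP; exists k, y.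
Qed.

Lemma sum_prob_letter_tower : \sum_c prob m (letter_tower n N c) = 1.
Proof.
rewrite -(probT m) prob_letter_towers //.
by apply: eq_bigr => c _; rewrite setTI.
Qed.

(** Reduces an invariant measure to its letter-tower masses: from level 0 for the decomposition into
    the limit measures, and over one step for the induced measures. *)
Lemma prob_letter_freq_approx r E : radius_local r E ->
  `|prob m E - \sum_c letter_freq s L n N E c * prob m (letter_tower n N c)|
  <= (r + r)%:R / (hlen L n N)%:R.
Proof.
move=> lr; have mE : measurable (E : set borel).
  by apply: measurable_local_biseq; exists r.
rewrite (prob_letter_towers mE) -sumrB; apply: (le_trans (ler_norm_sum _ _ _)).
apply: (@le_trans _ _ (\sum_c (r + r)%:R / (hlen L n N)%:R * prob m (letter_tower n N c))).
  apply: ler_sum => c _.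
  apply: (prob_tower_approx (hX n N) (@rX n N) finA mX) => //.
    exact: closed_letter_base.
  by move=> y [].
by rewrite -mulr_sumr sum_prob_letter_tower mulr1.
Qed.

End LetterTowers.

(** * Decomposition of invariant measures and ergodicity *)

Section Decomposition.
Variable mu : 'Z_d -> probability borel R.
Hypothesis mu_inv : forall i, invariant_measure (X 0) (mu i).
Hypothesis mu_freq : forall i E c, local_set E -> index_class i c ->
  letter_freq s L 0 N E c @[N --> \oo] --> prob (mu i) E.
Hypothesis mu_tower : forall i N, 1 - l%:R ^- N <= prob (mu i) (IT N i).

(** [u N] is the weighted mean of the frequencies at level [N], close to [prob m E]; [v N] has the
    limit frequencies instead. These depend on the index alone, so [v N] groups into index towers,
    whose masses converge to those of the limit sets. *)
Lemma prob_local_decomposition m E : invariant_measure (X 0) m -> local_set E ->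
  prob m E = \sum_i prob m (Tail i) * prob (mu i) E.
Proof.
move=> mX lE; have [r lr] := lE.
have mE : measurable (E : set borel) by exact: measurable_local_biseq.
have partE N := @prob_letter_towers 0%N N m (leq0n N) mX.
pose u N : R := \sum_c letter_freq s L 0 N E c * prob m (letter_tower 0 N c).
pose v N : R := \sum_c prob (mu c.1) E * prob m (letter_tower 0 N c).
have towerE N i : \sum_(c | c.1 == i) prob m (letter_tower 0 N c) = prob m (IT N i).
  rewrite [RHS](partE N); last exact: measurable_index_tower.
  rewrite big_mkcond; apply: eq_bigr => c _; have [<-|ci] := eqVneq c.1 i.
    by congr (prob m _); apply/esym/setIidPr => x; exact: mem_letter_tower.
  rewrite (_ : _ `&` _ = set0) ?prob0 //; apply/seteqP; split=> // x [xi xc].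
  rewrite -(index_tower_disjoint t_pos t_prol t_len N ci); split => //.
  exact: mem_letter_tower.
have vE N : v N = \sum_i prob m (IT N i) * prob (mu i) E.
  rewrite /v (partition_big (fun c : letter d => c.1) xpredT) //=.
  apply: eq_bigr => i _; rewrite -towerE mulr_suml.
  by apply: eq_bigr => c /eqP ->; rewrite mulrC.
have vlim : v N @[N --> \oo] --> \sum_i prob m (Tail i) * prob (mu i) E.
  under eq_fun do rewrite vE.
  apply: cvg_big => [|i _]; first exact: add_continuous.
  apply: cvgM; last exact: cvg_cst.
  exact: (cvg_prob_index_tower t_pos t_prol t_len mX).
have uE N : `|prob m E - u N| <= (r + r)%:R / (h N)%:R.
  exact: (prob_letter_freq_approx (leq0n N) mX lr).
have uv : u N - v N @[N --> \oo] --> (0 : R).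
  pose w N : R := \sum_c `|letter_freq s L 0 N E c - prob (mu c.1) E|.
  apply: (@cvgr0_le _ _ w) => [N|].
    rewrite /u /v -sumrB; apply: (le_trans (ler_norm_sum _ _ _)).
    apply: ler_sum => c _; rewrite -mulrBl normrM ler_piMr //.
    by rewrite ger0_norm ?prob_ge0 ?prob_le1 //; exact: measurable_letter_tower.
  rewrite (_ : 0 = \sum_(c : letter d) (0 : R)); last by rewrite big1.
  apply: cvg_big => [|c _]; first exact: add_continuous.
  apply: cvgr0_norm.
  exact: mu_freq.
apply: (@cvg_unique _ _ (v N @[N --> \oo])) => //.
apply/subr_cvg0.
have -> : (fun N => v N - prob m E) = (fun N => - (prob m E - u N) - (u N - v N)).
  by apply/funext => N; ring.
rewrite -[0](subr0 0) -{1}[0]oppr0; apply: cvgB => //; apply: cvgN.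
apply: cvgr0_le uE _.
exact: (cvg_inv_hlen (glued_interior t_pos t_prol t_len)).
Qed.

Lemma prob_decomposition m E : invariant_measure (X 0) m -> measurable (E : set borel) ->
  prob m E = \sum_i prob m (Tail i) * prob (mu i) E.
Proof.
move=> mX mE.
have [||m' m'E] := @convex_combination _ borel R _ (fun i => prob m (Tail i)) mu.
- by move=> i; exact: prob_ge0.
- exact: (sum_prob_tail_index t_pos t_prol t_len mX).
have mm' : same_measure m m'.
  apply: same_measure_local => U lU.
  have mU : measurable (U : set borel) by exact: measurable_local_biseq.
  by rewrite !probE // m'E // (prob_local_decomposition mX lU).
by rewrite -m'E //; have := mm' E mE; rewrite !probE // => -[].
Qed.

Lemma prob_tail_index_self i : prob (mu i) (Tail i) = 1.
Proof.
apply/eqP; rewrite eq_le prob_le1 /=; last exact: measurable_tail_index.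
have c : 1 - 2 * l%:R ^- N @[N --> \oo] --> (1 - 2 * 0 : R).
  apply: cvgB; first exact: cvg_cst.
  apply: cvgM; first exact: cvg_cst.
  exact: (cvg_exprVn t_pos t_prol t_len).
rewrite mulr0 subr0 in c.
apply: (closed_cvg (fun a => a <= prob (mu i) (Tail i))) c; first exact: closed_le.
apply: nearW => N; have := mu_tower i N.
have := prob_tail_index_ge t_pos t_prol t_len (mu_inv i) N i; lra.
Qed.

Lemma prob_tail_index_other (m : probability borel R) i j : invariant_measure (X 0) m ->
  prob m (Tail i) = 1 -> j != i -> prob m (Tail j) = 0.
Proof.
move=> mX mi ji; have := sum_prob_tail_index t_pos t_prol t_len mX.
rewrite (bigD1 i) //= mi => /(canRL (addKr _)); rewrite addNr => S0.
apply/eqP; rewrite eq_le prob_ge0 andbT -S0 (bigD1 j) //= lerDl.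
by apply: sumr_ge0 => k _; exact: prob_ge0.
Qed.

Lemma same_measure_tail m i : invariant_measure (X 0) m ->
  prob m (Tail i) = 1 -> same_measure m (mu i).
Proof.
move=> mX mi E mE; rewrite !probE // (prob_decomposition mX mE).
rewrite (bigD1 i) //= mi mul1r big1 ?addr0 // => j ji.
by rewrite (prob_tail_index_other mX mi ji) mul0r.
Qed.

Lemma glued_measures_distinct i j : same_measure (mu i) (mu j) -> i = j.
Proof.
move=> mij; apply/eqP/negPn/negP => ij.
have := prob_tail_index_other (mu_inv j) (prob_tail_index_self j) ij.
have -> : prob (mu j) (Tail i) = prob (mu i) (Tail i).
  by rewrite /prob mij //; exact: measurable_tail_index.
by rewrite prob_tail_index_self => /eqP; rewrite oner_eq0.
Qed.

(** Conditioned on an invariant [E] of positive mass, [mu i] stays invariant and keeps full mass on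
    [Tail i], so it is [mu i] again, and [E] has mass 1. *)
Lemma glued_ergodic i : ergodic_measure (X 0) (mu i).
Proof.
split=> // E mE ES; have [E0|E0] := eqVneq (prob (mu i) E) 0.
  by left; rewrite probE // E0.
right; set e := prob (mu i) E in E0 *.
have [|||m' m'E] := @scaled_probability _ borel R (mu i) E id e^-1 mE.
- exact: measurable_id.
- by rewrite invr_ge0 prob_ge0.
- by rewrite mulVf.
have [mX1 mXS] := (invariant_measureP (mu i) (@cX 0%N)).1 (mu_inv i).
have full F : measurable (F : set borel) -> prob (mu i) F = 1 -> prob m' F = 1.
  by move=> mF F1; rewrite m'E // (probI_full mE mF F1) mulVf.
have m'X : invariant_measure (X 0) m'.
  apply/invariant_measureP; first exact: cX.
  split; first by apply: full => //; apply: measurable_closed_biseq; exact: cX.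
  move=> F mF; rewrite !m'E //; last exact: (measurable_bshift 1).
  congr (_ * _); rewrite -[RHS]mXS; last exact: measurableI.
  by rewrite preimage_setI ES.
have m'i := same_measure_tail m'X
  (full _ (measurable_tail_index t_pos t_prol t_len i) (prob_tail_index_self i)).
by rewrite -m'i // probE // m'E // preimage_id setIid mulVf.
Qed.

(* [tail_index i] is only almost surely invariant; [tail_core i] is strictly so. *)
Definition tail_core i : set (biseq (letter d)) :=
  \bigcup_n \bigcap_k (@bshift (letter d) (n + k)%N%:Z @^-1` Tail i).

Lemma measurable_tail_core i : measurable (tail_core i : set borel).
Proof.
apply: bigcupT_measurable => n; apply: bigcapT_measurable => k.
by apply: measurable_bshift; exact: measurable_tail_index.
Qed.

Lemma tail_core_invariant i : @bishift _ @^-1` tail_core i = tail_core i.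
Proof.
apply/seteqP; split=> x [n _ xn].
  exists n.+1 => // k _; have := xn k I.
  by rewrite /= bshift1 bshiftD; congr (Tail i (bshift _ x)); lia.
exists n => // k _; have := xn k.+1 I.
by rewrite /= bshift1 bshiftD; congr (Tail i (bshift _ x)); lia.
Qed.

Lemma tail_core_disjoint i j : i != j -> tail_core i `&` tail_core j = set0.
Proof.
move=> ij; apply/seteqP; split=> // x [[n _ xn] [k _ xk]].
have : (Tail i `&` Tail j) (bshift (n + k)%N%:Z x).
  by split; [exact: xn|rewrite addnC; exact: xk].
by rewrite (tail_index_disjoint t_pos t_prol t_len ij).
Qed.

Lemma prob_tail_core_self i : prob (mu i) (tail_core i) = 1.
Proof.
have mT := measurable_tail_index t_pos t_prol t_len i.
have mb n : measurable (@bshift (letter d) n%:Z @^-1` Tail i : set borel).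
  exact: measurable_bshift.
pose I n := [set x | forall k, (k < n)%N -> (@bshift (letter d) k%:Z @^-1` Tail i) x].
have I0 : I 0%N = setT by apply/seteqP; split.
have IS n : I n.+1 = I n `&` (@bshift (letter d) n%:Z @^-1` Tail i).
  apply/seteqP; split=> [x xI|x [xI xn] k].
    by split=> [k kn|]; apply: xI => //; exact: leqW.
  by rewrite ltnS leq_eqVlt => /orP[/eqP ->|/xI].
have mI n : measurable (I n : set borel).
  elim: n => [|n IHn]; first by rewrite I0.
  by rewrite IS; exact: measurableI.
have prI n : prob (mu i) (I n) = 1.
  elim: n => [|n IHn]; first by rewrite I0 probT.
  by rewrite IS probI_full // (invariant_bshift _ (mu_inv i)) // prob_tail_index_self.
have cI := @prob_nonincreasing_cvg _ _ _ (mu i) _ mI (fun n x xn k kn => xn k (leqW kn)).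
apply/eqP; rewrite eq_le prob_le1 /=; last exact: measurable_tail_core.
apply: (@le_trans _ _ (prob (mu i) (\bigcap_n I n))).
  suff -> : prob (mu i) (\bigcap_n I n) = 1 by [].
  apply: (@cvg_unique _ _ (prob (mu i) (I n) @[n --> \oo])) => //.
  have -> : (fun n => prob (mu i) (I n)) = (fun=> 1) by apply/funext.
  exact: cvg_cst.
apply: le_prob; [exact: bigcapT_measurable|exact: measurable_tail_core|].
by move=> x xI; exists 0%N => // k _; exact: (xI k.+1).
Qed.

(** The measure [mu j] gives [tail_core i] mass 1 if [j = i] and 0 otherwise, so by decomposition
    the core has the mass of [Tail i] under [m]. Being strictly invariant it has mass 0 or 1, and
    not every [Tail i] is null. *)
Lemma glued_ergodic_unique m : ergodic_measure (X 0) m -> exists i, same_measure m (mu i).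
Proof.
move=> [mX mE].
have core i : prob m (tail_core i) = prob m (Tail i).
  rewrite (prob_decomposition mX (measurable_tail_core i)) (bigD1 i) //=.
  rewrite prob_tail_core_self mulr1 big1 ?addr0 // => j ji.
  suff -> : prob (mu j) (tail_core i) = 0 by rewrite mulr0.
  apply/eqP; rewrite eq_le prob_ge0 andbT.
  apply: (@le_trans _ _ (prob (mu j) (~` tail_core j))).
    apply: le_prob; [exact: measurable_tail_core| |].
      by apply: measurableC; exact: measurable_tail_core.
    move=> x xi xj; have : (tail_core j `&` tail_core i) x by [].
    by rewrite tail_core_disjoint.
  by rewrite probC ?prob_tail_core_self ?subrr //; exact: measurable_tail_core.
have [i mi] : exists i, prob m (Tail i) != 0.
  apply: contrapT => /forallNP m0.
  have := sum_prob_tail_index t_pos t_prol t_len mX.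
  rewrite big1 => [/esym/eqP|i _]; first by rewrite oner_eq0.
  by apply/eqP/negPn/negP; exact: m0.
exists i; apply: same_measure_tail => //.
have [E|E] := mE _ (measurable_tail_core i) (tail_core_invariant i).
  by move: mi; rewrite -core /prob E eqxx.
by rewrite -core /prob E.
Qed.

End Decomposition.
End GluedErgodicity.

(** * Unique ergodicity of the substitution subshifts *)

Section UniformFrequency.
Context {A : pointedType} {R : realType}.

(* Integrating the Birkhoff sums over the finite partition into itineraries. *)
Lemma invariant_uniform_freq (X : set (biseq A)) (m : probability (borel_biseq A) R)
    (E : set (biseq A)) (M : nat) (f e : R) :
  closed X -> invariant_measure X m -> measurable (E : set (borel_biseq A)) ->
  (0 < M)%N -> (forall x, X x -> `|freq x M E - f| <= e) -> `|prob m E - f| <= e.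
Proof.
move=> cX mX mE M0 freqE; have MR : 0 < M%:R :> R by rewrite ltr0n.
have [X1 _] := (invariant_measureP m cX).1 mX.
pose SE (k : nat) : set (biseq A) := @bshift A k%:Z @^-1` E.
have mSE k : measurable (SE k : set (borel_biseq A)) by exact: measurable_bshift.
pose B (v : {ffun 'I_M -> bool}) : set (biseq A) :=
  [set x | forall k : 'I_M, `[< SE k x >] = v k].
have mB v : measurable (B v : set (borel_biseq A)).
  rewrite (_ : B v = \bigcap_(k in [set: 'I_M]) (if v k then SE k else ~` SE k)).
    apply: fin_bigcap_measurable; first exact: finite_finset.
    by move=> k _; case: (v k); [exact: mSE|apply: measurableC; exact: mSE].
  apply/seteqP; split=> x xB k.
    by move=> _; have := xB k; case: (v k) => /asboolP.
  by have := xB k I; case: (v k) => H; [exact: asboolT|exact: asboolF].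
have part F : measurable (F : set (borel_biseq A)) ->
    prob m F = \sum_v prob m (F `&` B v).
  move=> mF; apply: (@prob_partition _ (borel_biseq A) R m _ B X) => //.
  - move=> v w vw; apply/seteqP; split=> // x [xv xw]; case/eqP: vw.
    by apply/ffunP => k; rewrite -xv -xw.
  - exact: measurable_closed_biseq.
  - by move=> x _; exists [ffun k : 'I_M => `[< SE k x >]] => k; rewrite ffunE.
have sumE : M%:R * prob m E =
    \sum_(v : {ffun 'I_M -> bool}) (\sum_(k < M) (v k)%:R) * prob m (B v).
  transitivity (\sum_(k < M) prob m (SE k)).
    under eq_bigr do rewrite (invariant_bshift _ mX) //.
    by rewrite sumr_const card_ord mulr_natl.
  under eq_bigr do rewrite (part _ (mSE _)).
  rewrite exchange_big; apply: eq_bigr => v _ /=; rewrite mulr_suml.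
  apply: eq_bigr => k _; have [vk|vk] := boolP (v k).
    rewrite mul1r; congr (prob m _); apply/setIidPr => x /(_ k).
    by rewrite vk => /asboolP.
  rewrite mul0r (_ : _ `&` _ = set0) ?prob0 //; apply/seteqP; split=> // x [xk /(_ k)].
  by rewrite asboolT // => E1; rewrite -E1 in vk.
have sumf : M%:R * f = \sum_v (M%:R * f) * prob m (B v).
  rewrite -mulr_sumr; under eq_bigr do rewrite -[B _]setTI.
  by rewrite -part // probT mulr1.
rewrite -(ler_pM2l MR) -{1}[M%:R](ger0_norm (ler0n R M)) -normrM mulrBr sumE sumf -sumrB.
apply: (le_trans (ler_norm_sum _ _ _)).
apply: (@le_trans _ _ (\sum_v (M%:R * e) * prob m (B v))); last first.
  rewrite -mulr_sumr; under eq_bigr do rewrite -[B _]setTI.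
  by rewrite -part // probT mulr1.
apply: ler_sum => v _; rewrite -mulrBl normrM [`|prob m _|]ger0_norm ?prob_ge0 //.
(* An itinerary realized by a point of [X] obeys the frequency bound; the cell of any other lies
   outside [X] and is null. *)
have [[x [Xx Bx]]|BX] := pselect (exists x, X x /\ B v x).
  rewrite ler_wpM2r ?prob_ge0 //.
  have -> : \sum_(k < M) (v k)%:R = M%:R * freq x M E :> R.
    rewrite /freq mulrCA mulfV ?gt_eqF // mulr1 /occ big_mkord.
    by apply: eq_bigr => k _; rewrite -Bx.
  by rewrite -mulrBr normrM ger0_norm ?ler0n // ler_wpM2l ?ler0n // freqE.
suff -> : prob m (B v) = 0 by rewrite !mulr0.
apply/eqP; rewrite eq_le prob_ge0 andbT.
have mXX : measurable (X : set (borel_biseq A)) by exact: measurable_closed_biseq.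
apply: (@le_trans _ _ (prob m (~` X))); last by rewrite probC // X1 subrr.
apply: le_prob => //; first exact: measurableC.
by move=> x Bx Xx; apply: BX; exists x.
Qed.

Lemma occ_bshift_dist (x : biseq A) (k h : nat) E :
  `|occ (bshift k%:Z x) h E - occ x h E| <= k%:R :> R.
Proof.
have e1 : occ x (h + k) E = occ x h E + occ (bshift h%:Z x) k E :> R by exact: occD.
have e2 : occ x (h + k) E = occ x k E + occ (bshift k%:Z x) h E :> R.
  by rewrite addnC occD.
have := occ_ge0 (R := R) (bshift h%:Z x) k E; have := occ_leh (R := R) (bshift h%:Z x) k E.
have := occ_ge0 (R := R) x k E; have := occ_leh (R := R) x k E.
rewrite ler_norml; lra.
Qed.

End UniformFrequency.

Section ConstantSequence.
Variables (tau : morph bool) (l : nat).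
Hypothesis tau_pos : positive tau.
Hypothesis tau_prol : prolongable tau.
Hypothesis tau_len : constant_length l tau.
Variable R : realType.

Local Notation s := (fun _ : nat => tau).
Local Notation L := (fun _ : nat => l).

Let sL (n : nat) : headed l tau. Proof. exact: prolongable_headed. Qed.
Let l3 : (3 <= l)%N. Proof. exact: positive_prolongable_length tau_pos tau_prol tau_len. Qed.

Let interior (n : nat) c : exists c' p, (0 < p < l)%N /\ nth point (tau c') p = c.
Proof.
by have [p pl pE] := positive_interior tau_pos tau_prol tau_len c; exists (~~ c), p; split; [lia|].
Qed.

Let finB : finite_set [set: bool]. Proof. exact: finite_finset. Qed.

Lemma hlen_const n m : hlen L n (n + m) = (l ^ m)%N.
Proof. by rewrite /hlen prod_nat_const_nat addKn. Qed.

(** In the glued sequence one step contains a high power of [tau_i]; here contraction takes [m]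
    steps above a cut at level [n]. For convergence [n] is chosen first, to make the boundary term
    small, and then [m]. *)
Lemma constant_letter_freq_dist n m E r : radius_local r E ->
  `|letter_freq s L 0 (n + m) E true - letter_freq s L 0 (n + m) E false|
  <= ((l - 2)%:R / l%:R) ^+ m + 2 * ((r + r)%:R / (hlen L 0 n)%:R) :> R.
Proof.
move=> lE; pose F e : R := letter_freq s L 0 n E e.
have appr e : `|letter_freq s L 0 (n + m) E e -
   (\sum_(0 <= j < l ^ m) F (nth point (mpow tau m e) j)) / (l ^ m)%:R|
   <= (r + r)%:R / (hlen L 0 n)%:R.
  have := letter_freq_blocks sL e (leq0n n) (leq_addr m n) lE (R := R).
  rewrite srange_const hlen_const; congr (`| _ - _ / _ | <= _).
  apply: eq_big_nat => j /andP[_ jl]; rewrite -[j%:Z]add0r -(mul0r (l ^ m)%:Z).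
  by rewrite (bimorphE_lt _ _ (headed_mpow tau_pos tau_prol tau_len m)).
have F01 c : 0 <= F c <= 1 by rewrite freq_ge0 freq_le1.
have := mpow_average_dist tau_pos tau_prol tau_len m F01.
have := appr true; have := appr false.
set a := letter_freq _ _ _ _ _ _; set b := letter_freq _ _ _ _ _ _.
set a' := _ / _; set b' := _ / _; set u := _ ^+ _.
by rewrite !ler_norml => /andP[? ?] /andP[? ?] /andP[? ?]; apply/andP; split; lra.
Qed.

Lemma cvg_constant_letter_freq_dist E : local_set E ->
  `|letter_freq s L 0 N E true - letter_freq s L 0 N E false| @[N --> \oo] --> (0 : R).
Proof.
move=> [r lE]; apply/cvgr0Pnorm_lt => e e0.
have e4 : 0 < e / 2 by rewrite divr_gt0.
have c1 : 2 * ((r + r)%:R / (hlen L 0 n)%:R) @[n --> \oo] --> (0 : R).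
  apply: cvgr0Ml.
  exact: (cvg_inv_hlen interior).
have /cvgr0Pnorm_lt /(_ _ e4) [n _ nE] := c1.
have c2 : ((l - 2)%:R / l%:R : R) ^+ m @[m --> \oo] --> 0.
  apply: cvg_expr; rewrite ger0_norm ?divr_ge0 // ltr_pdivrMr ?ltr0n; last by lia.
  by rewrite mul1r ltr_nat; lia.
have /cvgr0Pnorm_lt /(_ _ e4) [m _ mE] := c2.
exists (n + m)%N => // N /= nmN; rewrite normr_id.
have NE : N = (n + (N - n))%N by lia.
rewrite NE; apply: (le_lt_trans (constant_letter_freq_dist _ _ lE)).
have mN : (m <= N - n)%N by lia.
have := nE n (leqnn n); have := mE (N - n)%N mN.
set a := _ ^+ _; set b := 2 * _ => am bn.
have := ler_norm a; have := ler_norm b; lra.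
Qed.

Lemma constant_uniquely_ergodic :
  exists nu : probability (borel_biseq bool) R,
  the_only_measure (invariant_measure (substitution_subshift tau)) nu /\
  forall E c, local_set E -> letter_freq s L 0 N E c @[N --> \oo] --> prob nu E.
Proof.
have [||||nu [nuX nuE _]] := @class_measure _ R s L sL finB interior setT (fun=> 0).
- by exists true.
- move=> E lE.
  exists (fun N => `|letter_freq s L 0 N E true - letter_freq s L 0 N E false|).
    exact: cvg_constant_letter_freq_dist.
  by move=> N [] [] _ _; rewrite ?subrr ?normr0 // distrC.
- exact: cvg_cst.
- move=> N N' c NN' _; rewrite subr0 /letter_freq /freq.
  rewrite (_ : [set y : biseq bool | _] = setT); last by apply/seteqP; split.
  by rewrite occT divff // pnatr_eq0 -lt0n (hlen_gt0 sL).
rewrite -substitution_subshiftE in nuX.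
exists nu; split; last by move=> E c lE; exact: nuE.
split=> // m mX; apply: same_measure_local => E lE; have [r lr] := lE.
have mE : measurable (E : set (borel_biseq bool)) by exact: measurable_local_biseq.
rewrite !probE //; congr EFin.
rewrite substitution_subshiftE in mX.
pose dlt N : R := `|letter_freq s L 0 N E true - prob nu E| +
  `|letter_freq s L 0 N E false - prob nu E|.
have bound N : `|prob m E - prob nu E| <=
    N.+1%:R^-1 + (r + r)%:R / (hlen L 0 N)%:R + dlt N.
  have hN := hlen_gt0 sL 0 N; have hR : 0 < (hlen L 0 N)%:R :> R by rewrite ltr0n.
  (* Over [N + 1] blocks, starting at an offset [k] less than one block instead of at a cut costs at
     most [1 / (N + 1)], which also tends to 0. *)
  apply: (@invariant_uniform_freq _ _ (ssubshift s 0) m E (N.+1 * hlen L 0 N)) => //.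
  - exact: closed_ssubshift.
  - by rewrite muln_gt0.
  move=> x /(desubstitution sL (leq0n N)) [y [k [_ kh ->]]].
  have := freq_bimorph_blocks (R := R) y (headed_srange sL 0 N) lr (ltn0Sn N).
  set fy := freq _ _ _; set avg := _ / N.+1%:R => H1.
  have H2 : `|avg - prob nu E| <= dlt N.
    have -> : avg - prob nu E = (\sum_(0 <= j < N.+1)
        (letter_freq s L 0 N E (y j%:Z) - prob nu E)) / N.+1%:R.
      rewrite sumrB sumr_const_nat subn0 mulrBl.
      by rewrite -[prob nu E *+ N.+1]mulr_natr mulfK ?pnatr_eq0.
    rewrite normrM [`|_^-1|]ger0_norm ?invr_ge0 // ler_pdivrMr ?ltr0n //.
    apply: (le_trans (ler_norm_sum _ _ _)).
    rewrite mulr_natr -[N.+1 in leRHS]subn0 -sumr_const_nat; apply: ler_sum => j _.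
    by rewrite /dlt; case: (y j%:Z); rewrite ?lerDl ?lerDr.
  have H3 : `|freq (bshift k%:Z (bimorph (srange s 0 N) y)) (N.+1 * hlen L 0 N) E - fy|
      <= N.+1%:R^-1.
    rewrite /fy /freq -mulrBl normrM [`|_^-1|]ger0_norm ?invr_ge0 //.
    rewrite ler_pdivrMr ?ltr0n ?muln_gt0 // natrM mulKf ?pnatr_eq0 //.
    by apply: (le_trans (occ_bshift_dist _ _ _ _)); rewrite ler_nat ltnW.
  clearbody fy avg; move: H1 H2 H3.
  move: (freq _ _ _) (_ / _) (dlt N) (N.+1%:R^-1) => z u v w.
  rewrite !ler_norml => /andP[? ?] /andP[? ?] /andP[? ?].
  by apply/andP; split; lra.
have dlt0 : dlt N @[N --> \oo] --> 0.
  rewrite -[0]addr0 -{1 2}(@normr0 _ R); apply: cvgD; apply: cvg_norm; apply/subr_cvg0;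
    exact: nuE.
have c : (N.+1%:R^-1 + (r + r)%:R / (hlen L 0 N)%:R + dlt N) @[N --> \oo] --> (0 + 0 + 0 : R).
  apply: cvgD => //; apply: cvgD; first exact: cvg_harmonic.
  exact: (cvg_inv_hlen interior).
rewrite !addr0 in c; apply/eqP; rewrite -subr_eq0 -normr_le0.
apply: (closed_cvg (fun a => `|prob m E - prob nu E| <= a)) c; first exact: closed_ge.
exact: nearW.
Qed.

End ConstantSequence.

(** * Minimality and convergence of the induced measures *)

Section GluedMinimality.
Variables (d : nat) (t : 'Z_d -> morph bool) (l : nat).
Hypothesis t_pos : forall i, positive (t i).
Hypothesis t_prol : forall i, prolongable (t i).
Hypothesis t_len : forall i, constant_length l (t i).

Local Notation s := (glued_sequence t).
Local Notation L := (fun n => (l ^ n.+1)%N).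
Local Notation X n := (ssubshift s n).

Let sL n : headed (L n) (s n). Proof. exact: glued_headed. Qed.
Let L3 n : (3 <= L n)%N.
Proof.
have l3 := positive_prolongable_length (t_pos 0) (t_prol 0) (t_len 0).
by rewrite expnS -[3%N]muln1 leq_mul // expn_gt0; lia.
Qed.

(** The last letter of an image raises the index by one, so each further level reaches one more
    index by following last letters; following first letters keeps the index. The lowest level is
    reserved for passing from [e] to [e']. *)
Lemma glued_letter_occurs k N i e j e' : (j <= k)%N ->
  exists2 p, (p < hlen L N (N + k.+1))%N &
    nth point (srange s N (N + k.+1) (i, e)) p = (i + j%:R, e').
Proof.
elim: k i e j => [|k IHk] i e j jk.
  move: jk; rewrite leqn0 => /eqP ->; rewrite addr0 addn1 srange1 hlen1.
  have [->|ee'] := eqVneq e' e.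
    exists 0%N; first by have := L3 N; lia.
    by have [_ _ ->] := sL N.
  have [p pl pE] := mpow_interior (t_pos i) (t_prol i) (@t_len i) N e'.
  exists p; first by lia.
  have -> : e = ~~ e' by case: (e) (e') ee' => [] [].
  by rewrite (glued_nth t_pos t_prol t_len) ?pE //; lia.
have hg := headed_srange sL N (N + k.+1); have [h0 _ _] := hg.
have HS : hlen L N (N + k.+2) = (L (N + k.+1) * hlen L N (N + k.+1))%N.
  by rewrite addnS hlenS // leq_addr.
have sz c : size (s (N + k.+1)%N c) = L (N + k.+1)%N by have [_ ->] := sL (N + k.+1)%N.
have L3n := L3 (N + k.+1).
have E q p : (q < L (N + k.+1))%N -> (p < hlen L N (N + k.+1))%N ->
    (q * hlen L N (N + k.+1) + p < hlen L N (N + k.+2))%N /\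
    nth point (srange s N (N + k.+2) (i, e)) (q * hlen L N (N + k.+1) + p) =
    nth point (srange s N (N + k.+1) (nth point (s (N + k.+1)%N (i, e)) q)) p.
  move=> qL pH; have lt : (q * hlen L N (N + k.+1) + p < L (N + k.+1) * hlen L N (N + k.+1))%N.
    by nia.
  split; first by rewrite HS.
  rewrite addnS srangeS ?leq_addr // (nth_mext hg) ?sz //.
  by rewrite divnMDl // divn_small // addn0 modnMDl modn_small.
have [jk'|kj] := leqP j k.
  have [p ph pE] := IHk i e j jk'; have [|E1 E2] := E 0%N p _ ph; first by lia.
  exists p => //; rewrite E2 -pE; congr (nth _ (srange s _ _ _) _).
  by have [_ _ ->] := sL (N + k.+1)%N.
have -> : j = k.+1 by lia.
have [p ph pE] := IHk (i + 1) e k (leqnn k).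
have [|E1 E2] := E (L (N + k.+1)).-1 p _ ph; first by lia.
exists ((L (N + k.+1)%N).-1 * hlen L N (N + k.+1) + p)%N => //.
by rewrite E2 (glued_last t_pos t_prol t_len) pE -addrA -natr1 [1 + _]addrC.
Qed.

(** [(Zp_trunc d).+2] is the number of elements of ['Z_d], so that many levels reach every index, at
    a distance from the level [N] that does not depend on [N]. *)
Lemma glued_primitive N (c c' : letter d) :
  exists2 p, (p < hlen L N (N + (Zp_trunc d).+2))%N &
    nth point (srange s N (N + (Zp_trunc d).+2) c) p = c'.
Proof.
case: c c' => i e [i' e'].
have [|p ph pE] := @glued_letter_occurs (Zp_trunc d).+1 N i e (i' - i)%R e'.
  by rewrite -ltnS ltn_ord.
by exists p => //; rewrite pE natr_Zp addrC subrK.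
Qed.

Lemma glued_minimal : minimal_subshift (X 0).
Proof.
split.
  have [x Xx _] := ssubshift_letter sL (@finite_letter d)
    (glued_interior t_pos t_prol t_len) 0 point.
  by exists x.
move=> Y cY YX YS; have [->|/set0P [y Yy]] := eqVneq Y set0; first by left.
right; apply/seteqP; split=> // x Xx.
have Yk (k : nat) z : Y z -> Y (bshift k%:Z z).
  elim: k z => [|k IHk] z Yz; first by rewrite bshift0.
  have := IHk _ (YS _ Yz); rewrite bshift1 bshiftD.
  by congr Y; apply: bshift_eq; lia.
have /closed_biseqP := cY; apply => r.
have /(slanguage_windowP sL) [c [N [p [N0 ph xE]]]] := Xx (- r%:Z) (r + r + 1)%N.
pose N' := (N + (Zp_trunc d).+2)%N.
have NN' : (N <= N')%N by exact: leq_addr.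
have [z [k [Xz kh yE]]] := desubstitution sL (leq0n N') (YX _ Yy).
have [q qH qE] := glued_primitive N (z 1) c.
have hN' : hlen L 0 N' = (hlen L N N' * hlen L 0 N)%N by rewrite (hlen_cat _ (leq0n N) NN').
(* Goes to the start of the block of [z 1], then over [q] blocks of level [N], then to position [p]
   of the block of [c], then to the centre of the window. Block 1 is used instead of block 0 because
   [Y] is only forward invariant. *)
exists (bshift (hlen L 0 N' - k + q * hlen L 0 N + p + r)%N%:Z y); first exact: Yk.
move=> j jr; rewrite yE bshiftD /bshift.
have -> : j + ((hlen L 0 N' - k + q * hlen L 0 N + p + r)%N%:Z + k%:Z) =
    (hlen L N N' + q)%N%:Z * (hlen L 0 N)%:Z + (p + `|(j + r%:Z)%R|)%N%:Z.
  by rewrite -PoszM mulnDl -hN'; lia.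
rewrite (bimorph_srange_cat sL _ (leq0n N) NN').
have -> : x j = x (- r%:Z + `|(j + r%:Z)%R|%N%:Z) by congr x; lia.
rewrite xE; last by lia.
rewrite (bimorphE_lt _ _ (headed_srange sL 0 N)); last by lia.
have -> : (hlen L N N' + q)%N%:Z = 1 * (hlen L N N')%:Z + q%:Z by lia.
by rewrite (bimorphE_lt _ _ (headed_srange sL N N')) // qE.
Qed.

End GluedMinimality.

Lemma radius_local_cylinder (A : Type) (w : seq A) : radius_local (size w) (cylinder w).
Proof.
move=> x y xy; rewrite /cylinder /= => wE; rewrite -[RHS]wE.
by apply/eq_in_map => k; rewrite mem_iota => kw; rewrite xy //; lia.
Qed.

Section InducedLimit.
Variables (d : nat) (t : 'Z_d -> morph bool) (l : nat).
Hypothesis t_pos : forall i, positive (t i).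
Hypothesis t_prol : forall i, prolongable (t i).
Hypothesis t_len : forall i, constant_length l (t i).
Variable R : realType.

Local Notation s := (glued_sequence t).
Local Notation L := (fun n => (l ^ n.+1)%N).
Local Notation X n := (ssubshift s n).
Local Notation borel := (borel_biseq (letter d)).

Let sL n : headed (L n) (s n). Proof. exact: glued_headed. Qed.
Let LR n : 0 < (l ^ n.+1)%:R :> R.
Proof. by rewrite ltr0n; have [] := sL n. Qed.

Lemma induced_measureP (mu m : probability borel R) n :
  induced_measure s mu n m <-> invariant_measure (X n) m /\
  forall E : set borel, measurable E ->
    prob mu E = (hlen L 0 n)%:R^-1 * \sum_(0 <= k < hlen L 0 n)
      prob m ((fun y => bshift k%:Z (bimorph (srange s 0 n) y)) @^-1` E).
Proof.
have hg := headed_srange sL 0 n.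
have mpre (E : set borel) k : measurable E ->
    measurable ((fun y => bshift k%:Z (bimorph (srange s 0 n) y)) @^-1` E : set borel).
  apply: measurable_preimage_biseq => x.
  by apply: continuous_comp; [exact: bimorph_continuous hg x|exact: bshift_continuous].
have pushE (E : set borel) k : measurable E ->
    pushforward m (iter k (@bishift (letter d)) \o bimorph (srange s 0 n) : borel -> borel) E =
    (prob m ((fun y => bshift k%:Z (bimorph (srange s 0 n) y)) @^-1` E))%:E.
  move=> mE; rewrite -probE; last exact: mpre.
  by congr (m (_ @^-1` E)); apply/funext => y; rewrite /= iter_bishift.
rewrite /induced_measure (headed_mlength hg); split=> -[mX mE]; split=> // E mE'.
  apply: EFin_inj; rewrite -probE // mE //.
  under eq_bigr do rewrite pushE //.
  by rewrite sumEFin.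
rewrite probE // mE //.
under [in RHS]eq_bigr do rewrite pushE //.
by rewrite sumEFin.
Qed.

(** Carries the lower bound on index towers over to the induced measures: a tower has [h] levels of
    the mass of its base. *)
Lemma prob_induced_index (mu m : probability borel R) n i :
  invariant_measure (X 0) mu ->
  (forall E : set borel, measurable E -> prob m E = (hlen L 0 n)%:R *
    prob mu (level (srange s 0 n) (X n) 0 `&` @sample (letter d) (hlen L 0 n) @^-1` E)) ->
  prob m (index_cylinder i) = prob mu (index_tower t l n i).
Proof.
move=> muX mE; have hg := headed_srange sL 0 n.
have rg : recognizable (hlen L 0 n) (srange s 0 n).
  by apply: recognizable_srange => // k; exact: glued_recognizable.
rewrite mE; last by apply: measurable_closed_biseq; exact: closed_index_cylinder.
rewrite /index_tower (prob_tower hg rg (@finite_letter d) muX); last first.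
  by apply: closedI; [exact: closed_ssubshift|exact: closed_index_cylinder].
congr (_ * prob mu _); apply/seteqP; split=> x.
  by move=> [[y Xy <-]]; rewrite /= bshift0 (bimorphK hg) => yi; exists y; rewrite ?bshift0.
move=> [y [Xy yi] <-]; split; first by exists y.
by rewrite /= bshift0 (bimorphK hg).
Qed.

(** Only the last letter of such an image can have index [i]. *)
Lemma glued_other_index_freq n i c : c.1 != i ->
  letter_freq s L n n.+1 (index_cylinder i) c <= (l ^ n.+1)%:R^-1 :> R.
Proof.
move=> ci; rewrite /letter_freq srange1 hlen1 /freq ler_pdivrMr // mulVf ?gt_eqF //.
have : `|\sum_(0 <= k < l ^ n.+1) `[< @index_cylinder d i
    (bshift k%:Z (bimorph (s n) (fun=> c))) >]%:R - \sum_(0 <= k < l ^ n.+1) 0|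
    <= (0 + 1)%N%:R * 1 :> R; last first.
  rewrite [Z in _ - Z]big1 // subr0 mulr1 ger0_norm //.
  by apply: sumr_ge0 => k _; exact: ler0n.
apply: sum_dist => // k => [_|_ kL].
  by rewrite subr0 ger0_norm //; case: asboolP.
rewrite asboolF // /index_cylinder /index_class /= /bshift -(mul0r (l ^ n.+1)%:Z).
by rewrite (glued_index t_pos t_prol t_len) => [/eqP|]; [exact/negP|lia].
Qed.

(** The two words agree up to [kappa] on the last letter. A start [k] with [k + size w + 1] less
    than the length sees neither that letter nor the outside. *)
Lemma glued_cylinder_freq_dist n i e (w : seq bool) :
  `|letter_freq s L n n.+1 (cylinder (in_alphabet i w)) (i, e) -
    letter_freq (fun=> t i) (fun=> l) 0 n.+1 (cylinder w) e|
  <= (size w).+1%:R / (l ^ n.+1)%:R :> R.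
Proof.
rewrite /letter_freq srange1 hlen1 (srange_const _ 0 n.+1) (hlen_const _ 0 n.+1).
rewrite /freq -mulrBl normrM [`|_^-1|]ger0_norm ?invr_ge0 ?(ltW (LR n)) //.
rewrite ler_wpM2r ?invr_ge0 ?(ltW (LR n)) // -[leRHS]mulr1.
apply: (@sum_dist _ 0) => // k => [_|_ kL].
  by case: asboolP; case: asboolP;
    rewrite ?subrr ?subr0 ?sub0r ?normrN ?normr0 ?normr1.
congr (nat_of_bool _)%:R; apply: asbool_equiv_eq.
set x := bshift _ _; set y := bshift _ _.
have xy : window x 0 (size w) = in_alphabet i (window y 0 (size w)).
  rewrite /window /in_alphabet -map_comp; apply/eq_in_map => j; rewrite mem_iota => jw /=.
  have -> : x (0 + j%:Z) = bimorph (s n) (fun=> (i, e)) (0 * (l ^ n.+1)%:Z + (j + k)%N%:Z).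
    by rewrite /x /bshift; congr bimorph; lia.
  have -> : y (0 + j%:Z) = bimorph (mpow (t i) n.+1) (fun=> e) (0 * (l ^ n.+1)%:Z + (j + k)%N%:Z).
    by rewrite /y /bshift; congr bimorph; lia.
  rewrite (bimorphE_lt _ _ (sL n)); last by lia.
  rewrite (bimorphE_lt _ _ (headed_mpow (t_pos i) (t_prol i) (@t_len i) n.+1)); last by lia.
  by rewrite (glued_nth t_pos t_prol t_len) //; lia.
rewrite /cylinder /= size_map xy; split=> [|->] //.
by apply: inj_map => a b [].
Qed.

(** The three terms: windows across the cuts, the deviation of the two block frequencies of index
    [i] from [f], and the mass [Q] of the towers over other indices. *)
Lemma level_cylinder_dist n i (m : probability borel R) (w : seq bool) (f : R) :
  invariant_measure (X n) m -> 1 - l%:R ^- n <= prob m (index_cylinder i) -> 0 <= f <= 1 ->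
  `|prob m (cylinder (in_alphabet i w)) - f| <=
    (size w + size w)%:R / (l ^ n.+1)%:R +
    \sum_e `|letter_freq s L n n.+1 (cylinder (in_alphabet i w)) (i, e) - f| +
    (l%:R ^- n + (l ^ n.+1)%:R^-1).
Proof.
move=> mX mi /andP[f0 f1].
pose P c := prob m (letter_tower t l n n.+1 c).
have P0 c : 0 <= P c by exact: prob_ge0.
have P1 c : P c <= 1.
  by apply: prob_le1; exact: (measurable_letter_tower t_pos t_prol t_len).
have sP : \sum_c P c = 1 := sum_prob_letter_tower t_pos t_prol t_len (leqnSn n) mX.
pose Q := \sum_(c | c.1 != i) P c.
have sQ : \sum_(c | c.1 == i) P c = 1 - Q.
  by have := sP; rewrite (bigID (fun c : letter d => c.1 == i)) /= -/Q => <-; rewrite addrK.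
(* The index cylinder has radius 0, so the tower approximation is exact. Towers of index [i]
   contribute at most [1 - Q] to it and all others together at most [l^-(n+1)], against the assumed
   lower bound [1 - l^-n]. *)
have Qle : Q <= l%:R ^- n + (l ^ n.+1)%:R^-1.
  have := prob_letter_freq_approx t_pos t_prol t_len (leqnSn n) mX (@radius_local_index d i).
  rewrite addn0 mul0r normr_le0 subr_eq0 => /eqP E.
  have : prob m (index_cylinder i) <= (1 - Q) + (l ^ n.+1)%:R^-1.
    rewrite E (bigID (fun c : letter d => c.1 == i)) /= -sQ; apply: lerD.
      by apply: ler_sum => c _; apply: ler_piMl; [exact: P0|exact: freq_le1].
    apply: (@le_trans _ _ (\sum_(c | c.1 != i) (l ^ n.+1)%:R^-1 * P c)).
      by apply: ler_sum => c ci; apply: ler_wpM2r; [exact: P0|exact: glued_other_index_freq].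
    rewrite -mulr_sumr ler_piMr ?invr_ge0 ?(ltW (LR n)) // -/Q.
    have : 0 <= \sum_(c | c.1 == i) P c by apply: sumr_ge0.
    by rewrite sQ subr_ge0.
  move: mi; lra.
have := prob_letter_freq_approx t_pos t_prol t_len (leqnSn n) mX
  (@radius_local_cylinder _ (in_alphabet i w)).
rewrite size_map hlen1; set u := \sum_c _ => H1.
suff H2 : `|u - f| <= \sum_e `|letter_freq s L n n.+1 (cylinder (in_alphabet i w)) (i, e) - f| + Q.
  have := ler_normD (prob m (cylinder (in_alphabet i w)) - u) (u - f).
  rewrite addrA subrK => H3; apply: (le_trans H3).
  by rewrite -addrA lerD // (le_trans H2) // lerD2l.
have -> : u - f = \sum_c (letter_freq s L n n.+1 (cylinder (in_alphabet i w)) c - f) * P c.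
  under eq_bigr do rewrite mulrBl.
  by rewrite sumrB -mulr_sumr sP mulr1.
apply: (le_trans (ler_norm_sum _ _ _)).
rewrite (bigID (fun c : letter d => c.1 == i)) /=; apply: lerD.
  rewrite (reindex_onto (fun e : bool => (i, e)) (fun c : letter d => c.2)) /=; last first.
    by move=> [j e] /= /eqP ->.
  rewrite big_mkcond; apply: ler_sum => e _; rewrite !eqxx /= normrM.
  by rewrite [`|P _|]ger0_norm // ler_piMr.
apply: ler_sum => c _; rewrite normrM [`|P _|]ger0_norm // ler_piMl //.
have := freq_ge0 (R := R) (bimorph (srange s n n.+1) (fun=> c)) (hlen L n n.+1)
  (cylinder (in_alphabet i w)).
have := freq_le1 (R := R) (bimorph (srange s n n.+1) (fun=> c)) (hlen L n n.+1)
  (cylinder (in_alphabet i w)).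
by rewrite /letter_freq ler_norml => ? ?; lra.
Qed.

Lemma cvg_induced_cylinder i (m : nat -> probability borel R)
    (nu : probability (borel_biseq bool) R) (w : seq bool) :
  (forall n, invariant_measure (X n) (m n)) ->
  (forall n, 1 - l%:R ^- n <= prob (m n) (index_cylinder i)) ->
  (forall E c, local_set E ->
    letter_freq (fun=> t i) (fun=> l) 0 N E c @[N --> \oo] --> prob nu E) ->
  prob (m n) (cylinder (in_alphabet i w)) @[n --> \oo] --> prob nu (cylinder w).
Proof.
move=> mX mi nuE.
have lw : local_set (cylinder w) by exists (size w); exact: radius_local_cylinder.
have mw : measurable (cylinder w : set (borel_biseq bool)) by exact: measurable_local_biseq.
have cV := cvg_exprVn t_pos t_prol t_len (R := R).
have cLV (a : R) : a / (l ^ n.+1)%:R @[n --> \oo] --> 0.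
  apply: cvgr0Ml.
  have -> : (fun n => (l ^ n.+1)%:R^-1) = (fun n => (l%:R : R) ^- n.+1).
    by apply/funext => n; rewrite natrX.
  by rewrite (cvg_shiftS (fun n => (l%:R : R) ^- n)).
apply/subr_cvg0; apply: cvgr0_le => [n|].
  by apply: (level_cylinder_dist _ (mX n) (mi n)); rewrite prob_ge0 prob_le1.
apply: cvgr0D; last first.
  apply: cvgr0D => //.
  by have := cLV 1; under eq_fun do rewrite mul1r.
apply: cvgr0D; first exact: cLV.
rewrite [Z in _ --> Z](_ : _ = \sum_(e : bool) (0 : R)); last by rewrite big1.
apply: cvg_big => [|e _]; first exact: add_continuous.
apply: cvgr0_norm.
apply: (@cvg_sub0 _ _ _ _ _ _
  (fun n => letter_freq (fun=> t i) (fun=> l) 0 n.+1 (cylinder w) e)); last first.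
  rewrite (cvg_shiftS (fun n => letter_freq (fun=> t i) (fun=> l) 0 n (cylinder w) e)).
  exact: nuE.
by apply: cvgr0_le (cLV (size w).+1%:R) => n; exact: glued_cylinder_freq_dist.
Qed.

End InducedLimit.

Theorem theorem3p2 (R : realType) (d : nat) (d_ge2 : (2 <= d)%N)
    (t : 'Z_d -> morph bool) (l : nat)
    (t_subst : forall i, substitution (t i))
    (t_pos : forall i, positive (t i))
    (t_prol : forall i, prolongable (t i))
    (t_len : forall i, constant_length l (t i)) :
  let s := glued_sequence t in
  let X := ssubshift s 0 in
  minimal_subshift X /\
  exists mu : 'Z_d -> probability (borel_biseq (letter d)) R,
    [/\ forall i j, same_measure (mu i) (mu j) -> i = j,
        forall m, ergodic_measure X m <-> exists i, same_measure m (mu i) &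
        forall i,
          exists (mun : nat -> probability (borel_biseq (letter d)) R)
                 (nu : probability (borel_biseq bool) R),
          [/\ forall n, the_only_measure (induced_measure s (mu i) n) (mun n),
              the_only_measure
                (invariant_measure (substitution_subshift (t i))) nu &
              forall w : seq bool,
                (fun n => mun n (cylinder (in_alphabet i w))) @ \oo -->
                  nu (cylinder w)]].
Proof.
move=> s X; split; first exact: (glued_minimal t_pos t_prol t_len).
have [mu muP] := choice (glued_measure t_pos t_prol t_len R).
have mu_inv i : invariant_measure X (mu i) by have [] := muP i.
have mu_freq i E c : local_set E -> index_class i c ->
    letter_freq s (fun n => (l ^ n.+1)%N) 0 N E c @[N --> \oo] --> prob (mu i) E.
  by have [_ + _] := muP i; exact.
have mu_tower i N : 1 - l%:R ^- N <= prob (mu i) (index_tower t l N i).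
  by have [_ _ +] := muP i; exact.
exists mu; split.
- exact: (glued_measures_distinct t_pos t_prol t_len mu_inv mu_tower).
- move=> m; split.
    exact: (glued_ergodic_unique t_pos t_prol t_len mu_inv mu_freq mu_tower).
  move=> [i mi].
  have [[mX mS] mE] := glued_ergodic t_pos t_prol t_len mu_inv mu_freq mu_tower i.
  have mXX : measurable (X : set (borel_biseq (letter d))).
    by apply: measurable_closed_biseq; exact: closed_ssubshift.
  split; last by move=> E mE' ES; rewrite mi //; exact: mE.
  split; first by rewrite mi.
  move=> E mE'; rewrite /pushforward !mi //; first exact: mS.
  exact: (measurable_bshift 1).
move=> i.
have sL n : headed (l ^ n.+1) (s n) by exact: glued_headed.
have hg n := headed_srange sL 0 n.
have rg n : recognizable (hlen (fun n => (l ^ n.+1)%N) 0 n) (srange s 0 n).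
  by apply: recognizable_srange => // k; exact: glued_recognizable.
have fL := @finite_letter d.
have cX n : closed (ssubshift s n) by exact: closed_ssubshift.
have cover n := X_tower t_pos t_prol t_len n.
have [mun munE] := choice (fun n => induced_exists (hg n) (rg n) fL (mu_inv i)
  (cX 0%N) (cX n) (cover n)).
have munP n := induced_formula (hg n) (rg n) fL (mu_inv i) (cX 0%N) (cX n)
  (fun k y => @ssubshift_bshift _ s n k y) (cover n) (munE n).
have [nu [nuU nuE]] := constant_uniquely_ergodic (t_pos i) (t_prol i) (@t_len i) R.
exists mun, nu; split=> //.
  move=> n; split; first by apply/(induced_measureP t_pos t_prol t_len).
  move=> m /(induced_measureP t_pos t_prol t_len) [mX mE] E mE'.
  rewrite !probE // munE //.
  by rewrite (induced_unique (hg n) (rg n) fL (cX n) mX mE).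
move=> w; rewrite probE; last first.
  apply: measurable_local_biseq.
  by exists (size w); exact: radius_local_cylinder.
apply: cvg_EFin.
  apply: nearW => n; apply: fin_num_measure; apply: measurable_local_biseq.
  by exists (size (in_alphabet i w)); exact: radius_local_cylinder.
suff H n : 1 - l%:R ^- n <= prob (mun n) (index_cylinder i).
  have H2 := @cvg_induced_cylinder _ _ _ t_pos t_prol t_len R i mun nu w
    (fun n => (munP n).1) H nuE.
  exact: H2.
rewrite (prob_induced_index t_pos t_prol t_len i (mu_inv i) (munE n)).
exact: mu_tower.
Qed.
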